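(* Let $\Gamma$ be any (fixed) class of decomposable graphs. There is an $O(nk^2)$-time algorithm that solves the $k$MST problem on edge-weighted graphs in $\Gamma$, where $n$ is the number of nodes of the input graph $G\in\Gamma$ and $G$ is given together with a parse tree, of size $O(n)$, specifying how $G$ is constructed using the rules of $\Gamma$.
   Context: The $k$MST problem: given an undirected graph with nonnegative edge weights and a positive integer $k$, find a tree (a subgraph) of minimum total edge weight spanning at least $k$ nodes. A class of decomposable graphs $\Gamma$ is given by a set of rules satisfying: (1) the number of primitive graphs in $\Gamma$ is finite; (2) each graph in $\Gamma$ has an ordered set of special nodes called terminals, and the number of terminals in each graph is bounded by a constant; (3) there is a finite collection of binary composition rules that operate only at terminals, either by identifying two terminals or by adding an edge between terminals; a composition rule also determines the terminals of the resulting graph, which must be a subset of the terminals of the two graphs being composed. The graphs in $\Gamma$ are those obtained from the primitive graphs by finitely many applications of composition rules; a parse tree of $G\in\Gamma$ records such a construction. The constant hidden in $O(\cdot)$ may depend on $\Gamma$; arithmetic operations on weights are counted as unit cost. *)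

(* Defs.v *)
From HB Require Import structures.
From mathcomp Require Import all_boot all_order all_algebra.
Set Implicit Arguments.
Unset Strict Implicit.
Unset Printing Implicit Defensive.
Import Order.TTheory GRing.Theory Num.Theory.

(* Finite undirected graphs.  Each edge is listed with its two ends in an
   arbitrary order.  Parallel edges are allowed, since identifying terminals
   can create them. *)

Record graph := Graph { nv : nat; ne : nat; ends : 'I_ne -> 'I_nv * 'I_nv }.

Definition joins (T : eqType) (e : T * T) (x y : T) : bool :=
  (e == (x, y)) || (e == (y, x)).

(* A walk from x is the list of its (edge, next vertex) steps. *)
Fixpoint walk (G : graph) (F : {set 'I_(ne G)}) (x : 'I_(nv G))
    (p : seq ('I_(ne G) * 'I_(nv G))) : bool :=
  if p is (e, y) :: p' then [&& e \in F, joins (ends e) x y & walk F y p']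
  else true.

Definition walk_end (G : graph) (x : 'I_(nv G))
  (p : seq ('I_(ne G) * 'I_(nv G))) : 'I_(nv G) := last x (map snd p).

Definition is_subgraph (G : graph) (S : {set 'I_(nv G)}) (F : {set 'I_(ne G)}) :=
  forall e, e \in F -> ((ends e).1 \in S) && ((ends e).2 \in S).

Definition is_connected (G : graph) (S : {set 'I_(nv G)}) (F : {set 'I_(ne G)}) :=
  forall x y, x \in S -> y \in S -> exists p, walk F x p /\ walk_end x p = y.

(* Closed walks of length 1 (loops) and 2 (parallel edges) count as cycles. *)
Definition is_cycle (G : graph) (F : {set 'I_(ne G)}) (x : 'I_(nv G))
    (p : seq ('I_(ne G) * 'I_(nv G))) :=
  [/\ p != [::], walk F x p, walk_end x p = x,
      uniq (map fst p) & uniq (map snd p)].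

Definition is_tree (G : graph) (S : {set 'I_(nv G)}) (F : {set 'I_(ne G)}) :=
  [/\ S != set0, is_subgraph S F, is_connected S F
    & forall x p, ~ is_cycle F x p].

Definition weight (R : realDomainType) (G : graph) (w : 'I_(ne G) -> R)
  (F : {set 'I_(ne G)}) : R := (\sum_(e in F) w e)%R.

Definition is_kmst (R : realDomainType) (G : graph) (w : 'I_(ne G) -> R)
    (k : nat) (S : {set 'I_(nv G)}) (F : {set 'I_(ne G)}) :=
  [/\ is_tree S F, k <= #|S|
    & forall S' F', is_tree S' F' -> k <= #|S'| ->
        (weight w F <= weight w F')%R].

(* Classes of decomposable graphs. *)

Record tgraph := TGraph { tg :> graph; terms : seq 'I_(nv tg) }.

(* In an operation, i and j are indices in the concatenation of the terminal
   lists of the left and right operands. *)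
Inductive term_op :=
  | Identify of nat & nat
  | AddEdge of nat & nat.

(* A rule applies to operands with larity and rarity terminals.  It performs
   ops in order; result lists the terminals of the composed graph, again as
   indices in the concatenated terminal list. *)
Record crule := CRule {
  larity : nat; rarity : nat; ops : seq term_op; result : seq nat }.

Record gclass := GClass { prims : seq tgraph; rules : seq crule }.

(* A graph under construction.  The entries of bverts are the leaf vertices of
   the parse tree, from left to right; leaf vertices that have been identified
   carry the same name.  The vertex set is thus the set of names in bverts, and
   bedges and bterms refer to these names.  All names are less than
   size bverts. *)
Record built := Built {
  bverts : seq nat; bedges : seq (nat * nat); bterms : seq nat }.

Definition rename (f : nat -> nat) (A : built) : built :=
  Built (map f (bverts A)) [seq (f e.1, f e.2) | e <- bedges A]
        (map f (bterms A)).

Definition built_prim (p : tgraph) : built :=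
  Built (iota 0 (nv p))
        [seq (val (ends e).1, val (ends e).2) | e <- enum 'I_(ne p)]
        (map val (terms p)).

Definition disj_union (A B : built) : built :=
  let B' := rename (addn (size (bverts A))) B in
  Built (bverts A ++ bverts B') (bedges A ++ bedges B') (bterms A ++ bterms B').

Definition apply_op (A : built) (o : term_op) : built :=
  match o with
  | Identify i j =>
      let a := nth 0 (bterms A) i in let b := nth 0 (bterms A) j in
      rename (fun x => if x == b then a else x) A
  | AddEdge i j =>
      let a := nth 0 (bterms A) i in let b := nth 0 (bterms A) j in
      Built (bverts A) (rcons (bedges A) (a, b)) (bterms A)
  end.

Definition compose (r : crule) (A B : built) : built :=
  let D := foldl apply_op (disj_union A B) (ops r) in
  Built (bverts D) (bedges D) [seq nth 0 (bterms D) i | i <- result r].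

Definition prim_ok (tau : nat) (p : tgraph) : bool :=
  [&& 0 < nv p, uniq (terms p) & size (terms p) <= tau].

Definition op_ok (m : nat) (o : term_op) : bool :=
  match o with Identify i j | AddEdge i j => (i < m) && (j < m) end.

(* m isolated vertices, all of them terminals. *)
Definition discrete (m : nat) : built := Built (iota 0 m) [::] (iota 0 m).

(* The last condition says that the resulting terminals are pairwise distinct
   as vertices; this depends only on the identifications made by the rule, so
   it can be tested on discrete operands. *)
Definition rule_ok (tau : nat) (r : crule) : bool :=
  [&& all (op_ok (larity r + rarity r)) (ops r),
      all (fun i => i < larity r + rarity r) (result r),
      size (result r) <= tau
    & uniq (bterms (compose r (discrete (larity r)) (discrete (rarity r))))].

(* tau bounds the number of terminals of the graphs in the class. *)
Definition class_ok (tau : nat) (Gamma : gclass) : bool :=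
  all (prim_ok tau) (prims Gamma) && all (rule_ok tau) (rules Gamma).

(* Parse trees of a graph with vertices 'I_n and edges 'I_m.  A leaf holds the
   index of a primitive graph, and the vertices and edges of the parsed graph
   that correspond to those of the primitive.  An internal node holds the index
   of a rule, and the edges of the parsed graph that correspond to the AddEdge
   operations of the rule. *)
Inductive ptree (n m : nat) :=
  | PLeaf of nat & seq 'I_n & seq 'I_m
  | PNode of nat & seq 'I_m & ptree n m & ptree n m.

Fixpoint psize n m (t : ptree n m) : nat :=
  match t with
  | PLeaf _ _ _ => 1
  | PNode _ _ t1 t2 => (psize t1 + psize t2).+1
  end.

Fixpoint pverts n m (t : ptree n m) : seq 'I_n :=
  match t with
  | PLeaf _ vs _ => vs
  | PNode _ _ t1 t2 => pverts t1 ++ pverts t2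
  end.

(* In the order in which build lists the edges. *)
Fixpoint pedges n m (t : ptree n m) : seq 'I_m :=
  match t with
  | PLeaf _ _ es => es
  | PNode _ es t1 t2 => (pedges t1 ++ pedges t2) ++ es
  end.

Definition is_add (o : term_op) : bool := if o is AddEdge _ _ then true else false.

Fixpoint build (Gamma : gclass) n m (t : ptree n m) : option built :=
  match t with
  | PLeaf i vs es =>
      if onth (prims Gamma) i is Some p then
        if (size vs == nv p) && (size es == ne p) then Some (built_prim p)
        else None
      else None
  | PNode i es t1 t2 =>
      match onth (rules Gamma) i, build Gamma t1, build Gamma t2 with
      | Some r, Some A, Some B =>
          if [&& size (bterms A) == larity r, size (bterms B) == rarity r
               & size es == count is_add (ops r)]
          then Some (compose r A B) else None
      | _, _, _ => None
      end
  end.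

(* The annotations of t define an isomorphism phi from the graph built by t
   onto G. *)
Definition parses (Gamma : gclass) (G : graph) (t : ptree (nv G) (ne G)) :=
  exists (A : built) (phi : nat -> 'I_(nv G)),
    [/\ build Gamma t = Some A,
        {in bverts A &, injective phi},
        pverts t = map phi (bverts A) /\ (forall x, x \in pverts t),
        perm_eq (pedges t) (enum 'I_(ne G))
      & all2 (fun e (ab : nat * nat) => joins (ends e) (phi ab.1) (phi ab.2))
             (pedges t) (bedges A)].

(* Unit-cost random access machine, programmed in a structured language.  The
   memory consists of arrays of natural numbers and arrays of weights, of which
   a program mentions only finitely many; array names are constants, indices
   are computed.  The only operations on numbers are addition, truncated
   subtraction and comparison, and the same holds for weights (with exact
   subtraction); integer multiplication is deliberately left out.  Each
   operation, memory access and test costs 1. *)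

Inductive nexp :=
  | NConst of nat
  | NGet of nat & nexp
  | NAdd of nexp & nexp
  | NSub of nexp & nexp.

Inductive wexp :=
  | WZero
  | WGet of nat & nexp
  | WAdd of wexp & wexp
  | WSub of wexp & wexp.

Inductive bexp :=
  | BLe of nexp & nexp
  | BWLe of wexp & wexp
  | BNot of bexp.

Inductive com :=
  | Skip
  | NSet of nat & nexp & nexp
  | WSet of nat & nexp & wexp
  | Seq of com & com
  | If of bexp & com & com
  | While of bexp & com.

Record state (R : Type) := State { nmem : nat -> nat -> nat; wmem : nat -> nat -> R }.

Definition upd (T : Type) (f : nat -> nat -> T) (a i : nat) (v : T) :=
  fun a' i' => if (a' == a) && (i' == i) then v else f a' i'.

Fixpoint neval (R : Type) (s : state R) (e : nexp) : nat :=
  match e with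
  | NConst c => c
  | NGet a i => nmem s a (neval s i)
  | NAdd e1 e2 => neval s e1 + neval s e2
  | NSub e1 e2 => neval s e1 - neval s e2
  end.

Fixpoint weval (R : realDomainType) (s : state R) (e : wexp) : R :=
  match e with
  | WZero => 0%R
  | WGet a i => wmem s a (neval s i)
  | WAdd e1 e2 => (weval s e1 + weval s e2)%R
  | WSub e1 e2 => (weval s e1 - weval s e2)%R
  end.

Fixpoint beval (R : realDomainType) (s : state R) (b : bexp) : bool :=
  match b with
  | BLe e1 e2 => neval s e1 <= neval s e2
  | BWLe e1 e2 => (weval s e1 <= weval s e2)%R
  | BNot b1 => ~~ beval s b1
  end.

Fixpoint ncost (e : nexp) : nat :=
  match e with
  | NConst _ => 1
  | NGet _ i => (ncost i).+1
  | NAdd e1 e2 | NSub e1 e2 => (ncost e1 + ncost e2).+1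
  end.

Fixpoint wcost (e : wexp) : nat :=
  match e with
  | WZero => 1
  | WGet _ i => (ncost i).+1
  | WAdd e1 e2 | WSub e1 e2 => (wcost e1 + wcost e2).+1
  end.

Fixpoint bcost (b : bexp) : nat :=
  match b with
  | BLe e1 e2 => (ncost e1 + ncost e2).+1
  | BWLe e1 e2 => (wcost e1 + wcost e2).+1
  | BNot b1 => (bcost b1).+1
  end.

(* exec P s T s': started in s, P halts in s' after T steps. *)
Inductive exec (R : realDomainType) : com -> state R -> nat -> state R -> Prop :=
  | ESkip s : exec Skip s 1 s
  | ENSet a i e s :
      exec (NSet a i e) s (ncost i + ncost e).+1
        (State (upd (nmem s) a (neval s i) (neval s e)) (wmem s))
  | EWSet a i e s :
      exec (WSet a i e) s (ncost i + wcost e).+1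
        (State (nmem s) (upd (wmem s) a (neval s i) (weval s e)))
  | ESeq c1 c2 s s1 s2 T1 T2 :
      exec c1 s T1 s1 -> exec c2 s1 T2 s2 -> exec (Seq c1 c2) s (T1 + T2) s2
  | EIfTrue b c1 c2 s s1 T :
      beval s b -> exec c1 s T s1 -> exec (If b c1 c2) s (bcost b + T).+1 s1
  | EIfFalse b c1 c2 s s1 T :
      ~~ beval s b -> exec c2 s T s1 -> exec (If b c1 c2) s (bcost b + T).+1 s1
  | EWhileTrue b c s s1 s2 T1 T2 :
      beval s b -> exec c s T1 s1 -> exec (While b c) s1 T2 s2 ->
      exec (While b c) s (bcost b + T1 + T2).+1 s2
  | EWhileFalse b c s :
      ~~ beval s b -> exec (While b c) s (bcost b).+1 s.

(* Input: array 0 holds k, the numbers of nodes and edges, and the length of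
   the code of the parse tree; arrays 1 and 2 hold the ends of the edges; array
   3 holds the parse tree in postfix order; weight array 0 holds the weights.
   Everything else is zero. *)

Fixpoint code n m (t : ptree n m) : seq nat :=
  match t with
  | PLeaf i vs es => 0 :: i :: map val vs ++ map val es
  | PNode i es t1 t2 => code t1 ++ code t2 ++ 1 :: i :: map val es
  end.

Definition input (R : realDomainType) (G : graph) (w : 'I_(ne G) -> R)
    (t : ptree (nv G) (ne G)) (k : nat) : state R :=
  State
    (fun a i => nth 0 (nth [::]
       [:: [:: k; nv G; ne G; size (code t)];
           [seq val (ends e).1 | e <- enum 'I_(ne G)];
           [seq val (ends e).2 | e <- enum 'I_(ne G)];
           code t] a) i)
    (fun a i => nth 0%R (nth [::] [:: [seq w e | e <- enum 'I_(ne G)]] a) i).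

(* Output: cell 0 of array 4 is nonzero if a tree is returned; arrays 5 and 6
   are then the characteristic functions of its nodes and edges. *)

Definition out_found (R : Type) (s : state R) : bool := nmem s 4 0 != 0.

Definition out_nodes (R : Type) (G : graph) (s : state R) : {set 'I_(nv G)} :=
  [set x : 'I_(nv G) | nmem s 5 x != 0].

Definition out_edges (R : Type) (G : graph) (s : state R) : {set 'I_(ne G)} :=
  [set e : 'I_(ne G) | nmem s 6 e != 0].

Definition solves_kmst (R : realDomainType) (G : graph) (w : 'I_(ne G) -> R)
    (k : nat) (s : state R) : Prop :=
  if out_found s then is_kmst w k (out_nodes G s) (out_edges G s)
  else forall S F, @is_tree G S F -> #|S| < k.

(* Main.v *)
Require Import Defs.
From mathcomp Require Import all_boot all_order all_algebra.
From mathcomp Require Import zify.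

(** Dynamic programming along the parse tree.  A partial solution of a graph
    under construction is a forest in which every component either reaches a
    terminal or is the whole solution; all that matters for its extension is
    which terminals it contains and which of them it connects, together with
    the number of selected non-terminals, which never decreases and can
    therefore be truncated at k.  There are finitely many such states, so the
    partial solutions are the runs of a finite tree automaton on the parse tree,
    and the cheapest run for each state and each count up to k is found in
    O(k^2) steps per node.  The program tabulates these runs in postorder and
    reads off an optimal one from the root downwards.  Since weights are
    nonnegative, replacing a solution by a spanning forest of its edges loses
    nothing. *)

Set Implicit Arguments.
Unset Strict Implicit.
Unset Printing Implicit Defensive.
Import Order.TTheory GRing.Theory Num.Theory.

(** * Connectivity and forests as functions of an edge list *)

(** What the automaton remembers must survive the identification of terminals, which makes vertices
    disappear. On edge lists, identifying two distinct terminals acts on connectivity and acyclicity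
    exactly as adding an edge between them. Hence [conn] and [forest] are recursive boolean
    functions of a list, and the automaton updates its relations by the very formula that defines
    [conn]. A vertex is counted when it ceases to be a terminal; from then on it can no longer be
    identified with another one. The automaton depends neither on k nor on n, so its transitions are
    unrolled into the text of the program; genuine loops run only over the nodes of the tree and
    over two counts. The machine has neither multiplication nor a stack. Tables of k + 1 entries
    therefore lie consecutively in postorder, addresses arise by adding k + 1, and the operands of a
    node are found through the stored address of the first table of each subtree. Truncating counts
    is harmless because min(k, min(k,a) + min(k,b) + d) = min(k, a + b + d). *)

Fixpoint conn (T : eqType) (L : seq (T * T)) (x y : T) : bool :=
  if L is e :: L' then
    [|| conn L' x y, conn L' x e.1 && conn L' e.2 y
      | conn L' x e.2 && conn L' e.1 y]
  else x == y.

(** The list is built up from its end, and each edge must join two different components of what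
    follows it. This excludes loops and parallel edges, since [conn] is reflexive and contains the
    listed edges. *)
Fixpoint forest (T : eqType) (L : seq (T * T)) : bool :=
  if L is e :: L' then ~~ conn L' e.1 e.2 && forest L' else true.

Lemma conn_refl (T : eqType) (L : seq (T * T)) x : conn L x x.
Proof. by elim: L => [|e L IH] /=; rewrite ?eqxx ?IH. Qed.

Lemma conn_sym (T : eqType) (L : seq (T * T)) x y : conn L x y = conn L y x.
Proof.
elim: L x y => [|e L IH] x y /=; first exact: eq_sym.
rewrite (IH x y) (IH x e.1) (IH e.2 y) (IH x e.2) (IH e.1 y).
by do 5!case: (conn L _ _).
Qed.

Lemma conn_trans (T : eqType) (L : seq (T * T)) : transitive (conn L).
Proof.
elim: L => [|e L IH] y x z /=; first by move=> /eqP-> /eqP->.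
have tr a b c : conn L a b -> conn L b c -> conn L a c by apply: IH.
have sy a b : conn L a b -> conn L b a by rewrite conn_sym.
case/or3P=> [H1|/andP[H1 H2]|/andP[H1 H2]]
  /or3P[H3|/andP[H3 H4]|/andP[H3 H4]]; apply/or3P.
- by apply: Or31; apply: tr H3.
- by apply: Or32; rewrite (tr _ _ _ H1 H3).
- by apply: Or33; rewrite (tr _ _ _ H1 H3).
- by apply: Or32; rewrite H1 (tr _ _ _ H2 H3).
- by apply: Or32; rewrite H1 H4.
- by apply: Or31; exact: tr H4.
- by apply: Or33; rewrite H1 (tr _ _ _ H2 H3).
- by apply: Or31; exact: tr H4.
- by apply: Or33; rewrite H1 H4.
Qed.

Lemma conn_edge (T : eqType) (L : seq (T * T)) e :
  e \in L -> conn L e.1 e.2.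
Proof.
elim: L => //= e' L IH; rewrite inE => /orP[/eqP<-|/IH->//].
by rewrite !conn_refl /= orbT.
Qed.

(** Universal property of [conn L] as the equivalence relation generated by the edges; monotonicity
    and the invariance of predicates along connections are instances of it. *)
Lemma conn_least (T : eqType) (r : rel T) (L : seq (T * T)) :
  reflexive r -> symmetric r -> transitive r ->
  {in L, forall e, r e.1 e.2} -> subrel (conn L) r.
Proof.
move=> rr rs rt; elim: L => [|e L IH] He x y /=; first by move/eqP->.
have IH' := IH (fun e' h => He e' (mem_behead (s := e :: L) h)).
have re : r e.1 e.2 by apply: He; rewrite mem_head.
case/or3P=> [/IH'//|/andP[/IH' h1 /IH' h2]|/andP[/IH' h1 /IH' h2]].
  exact: rt h1 (rt _ _ _ re h2).
by apply: (rt _ _ _ h1); apply: rt h2; rewrite rs.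
Qed.

Lemma conn_sub (T : eqType) (L L' : seq (T * T)) :
  {in L, forall e, conn L' e.1 e.2} -> subrel (conn L) (conn L').
Proof.
apply: conn_least; [exact: conn_refl|exact: conn_sym|exact: conn_trans].
Qed.

Lemma conn_mono (T : eqType) (L L' : seq (T * T)) :
  {subset L <= L'} -> subrel (conn L) (conn L').
Proof. by move=> sLL'; apply: conn_sub => e /sLL'/conn_edge. Qed.

Lemma eq_conn (T : eqType) (L L' : seq (T * T)) :
  L =i L' -> conn L =2 conn L'.
Proof.
by move=> e x y; apply/idP/idP; apply: conn_mono => z; rewrite e.
Qed.

Lemma conn_inv (T : eqType) (P : pred T) (L : seq (T * T)) x y :
  {in L, forall e, P e.1 = P e.2} -> conn L x y -> P x = P y.
Proof.
move=> HL /(@conn_least _ (fun x y => P x == P y)) H; apply/eqP/H.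
- by move=> z; exact: eqxx.
- by move=> a b; exact: eq_sym.
- by move=> a b c /eqP-> /eqP->.
- by move=> e /HL->.
Qed.

Lemma conn_isolated (T : eqType) (L : seq (T * T)) x y :
  {in L, forall e, (e.1 != x) && (e.2 != x)} -> conn L x y = (x == y).
Proof.
move=> HL; apply/idP/eqP=> [|->]; last exact: conn_refl.
move/(conn_inv (P := pred1 x)) => /= H; apply/esym/eqP.
rewrite -H ?eqxx // => e /HL /andP[h1 h2].
by rewrite /= (negPf h1) (negPf h2).
Qed.

(** In either order the condition is symmetric: neither edge closes a cycle by itself, and the two
    do not join the same pair of components. Once the symmetric instances of [conn] are aligned,
    this is propositional. Invariance under all permutations follows. *)
Lemma forest_swap (T : eqType) e1 e2 (L : seq (T * T)) :
  forest (e1 :: e2 :: L) = forest (e2 :: e1 :: L).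
Proof.
rewrite /= !andbA; congr (_ && _); case: e1 e2 => [a b] [c d] /=.
rewrite (conn_sym L c a) (conn_sym L d b) (conn_sym L c b).
by do 6!case: (conn L _ _).
Qed.

Lemma forest_cat_cons (T : eqType) (L1 : seq (T * T)) e L2 :
  forest (L1 ++ e :: L2) = forest (e :: L1 ++ L2).
Proof.
elim: L1 => // e' L1 IH.
transitivity (forest (e' :: e :: L1 ++ L2)); last exact: forest_swap.
rewrite [LHS]/= IH [RHS]/=; congr (~~ _ && _).
by apply: (@eq_conn _ (L1 ++ e :: L2) (e :: L1 ++ L2)) => z;
  rewrite inE !mem_cat inE orbCA.
Qed.

Lemma perm_forest (T : eqType) (L1 L2 : seq (T * T)) :
  perm_eq L1 L2 -> forest L1 = forest L2.
Proof.
elim: L1 L2 => [|e L1 IH] L2; first by rewrite perm_sym => /perm_nilP->.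
move=> pe; have he : e \in L2 by rewrite -(perm_mem pe) mem_head.
move: pe; case/splitPr: he => p1 p2 pe.
rewrite forest_cat_cons /=.
have pe' : perm_eq L1 (p1 ++ p2).
  by rewrite -(perm_cons e) (perm_trans pe) // perm_catC /= perm_cons perm_catC.
by rewrite (eq_conn (perm_mem pe')) (IH _ pe').
Qed.

(** [P] marks one side of a disjoint union. Induction strips the edges of [L1]; with none left, the
    points of [P] are isolated. *)
Lemma conn_catl (T : eqType) (P : pred T) (L1 L2 : seq (T * T)) x y :
  {in L1, forall e, P e.1 && P e.2} -> {in L2, forall e, ~~ P e.1 && ~~ P e.2} ->
  P x -> P y -> conn (L1 ++ L2) x y = conn L1 x y.
Proof.
move=> H1 H2; elim: L1 x y H1 => [|e L1 IH] x y H1 Px Py /=.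
  apply: conn_isolated => e /H2 /andP[p1 p2].
  by apply/andP; split; apply/eqP => ex; rewrite ex Px in p1 p2.
have /andP[Pe1 Pe2] := H1 e (mem_head _ _).
have H1' : {in L1, forall e, P e.1 && P e.2}.
  by move=> e' h; apply: H1; rewrite inE h orbT.
by rewrite !IH.
Qed.

Lemma forest_cat (T : eqType) (P : pred T) (L1 L2 : seq (T * T)) :
  {in L1, forall e, P e.1 && P e.2} -> {in L2, forall e, ~~ P e.1 && ~~ P e.2} ->
  forest (L1 ++ L2) = forest L1 && forest L2.
Proof.
move=> H1 H2; elim: L1 H1 => //= e L1 IH H1.
have /andP[Pe1 Pe2] := H1 e (mem_head _ _).
have H1' : {in L1, forall e, P e.1 && P e.2}.
  by move=> e' h; apply: H1; rewrite inE h orbT.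
by rewrite (conn_catl H1' H2) // IH // andbA.
Qed.

Definition map_pair (T U : Type) (f : T -> U) (e : T * T) := (f e.1, f e.2).

Lemma conn_map (T U : eqType) (f : T -> U) (P : pred T) (L : seq (T * T)) x y :
  {in P &, injective f} -> {in L, forall e, P e.1 && P e.2} -> P x -> P y ->
  conn (map (map_pair f) L) (f x) (f y) = conn L x y.
Proof.
move=> fi; elim: L x y => [|e L IH] x y HL Px Py /=.
  by apply/eqP/eqP=> [/fi->//|->].
have /andP[Pe1 Pe2] := HL e (mem_head _ _).
have HL' : {in L, forall e, P e.1 && P e.2}.
  by move=> e' h; apply: HL; rewrite inE h orbT.
by rewrite !IH.
Qed.

Lemma forest_map (T U : eqType) (f : T -> U) (P : pred T) (L : seq (T * T)) :
  {in P &, injective f} -> {in L, forall e, P e.1 && P e.2} ->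
  forest (map (map_pair f) L) = forest L.
Proof.
move=> fi; elim: L => //= e L IH HL.
have /andP[Pe1 Pe2] := HL e (mem_head _ _).
have HL' : {in L, forall e, P e.1 && P e.2}.
  by move=> e' h; apply: HL; rewrite inE h orbT.
by rewrite (conn_map fi) // IH.
Qed.

Definition glue (T : eqType) (a b x : T) := if x == b then a else x.

(* Identifying two vertices has the same effect on connectivity and on
   acyclicity as adding an edge between them. *)
Lemma conn_glue (T : eqType) (a b : T) (L : seq (T * T)) x y :
  conn (map (map_pair (glue a b)) L) (glue a b x) (glue a b y) =
  conn ((a, b) :: L) x y.
Proof.
elim: L x y => [|e L IH] x y.
  rewrite /= /glue; case: (eqVneq x b) => [->|nx]; case: (eqVneq y b) => [->|ny].
  - by rewrite eqxx.
  - by rewrite andbF.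
  - by rewrite (negPf nx) andbT orbF.
  - by rewrite andbF orbF.
transitivity (conn (e :: (a, b) :: L) x y); last first.
  by apply: eq_conn => z; rewrite !inE orbCA.
by rewrite [LHS]/= !IH.
Qed.

(** For [a = b] gluing changes nothing, whereas the added edge would be a loop. This is why [a == b]
    appears as a separate alternative in [sol_glue] and, as [sm i j], in [ops_step]. *)
Lemma forest_glue (T : eqType) (a b : T) (L : seq (T * T)) : a != b ->
  forest (map (map_pair (glue a b)) L) = forest ((a, b) :: L).
Proof.
move=> nab; elim: L => [|e L IH]; first by rewrite /= nab.
by rewrite -forest_swap [LHS]/= IH conn_glue.
Qed.

Lemma glue_refl (T : eqType) (a : T) : glue a a =1 id.
Proof. by move=> x; rewrite /glue; case: eqP => // ->. Qed.

(* Greedy choice of a spanning forest of the edges marked in em. *)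
Fixpoint span_mask (T : eqType) (em : bitseq) (L : seq (T * T)) : bitseq :=
  match em, L with
  | b :: em', e :: L' =>
      (b && ~~ conn (mask em' L') e.1 e.2) :: span_mask em' L'
  | _, _ => [::]
  end.

Lemma size_span_mask (T : eqType) em (L : seq (T * T)) :
  size em = size L -> size (span_mask em L) = size L.
Proof. by elim: em L => [|b em IH] [|e L] //= [/IH->]. Qed.

Lemma conn_span (T : eqType) em (L : seq (T * T)) :
  conn (mask (span_mask em L) L) =2 conn (mask em L).
Proof.
elim: em L => [|b em IH] [|e L] //= x y; case: b => /=; last exact: IH.
case: ifP => c /=; first by rewrite !IH.
have {}c : conn (mask em L) e.1 e.2 by move/negbFE: c.
rewrite IH; apply/idP/idP => [->//|].
case/or3P=> [//|/andP[h1 h2]|/andP[h1 h2]].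
  exact: conn_trans h1 (conn_trans c h2).
by apply: conn_trans h1 (conn_trans _ h2); rewrite conn_sym.
Qed.

Lemma forest_span (T : eqType) em (L : seq (T * T)) :
  forest (mask (span_mask em L) L).
Proof.
elim: em L => [|b em IH] [|e L] //=; case: b => //=.
by case: ifP => //= c; rewrite conn_span c IH.
Qed.

(** The second list [P] is arbitrary so that the inclusion also applies to the edges of the graph
    listed in parallel with [L]. *)
Lemma mask_span_sub (T U : eqType) em (L : seq (T * T)) (P : seq U) :
  {subset mask (span_mask em L) P <= mask em P}.
Proof.
elim: em L P => [|b em IH] [|e L] [|p P] //=; rewrite ?mask0 //.
move=> z; case: b => /=; last exact: IH.
by case: ifP => _; rewrite ?inE; [case/orP=> [->//|]|]; move/IH=> ->; rewrite orbT.
Qed.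

(** * Partial solutions *)

(* A partial solution selects the vertices x with s x and the edges in L.  It
   is open (cl = false) when each of its components reaches a terminal, and
   closed when it is a single component without terminals, which can then no
   longer be extended. *)
Definition sol (V T : seq nat) (s : nat -> bool) (L : seq (nat * nat))
    (cl : bool) : Prop :=
  [/\ {in L, forall e, [&& s e.1, s e.2, e.1 \in V & e.2 \in V]}, forest L
    & if cl then
        [/\ {in T, forall t, ~~ s t}, exists2 x, x \in V & s x
          & {in V &, forall x y, s x -> s y -> conn L x y}]
      else {in V, forall x, s x -> has (conn L x) T}].

(** Terminals are left out because they may still be identified with one another. The list [V]
    repeats the name of an identified vertex, hence [undup]. *)
Definition cnt (V T : seq nat) (s : nat -> bool) : nat :=
  size (undup [seq x <- V | s x && (x \notin T)]).

(** * Effect of the elementary operations on partial solutions *)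

Lemma sol_conn V T s L cl x y : sol V T s L cl -> conn L x y -> s x = s y.
Proof. by case=> He _ _; apply: conn_inv => e /He /and4P[-> ->]. Qed.

Lemma sol_ext V T s s' L cl : {subset T <= V} -> {in V, s =1 s'} ->
  sol V T s L cl -> sol V T s' L cl.
Proof.
move=> sTV es [He HL Hc]; split=> //.
  by move=> e /He /and4P[s1 s2 v1 v2]; rewrite -!es // s1 s2 v1.
case: cl Hc => [[h1 [x xV sx] h3]|h].
  split.
  - by move=> t tT; rewrite -es ?h1 // sTV.
  - by exists x; rewrite -?es.
  - by move=> y z yV zV; rewrite -!es //; apply: h3.
by move=> x xV; rewrite -es //; apply: h.
Qed.

Lemma sol_perm V T s L L' cl :
  perm_eq L L' -> sol V T s L cl -> sol V T s L' cl.
Proof.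
move=> pL [He HL Hc]; have eqc := eq_conn (perm_mem pL); split.
- by move=> e; rewrite -(perm_mem pL); apply: He.
- by rewrite -(perm_forest pL).
- case: cl Hc => [[h1 h2 h3]|h]; first by split=> // x y xV yV; rewrite -eqc; apply: h3.
  by move=> x xV sx; rewrite (eq_has (a2 := conn L x)) ?h // => y; rewrite eqc.
Qed.

(** A path through the new edge meets a terminal, [a] or [b], before using it. *)
Lemma conn_add_term (T : seq nat) (L : seq (nat * nat)) a b x :
  a \in T -> b \in T -> has (conn ((a, b) :: L) x) T = has (conn L x) T.
Proof.
move=> aT bT; apply/hasP/hasP=> [[t tT /=]|[t tT h]]; last by exists t => //=; rewrite h.
by case/or3P=> [h|/andP[h _]|/andP[h _]]; [exists t | exists a | exists b].
Qed.

(** The selection is pulled back along the gluing map, so both glued terminals are selected or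
    neither is. Gluing distinct terminals that are already connected would close a cycle. An open
    solution stays open because the glued vertex is a terminal; in a closed one that vertex is
    unselected, so no connection passes through it. *)
Lemma sol_glue V T s L cl a b :
  a \in T -> b \in T -> {subset T <= V} ->
  {in L, forall e, (e.1 \in V) && (e.2 \in V)} ->
  sol (map (glue a b) V) (map (glue a b) T) s (map (map_pair (glue a b)) L) cl
  <-> sol V T (s \o glue a b) L cl /\ (a == b) || ~~ conn L a b.
Proof.
move=> aT bT sTV LV; set f := glue a b.
have fV x : x \in V -> f x \in map f V by move=> xV; apply: map_f.
have cf x y : conn (map (map_pair f) L) (f x) (f y) = conn ((a, b) :: L) x y.
  exact: conn_glue.
have fl : forest (map (map_pair f) L) = ((a == b) || ~~ conn L a b) && forest L.
  case: (eqVneq a b) => [eab|nab]; last by rewrite forest_glue.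
  rewrite /f -eab; congr forest; rewrite -[RHS]map_id; apply: eq_map => -[x y].
  by rewrite /map_pair !glue_refl.
have hf x : has (conn (map (map_pair f) L) (f x)) (map f T) = has (conn L x) T.
  rewrite has_map (eq_has (a2 := conn ((a, b) :: L) x)); last by move=> y /=; exact: cf.
  exact: conn_add_term.
split.
  case=> He HL Hc; move: HL; rewrite fl => /andP[nab fL]; split=> //; split=> //.
    move=> e eL; have /andP[-> ->] := LV e eL; rewrite /= !andbT.
    by have /He/and4P[/= -> -> _ _] := map_f (map_pair f) eL.
  case: cl Hc => [[h1 [x' /mapP[x xV ->] sx] h3]|h].
    split.
    - by move=> t tT; apply: h1; apply: map_f.
    - by exists x.
    - move=> y z yV zV sy sz; have := h3 _ _ (fV _ yV) (fV _ zV) sy sz.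
      rewrite cf /= => /or3P[//|/andP[hya _]|/andP[hyb _]].
        have sa : (s \o f) a.
          have <- // := conn_inv (P := s \o f) _ hya.
          move=> e eL; have /He/and4P[/= s1 s2 _ _] := map_f (map_pair f) eL.
          by rewrite s1 s2.
        by case/negP: (h1 _ (map_f f aT)).
      have sb : (s \o f) b.
        have <- // := conn_inv (P := s \o f) _ hyb.
        move=> e eL; have /He/and4P[/= s1 s2 _ _] := map_f (map_pair f) eL.
        by rewrite s1 s2.
      by case/negP: (h1 _ (map_f f bT)).
  by move=> x xV sx; rewrite -hf; apply: h; rewrite ?fV.
case=> -[He HL Hc] nab; split.
- move=> e' /mapP[e eL ->]; have /He/and4P[/= -> -> v1 v2] := eL.
  by rewrite !fV.
- by rewrite fl nab.
- case: cl Hc => [[h1 [x xV sx] h3]|h].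
    split.
    + by move=> t' /mapP[t tT ->]; apply: h1.
    + by exists (f x); rewrite ?fV.
    + move=> y' z' /mapP[y yV ->] /mapP[z zV ->] sy sz; rewrite cf /=.
      by rewrite h3.
  by move=> x' /mapP[x xV ->] sx; rewrite hf; apply: h.
Qed.

(** The ends of a selected new edge are selected terminals, which a closed solution does not have;
    the case [cl = true] is therefore contradictory in both directions. *)
Lemma sol_add V T s L cl a b :
  a \in T -> b \in T -> {subset T <= V} ->
  sol V T s ((a, b) :: L) cl <->
  sol V T s L cl /\ [&& s a, s b & ~~ conn L a b].
Proof.
move=> aT bT sTV; split.
  case=> He /= /andP[nab fL] Hc.
  have /He/and4P[/= sa sb _ _] : (a, b) \in (a, b) :: L by rewrite mem_head.
  rewrite sa sb nab; split=> //; split=> //.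
    by move=> e eL; apply: He; rewrite inE eL orbT.
  case: cl Hc => [[h1 _ _]|h]; first by have := h1 _ aT; rewrite sa.
  by move=> x xV sx; rewrite -(conn_add_term _ _ aT bT); apply: h.
case=> -[He fL Hc] /and3P[sa sb nab]; split.
- by move=> e; rewrite inE => /orP[/eqP->/=|/He//]; rewrite sa sb !sTV.
- by rewrite /= nab.
- case: cl Hc => [[h1 _ _]|h]; first by have := h1 _ aT; rewrite sa.
  by move=> x xV sx; rewrite conn_add_term //; apply: h.
Qed.

(** The flags [ne1] and [ne2] say whether a terminal is selected, which for an open solution amounts
    to being nonempty ([sol_open_empty]). A closed solution can only be combined with an empty one,
    since its component can never be joined to anything else. *)
Definition union_cl (ne1 ne2 cl1 cl2 : bool) : option bool :=
  match cl1, cl2 with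
  | false, false => Some false
  | true, false => if ne2 then None else Some true
  | false, true => if ne1 then None else Some true
  | true, true => None
  end.

Lemma sol_open_empty V T s L : sol V T s L false -> ~~ has s T ->
  {in V, forall x, ~~ s x}.
Proof.
move=> hs /hasPn nT x xV; apply/negP=> sx; case: (hs) => _ _ /(_ x xV sx).
by case/hasP=> t tT /(sol_conn hs); rewrite sx => /esym st; have := nT t tT; rewrite st.
Qed.

Lemma conn_union N (V1 V2 : seq nat) (L1 L2 : seq (nat * nat)) x y :
  {in V1, forall x, x < N} ->
  {in L1, forall e, (e.1 \in V1) && (e.2 \in V1)} ->
  {in L2, forall e, (e.1 \in V2) && (e.2 \in V2)} ->
  conn (L1 ++ map (map_pair (addn N)) L2) x y =
  if x < N then (y < N) && conn L1 x y else (N <= y) && conn L2 (x - N) (y - N).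
Proof.
move=> V1N LV1 LV2; set L2' := map _ L2.
have P1 : {in L1, forall e, (e.1 < N) && (e.2 < N)}.
  by move=> e /LV1 /andP[h1 h2]; rewrite !V1N.
have P2 : {in L2', forall e, ~~ (e.1 < N) && ~~ (e.2 < N)}.
  by move=> e' /mapP[e _ ->] /=; rewrite -!leqNgt !leq_addr.
case: (boolP ((x < N) == (y < N))) => [/eqP exy|nxy]; last first.
  have -> : conn (L1 ++ L2') x y = false.
    apply/negP => /(conn_inv (P := fun z => z < N)) H.
    move: nxy; rewrite H ?eqxx // => e.
    by rewrite mem_cat => /orP[/P1/andP[-> ->]//|/P2/andP[/negPf-> /negPf->]//].
  by move: nxy; case: (ltnP x N); case: (ltnP y N).
rewrite [N <= y]leqNgt -exy; case: (ltnP x N) => hx /=.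
  by rewrite (@conn_catl _ (fun z => z < N) _ _ _ _ P1 P2) -?exy.
have hy : N <= y by rewrite leqNgt -exy -leqNgt.
have -> : conn (L1 ++ L2') x y = conn (L2' ++ L1) x y.
  by apply: eq_conn => z; rewrite !mem_cat orbC.
rewrite (@conn_catl _ (fun z => N <= z)) //.
- rewrite -{1}(subnKC hx) -{1}(subnKC hy) (@conn_map _ _ _ predT) //.
  by move=> a b _ _ /addnI.
- by move=> e /P2; rewrite -!leqNgt.
- by move=> e /P1; rewrite -!ltnNge.
Qed.

Lemma sol_union N V1 T1 L1 V2 T2 L2 s cl :
  {in V1, forall x, x < N} -> {subset T1 <= V1} -> {subset T2 <= V2} ->
  {in L1, forall e, (e.1 \in V1) && (e.2 \in V1)} ->
  {in L2, forall e, (e.1 \in V2) && (e.2 \in V2)} ->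
  sol (V1 ++ map (addn N) V2) (T1 ++ map (addn N) T2) s
      (L1 ++ map (map_pair (addn N)) L2) cl <->
  exists cl1 cl2, [/\ sol V1 T1 s L1 cl1, sol V2 T2 (s \o addn N) L2 cl2
    & union_cl (has s T1) (has (s \o addn N) T2) cl1 cl2 = Some cl].
Proof.
move=> V1N sT1 sT2 LV1 LV2.
set V := V1 ++ _; set T := T1 ++ _; set L2' := map _ L2; set L := L1 ++ L2'.
have addI : injective (addn N) := @addnI N.
have P1 : {in L1, forall e, (fun x => x < N) e.1 && (fun x => x < N) e.2}.
  by move=> e /LV1 /andP[h1 h2]; rewrite !V1N.
have P2 : {in L2', forall e, ~~ (fun x => x < N) e.1 && ~~ (fun x => x < N) e.2}.
  by move=> e' /mapP[e _ ->] /=; rewrite -!leqNgt !leq_addr.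
have cE x y := conn_union x y V1N LV1 LV2; rewrite -/L2' -/L in cE.
have c1 x y : x < N -> y < N -> conn L x y = conn L1 x y.
  by move=> xN yN; rewrite cE xN yN.
have c2 x y : conn L (N + x) (N + y) = conn L2 x y.
  by rewrite cE ltnNge leq_addr /= leq_addr !addKn.
have c12 x y : x < N -> conn L x (N + y) = false.
  by move=> xN; rewrite cE xN ltnNge leq_addr.
have fL : forest L = forest L1 && forest L2.
  rewrite /L (@forest_cat _ (fun z => z < N) _ _ P1 P2); congr (_ && _).
  by rewrite (@forest_map _ _ _ predT) // => a b _ _ /addI.
have h1 x : x < N -> has (conn L x) T = has (conn L1 x) T1.
  move=> xN; rewrite /T has_cat has_map [X in _ || X](_ : _ = false) ?orbF.
    by apply: eq_in_has => y yT; apply: c1 => //; exact: V1N (sT1 _ yT).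
  by apply/negP => /hasP[y _ /=]; rewrite c12.
have h2 x : has (conn L (N + x)) T = has (conn L2 x) T2.
  rewrite /T has_cat has_map [X in X || _](_ : _ = false) /=.
    by apply: eq_in_has => y yT /=; apply: c2.
  by apply/negP => /hasP[y yT /=]; rewrite conn_sym c12 // (V1N _ (sT1 _ yT)).
have V1V x : x \in V1 -> x \in V by rewrite mem_cat => ->.
have V2V x : x \in V2 -> N + x \in V by move=> h; rewrite mem_cat map_f ?orbT.
have L2L e : e \in L2 -> map_pair (addn N) e \in L.
  by move=> eL; rewrite mem_cat map_f ?orbT.
split.
- case=> He; rewrite fL => /andP[f1 f2] Hc.
  have He1 : {in L1, forall e, [&& s e.1, s e.2, e.1 \in V1 & e.2 \in V1]}.
    move=> e eL; have /andP[-> ->] := LV1 _ eL.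
    by have /He/and4P[-> ->] : e \in L by rewrite mem_cat eL.
  have He2 : {in L2, forall e,
      [&& (s \o addn N) e.1, (s \o addn N) e.2, e.1 \in V2 & e.2 \in V2]}.
    move=> e eL; have /andP[-> ->] := LV2 _ eL.
    by have /L2L/He/and4P[/= -> ->] := eL.
  case: cl Hc => [[nT [x xV sx] hc]|ho]; last first.
    exists false, false; split=> //; split=> //.
      by move=> x xV sx; rewrite -h1 ?V1N // ho // V1V.
    by move=> x xV sx; rewrite -h2 ho // V2V.
  (* A closed solution is connected, so it lies entirely on the side of the vertex [x] that it
     contains, and the other operand carries the empty open solution. *)
  move: xV; rewrite mem_cat => /orP[xV|/mapP[x' xV ex]].
    have ns2 y : y \in V2 -> ~~ s (N + y).
      by move=> yV; apply/negP => sy; have := hc _ _ (V1V _ xV) (V2V _ yV) sx sy;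
        rewrite c12 ?V1N.
    exists true, false; split=> //.
    + split=> //; split.
      * by move=> t tT; apply: nT; rewrite mem_cat tT.
      * by exists x.
      * by move=> y z yV zV sy sz; rewrite -c1 ?V1N // hc // V1V.
    + by split=> // y yV /= sy; have := ns2 _ yV; rewrite sy.
    + rewrite /=; case: hasP => // -[y yT /= sy].
      by have := ns2 _ (sT2 _ yT); rewrite sy.
  have ns1 y : y \in V1 -> ~~ s y.
    move=> yV; apply/negP => sy; have := hc _ _ (V1V _ yV) (V2V _ xV) sy.
    by rewrite c12 ?V1N // -ex => /(_ sx).
  exists false, true; split=> //.
  + by split=> // y yV /= sy; have := ns1 _ yV; rewrite sy.
  + split=> //; split.
    * by move=> t tT; apply: nT; rewrite mem_cat map_f ?orbT.
    * by exists x' => //=; rewrite -ex.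
    * by move=> y z yV zV sy sz; rewrite -c2 hc // V2V.
  + rewrite /=; case: hasP => // -[y yT /= sy].
    by have := ns1 _ (sT1 _ yT); rewrite sy.
- case=> cl1 [cl2 [S1 S2 eu]].
  have [He1 f1 Hc1] := S1; have [He2 f2 Hc2] := S2.
  split.
  + move=> e; rewrite mem_cat => /orP[/He1/and4P[-> -> v1 v2]|].
      by rewrite !V1V.
    by case/mapP=> e' /He2/and4P[/= s1 s2 v1 v2] ->; rewrite /= s1 s2 !V2V.
  + by rewrite fL f1.
  + case: cl1 cl2 eu S1 S2 Hc1 Hc2 => -[] //=.
    * case: ifP => // ne2 [<-] S1 S2 [nT [x xV sx] hc] _.
      have ns2 y : y \in V2 -> s (N + y) = false.
        by move/(sol_open_empty S2 (negbT ne2))/negPf.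
      split.
      - move=> t; rewrite mem_cat => /orP[/nT//|/mapP[t' tT ->]].
        by rewrite ns2 ?sT2.
      - by exists x; rewrite ?V1V.
      - move=> y z; rewrite !mem_cat.
        case/orP=> [yV|/mapP[y' yV ->]]; last by rewrite (ns2 _ yV).
        case/orP=> [zV|/mapP[z' zV ->]]; last by rewrite (ns2 _ zV).
        by rewrite c1 ?V1N //; apply: hc.
    * case: ifP => // ne1 [<-] S1 S2 _ [nT [x xV sx] hc].
      have ns1 y : y \in V1 -> s y = false.
        by move/(sol_open_empty S1 (negbT ne1))/negPf.
      split.
      - move=> t; rewrite mem_cat => /orP[tT|/mapP[t' tT ->]].
          by rewrite ns1 ?sT1.
        exact: nT.
      - by exists (N + x); rewrite ?V2V.
      - move=> y z; rewrite !mem_cat.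
        case/orP=> [yV|/mapP[y' yV ->]]; first by rewrite (ns1 _ yV).
        case/orP=> [zV|/mapP[z' zV ->]]; first by rewrite (ns1 _ zV).
        by rewrite c2 //; apply: hc.
    * move=> [<-] _ _ h1' h2' x; rewrite mem_cat => /orP[xV|/mapP[x' xV ->]] sx.
        by rewrite h1 ?V1N // h1'.
      by rewrite h2 h2'.
Qed.

(** [I] lists the old terminals and [res] the remaining ones. An open solution stays open if every
    selected terminal is connected to a remaining one; this includes the empty solution. Otherwise
    some component is cut off, and then it must be the whole solution, which becomes closed. *)
Definition restrict_cl (sel : pred nat) (cn : rel nat) (I res : seq nat)
    (cl : bool) : option bool :=
  if cl then Some true
  else if all (fun i => sel i ==> has (cn i) res) I then Some false
  else if all (fun k => ~~ sel k) res &&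
          all (fun i => all (fun j => sel i && sel j ==> cn i j) I) I
       then Some true
  else None.

Lemma sol_restrict V T T' s L cl : {subset T' <= T} -> {subset T <= V} ->
  sol V T' s L cl <->
  exists cl0, sol V T s L cl0 /\ restrict_cl s (conn L) T T' cl0 = Some cl.
Proof.
move=> sT sTV; split.
  move=> S; have [He fL Hc] := S; case: cl S Hc => [|] S Hc; last first.
    exists false; split.
      split=> // x xV sx; have /hasP[t tT h] := Hc x xV sx.
      by apply/hasP; exists t => //; apply: sT.
    rewrite /restrict_cl ifT //; apply/allP => t /sTV tV.
    by apply/implyP => /(Hc _ tV).
  have [nT [x xV sx] hc] := Hc.
  (* A solution closed with respect to [T'] comes from an open one if it selects a terminal that is
     being dropped, and was closed already if it selects none. *)
  case: (boolP (has s T)) => [/hasP[t tT st]|/hasPn nT0].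
    exists false; split.
      split=> // y yV sy; apply/hasP; exists t => //.
      by apply: hc => //; apply: sTV.
    rewrite /restrict_cl ifF; last first.
      apply/negP => /allP /(_ _ tT); rewrite st /= => /hasP[t' tT'].
      by move/(sol_conn S); rewrite st => /esym st'; have := nT _ tT'; rewrite st'.
    rewrite ifT //; apply/andP; split; first by apply/allP => k /nT.
    apply/allP => i iT; apply/allP => j jT; apply/implyP => /andP[si sj].
    by apply: hc => //; apply: sTV.
  by exists true; split=> //; split=> //; split=> //; exists x.
case=> cl0 [S]; rewrite /restrict_cl; have [He fL Hc] := S.
case: cl0 S Hc => [|] S Hc.
  case=> <-; have [nT [x xV sx] hc] := Hc; split=> //; split=> //.
    by move=> t /sT/nT.
  by exists x.
case: ifP => [/allP h [<-]|nh].
  split=> // x xV sx; have /hasP[t tT hxt] := Hc x xV sx.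
  have := h t tT; rewrite -(sol_conn S hxt) sx /= => /hasP[t' tT' htt'].
  by apply/hasP; exists t' => //; apply: conn_trans htt'.
case: ifP => // /andP[/allP nT /allP hc] [<-].
split=> //; split=> //.
  have /allPn[t tT] := negbT nh; rewrite negb_imply => /andP[st _].
  by exists t; rewrite ?sTV.
move=> x y xV yV sx sy.
have /hasP[t tT hxt] := Hc x xV sx; have /hasP[u uT hyu] := Hc y yV sy.
apply: (conn_trans hxt); rewrite conn_sym; apply: (conn_trans hyu).
have /allP/(_ t tT) := hc u uT.
by rewrite -(sol_conn S hxt) -(sol_conn S hyu) sx sy.
Qed.

(** Gluing moves only a terminal, and terminals are not counted. *)
Lemma cnt_glue V T s a b : a \in T -> b \in T ->
  cnt (map (glue a b) V) (map (glue a b) T) s = cnt V T (s \o glue a b).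
Proof.
move=> aT bT; rewrite /cnt filter_map; congr (size (undup _)).
have fT x : (glue a b x \in map (glue a b) T) = (x \in T).
  apply/idP/idP => [/mapP[y yT e]|]; last exact: map_f.
  have : glue a b x \in T by rewrite e /glue; case: ifP.
  by rewrite /glue; case: eqP => [->|].
rewrite (eq_filter (a2 := fun x => (s \o glue a b) x && (x \notin T))); last first.
  by move=> x /=; rewrite fT.
apply: map_id_in => x; rewrite mem_filter => /andP[/andP[_ nT] _].
by rewrite /glue; case: eqP => // e; rewrite e bT in nT.
Qed.

Lemma cnt_union N V1 T1 V2 T2 s :
  {in V1, forall x, x < N} -> {subset T1 <= V1} ->
  cnt (V1 ++ map (addn N) V2) (T1 ++ map (addn N) T2) s =
  cnt V1 T1 s + cnt V2 T2 (s \o addn N).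
Proof.
move=> V1N sT1; rewrite /cnt filter_cat undup_cat size_cat; congr (_ + _).
  rewrite filter_undup -filter_predI; congr (size (undup _)).
  apply: eq_in_filter => x xV /=.
  have nm (W : seq nat) : (x \in map (addn N) W) = false.
    by apply/negP => /mapP[y _ e]; have := V1N _ xV; rewrite e ltnNge leq_addr.
  by rewrite !mem_cat mem_filter !nm /= andbF orbF.
rewrite filter_map undup_map_inj; last exact: addnI.
rewrite size_map; congr (size (undup _)); apply: eq_filter => x /=.
rewrite mem_cat mem_map; last exact: addnI.
congr (_ && ~~ _); rewrite [X in X || _](_ : _ = false) //.
by apply/negP => /sT1/V1N; rewrite ltnNge leq_addr.
Qed.

(* Number of distinct vertices among the terminals with indices in I, where sm
   tells which indices denote the same vertex. *)
Fixpoint ndist (sm : rel nat) (I : seq nat) : nat :=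
  if I is i :: I' then (~~ has (sm i) I') + ndist sm I' else 0.

Lemma size_undup_map (sm : rel nat) (f : nat -> nat) (I : seq nat) :
  {in I &, forall i j, sm i j = (f i == f j)} ->
  size (undup (map f I)) = ndist sm I.
Proof.
elim: I => //= i I IH H.
have h : (f i \in map f I) = has (sm i) I.
  apply/mapP/hasP => [[j jI e]|[j jI]].
    by exists j => //; rewrite H ?mem_head ?inE ?jI ?orbT // e.
  by rewrite H ?mem_head ?inE ?jI ?orbT // => /eqP; exists j.
rewrite h; case: (has _ _) => /=; rewrite -IH // => j k hj hk;
  by apply: H; rewrite inE ?hj ?hk orbT.
Qed.

Lemma cnt_restrict V T T' s : {subset T' <= T} -> {subset T <= V} ->
  cnt V T' s = cnt V T s + size (undup [seq t <- T | s t && (t \notin T')]).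
Proof.
move=> sT sTV; rewrite /cnt -size_cat; apply/perm_size/uniq_perm.
- exact: undup_uniq.
- rewrite cat_uniq !undup_uniq andbT /=; apply/hasPn => x.
  rewrite mem_undup mem_filter mem_undup mem_filter => /andP[_ xT].
  by rewrite xT /= andbF.
- move=> x; rewrite mem_cat !mem_undup !mem_filter.
  case: (boolP (x \in T)) => xT; first by rewrite (sTV _ xT) /= !andbT andbF.
  rewrite /= !andbF orbF andbT; case: (s x) => //=.
  by rewrite (contra (sT x) xT).
Qed.

(** * The operations of a rule, on graphs and on index relations *)

Definition wfb (A : built) : Prop :=
  {subset bterms A <= bverts A} /\
  {in bedges A, forall e, (e.1 \in bverts A) && (e.2 \in bverts A)}.

(** One step of the recursion of [conn]. It serves connectivity for both operations, and by
    [glue_eq] it also describes which terminals coincide after an identification. *)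
Definition join (r : rel nat) (i j : nat) : rel nat :=
  fun x y => [|| r x y, r x i && r j y | r x j && r i y].

(* sel, sm and cn say which terminals are selected, which coincide as vertices
   and which are connected; em says which of the new edges are selected. *)
Fixpoint ops_step (sel : pred nat) (os : seq term_op) (em : bitseq)
    (sm cn : rel nat) : option (rel nat * rel nat) :=
  match os with
  | [::] => Some (sm, cn)
  | Identify i j :: os' =>
      if sm i j || (sel i == sel j) && ~~ cn i j
      then ops_step sel os' em (join sm i j) (join cn i j) else None
  | AddEdge i j :: os' =>
      if head false em then
        if [&& sel i, sel j & ~~ cn i j]
        then ops_step sel os' (behead em) sm (join cn i j) else None
      else ops_step sel os' (behead em) sm cn
  end.

(** The composite of all renamings performed by the operations. A selection [s] of the resulting
    names is pulled back to the operands as [s \o ops_fun T os]. *)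
Fixpoint ops_fun (T : seq nat) (os : seq term_op) : nat -> nat :=
  match os with
  | [::] => id
  | Identify i j :: os' =>
      let f := glue (nth 0 T i) (nth 0 T j) in ops_fun (map f T) os' \o f
  | AddEdge _ _ :: os' => ops_fun T os'
  end.

Lemma foldl_ops D os : let D' := foldl apply_op D os in
  bverts D' = map (ops_fun (bterms D) os) (bverts D) /\
  bterms D' = map (ops_fun (bterms D) os) (bterms D).
Proof.
elim: os D => [|[i j|i j] os IH] D /=; first by rewrite !map_id.
  by have [-> ->] := IH (apply_op D (Identify i j)); rewrite /= -!map_comp.
exact: IH (apply_op D (AddEdge i j)).
Qed.

Lemma size_foldl_ops D os :
  size (bedges (foldl apply_op D os)) = size (bedges D) + count is_add os.
Proof.
elim: os D => [|[i j|i j] os IH] D /=; first by rewrite addn0.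
  by rewrite IH /= size_map.
by rewrite IH /= size_rcons addSnnS.
Qed.

Lemma wfb_apply D o : wfb D -> op_ok (size (bterms D)) o -> wfb (apply_op D o).
Proof.
case: o => i j [sT hE] /= /andP[hi hj]; split=> /=.
- by move=> x' /mapP[x xT ->]; apply: map_f; apply: sT.
- move=> e' /mapP[e /hE /andP[h1 h2] ->] /=.
  by rewrite (map_f (glue _ _) h1) (map_f (glue _ _) h2).
- exact: sT.
- move=> e; rewrite mem_rcons inE => /orP[/eqP-> /=|/hE //].
  by rewrite !sT ?mem_nth.
Qed.

Lemma size_bterms_apply D o : size (bterms (apply_op D o)) = size (bterms D).
Proof. by case: o => i j //=; rewrite size_map. Qed.

Lemma wfb_foldl D os :
  wfb D -> all (op_ok (size (bterms D))) os -> wfb (foldl apply_op D os).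
Proof.
elim: os D => //= o os IH D wD /andP[ho hos].
by apply: IH; [exact: wfb_apply | rewrite size_bterms_apply].
Qed.

Lemma ops_fun_mem T os (V : seq nat) : {subset T <= V} ->
  all (op_ok (size T)) os -> {in V, forall x, ops_fun T os x \in V}.
Proof.
elim: os T => [|[i j|i j] os IH] T sTV /=; first by move=> _ x.
all: case/andP=> /andP[hi hj] hos x xV.
2: exact: IH.
have fV y : y \in V -> glue (nth 0 T i) (nth 0 T j) y \in V.
  by move=> yV; rewrite /glue; case: ifP => // _; rewrite sTV ?mem_nth.
apply: IH; rewrite ?size_map ?fV //.
by move=> y' /mapP[y yT ->]; rewrite fV ?sTV.
Qed.

Lemma glue_eq (a b x y : nat) :
  (glue a b x == glue a b y) = [|| x == y, (x == a) && (b == y) | (x == b) && (a == y)].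
Proof. exact: (conn_glue a b [::]). Qed.

(** Which terminals coincide after the operations depends only on which coincided before. This
    carries the distinctness test that [rule_ok] performs on discrete operands over to arbitrary
    operands. *)
Lemma ops_fun_pattern (T U : seq nat) os : size T = size U ->
  all (op_ok (size T)) os ->
  (forall i j, i < size T -> j < size T ->
    (nth 0 T i == nth 0 T j) = (nth 0 U i == nth 0 U j)) ->
  forall i j, i < size T -> j < size T ->
    (ops_fun T os (nth 0 T i) == ops_fun T os (nth 0 T j)) =
    (ops_fun U os (nth 0 U i) == ops_fun U os (nth 0 U j)).
Proof.
elim: os T U => [|[k l|k l] os IH] T U sTU //=.
all: move=> /andP[/andP[hk hl] hos] H i j hi hj.
2: exact: IH.
set f := glue _ _; set g := glue (nth 0 U k) _.
have := IH (map f T) (map g U); rewrite !size_map => /(_ sTU hos) {}IH.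
have {}IH := IH _ i j hi hj; rewrite !(nth_map 0) -?sTU // in IH.
by apply: IH => x y hx hy; rewrite !(nth_map 0) -?sTU // !glue_eq !H.
Qed.

Definition matches (T : seq nat) (L : seq (nat * nat)) (sm cn : rel nat) :=
  forall i j, i < size T -> j < size T ->
    sm i j = (nth 0 T i == nth 0 T j) /\
    cn i j = conn L (nth 0 T i) (nth 0 T j).

Lemma matches_join_glue T L sm cn i j : i < size T -> j < size T ->
  let f := glue (nth 0 T i) (nth 0 T j) in
  matches T L sm cn ->
  matches (map f T) (map (map_pair f) L) (join sm i j) (join cn i j).
Proof.
move=> hi hj f H x y; rewrite size_map => hx hy; rewrite !(nth_map 0) //.
rewrite glue_eq conn_glue /join /=.
have [-> ->] := H x y hx hy; have [-> ->] := H x i hx hi; have [-> ->] := H x j hx hj.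
by have [-> ->] := H i y hi hy; have [-> ->] := H j y hj hy.
Qed.

Lemma matches_join_add T L L' sm cn i j : i < size T -> j < size T ->
  L' =i (nth 0 T i, nth 0 T j) :: L ->
  matches T L sm cn -> matches T L' sm (join cn i j).
Proof.
move=> hi hj eL H x y hx hy; rewrite (eq_conn eL) /join /=.
have [-> ->] := H x y hx hy; have [_ ->] := H x i hx hi; have [_ ->] := H x j hx hj.
by have [_ ->] := H i y hi hy; have [_ ->] := H j y hj hy.
Qed.

Lemma mask_identify D i j em :
  mask em (bedges (apply_op D (Identify i j))) =
  map (map_pair (glue (nth 0 (bterms D) i) (nth 0 (bterms D) j)))
      (mask em (bedges D)).
Proof. by rewrite map_mask. Qed.

Lemma ops_matches os D em0 em sel sm cn sm' cn' :
  all (op_ok (size (bterms D))) os -> size em0 = size (bedges D) ->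
  size em = count is_add os ->
  matches (bterms D) (mask em0 (bedges D)) sm cn ->
  ops_step sel os em sm cn = Some (sm', cn') ->
  let D' := foldl apply_op D os in
  matches (bterms D') (mask (em0 ++ em) (bedges D')) sm' cn'.
Proof.
elim: os D em0 em sm cn => [|[i j|i j] os IH] D em0 em sm cn /=.
- by move=> _ _ /size0nil-> H [<- <-]; rewrite cats0.
- case/andP=> /andP[hi hj] hos s0 s1 H; case: ifP => // _.
  apply: (IH (apply_op D (Identify i j)));
    rewrite ?mask_identify ?size_bterms_apply //= ?size_map //.
  exact: matches_join_glue.
- case/andP=> /andP[hi hj] hos s0; case: em => // b em [s1] H /= hst.
  rewrite -cat_rcons; case: b hst => [|hst].
    case: ifP => // _ hst; apply: (IH (apply_op D (AddEdge i j))) hst;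
      rewrite /= ?size_rcons ?s0 //.
    apply: (matches_join_add hi hj) H => z.
    by rewrite mask_rcons //= mem_cat !inE orbC.
  apply: (IH (apply_op D (AddEdge i j))) hst; rewrite /= ?size_rcons ?s0 //.
  by rewrite mask_rcons //= cats0.
Qed.

(** The guard of [ops_step] admits an identification only of terminals that are the same vertex or
    on which the selection agrees. So a selection chosen before the operations already respects all
    renamings; [run_sound] depends on this. *)
Lemma ops_invar os T em sel s sm cn L r :
  all (op_ok (size T)) os -> matches T L sm cn ->
  {in iota 0 (size T), forall i, sel i = s (nth 0 T i)} ->
  ops_step sel os em sm cn = Some r -> s \o ops_fun T os =1 s.
Proof.
elim: os T em sm cn L => [|[i j|i j] os IH] T em sm cn L //=.
- case/andP=> /andP[hi hj] hos H hs; case: ifP => // hc hst x /=.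
  set f := glue _ _.
  have sab : s (nth 0 T i) = s (nth 0 T j).
    case/orP: hc => [|/andP[/eqP h _]]; first by rewrite (H i j hi hj).1 => /eqP->.
    by rewrite -!hs ?mem_iota.
  have sf y : s (f y) = s y by rewrite /f /glue; case: eqP => // ->.
  have /= -> := IH (map f T) em _ _ _ _ (matches_join_glue hi hj H) _ hst (f x).
  + exact: sf.
  + by rewrite size_map.
  + move=> k; rewrite size_map => hk; rewrite (nth_map 0) ?sf ?hs //.
    by rewrite mem_iota in hk.
- case/andP=> /andP[hi hj] hos H hs; case: ifP => _; last exact: IH hos H hs.
  case: ifP => // _; have H1 := matches_join_add hi hj (fun=> erefl) H.
  exact: IH hos H1 hs.
Qed.

Lemma sol_ops os D em0 em sel sm cn s cl :
  all (op_ok (size (bterms D))) os -> wfb D -> size em0 = size (bedges D) ->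
  size em = count is_add os ->
  matches (bterms D) (mask em0 (bedges D)) sm cn ->
  let F := ops_fun (bterms D) os in
  {in iota 0 (size (bterms D)), forall i, sel i = s (F (nth 0 (bterms D) i))} ->
  let D' := foldl apply_op D os in
  sol (bverts D') (bterms D') s (mask (em0 ++ em) (bedges D')) cl <->
  sol (bverts D) (bterms D) (s \o F) (mask em0 (bedges D)) cl
    /\ isSome (ops_step sel os em sm cn).
Proof.
elim: os D em0 em sm cn => [|[i j|i j] os IH] D em0 em sm cn /=.
- by move=> _ _ _ /size0nil-> _ _; rewrite cats0; split=> [h|[]].
- case/andP=> /andP[hi hj] hos wD s0 s1 H hs.
  set D1 := apply_op D (Identify i j); set f := glue _ _ in hs *.
  have H1 : matches (bterms D1) (mask em0 (bedges D1)) (join sm i j) (join cn i j).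
    by rewrite mask_identify; apply: matches_join_glue.
  have wD1 : wfb D1 by apply: wfb_apply => //=; rewrite hi.
  have s01 : size em0 = size (bedges D1) by rewrite /= size_map.
  have hs1 : {in iota 0 (size (bterms D1)), forall k,
      sel k = s (ops_fun (bterms D1) os (nth 0 (bterms D1) k))}.
    rewrite size_bterms_apply => k hk; rewrite hs // (nth_map 0) //.
    by rewrite mem_iota in hk.
  have hos1 : all (op_ok (size (bterms D1))) os by rewrite size_bterms_apply.
  rewrite (IH D1 em0 em _ _ hos1 wD1 s01 s1 H1 hs1) mask_identify.
  have [sT hE] := wD.
  have hsol := @sol_glue (bverts D) (bterms D) (s \o ops_fun (map f (bterms D)) os)
     (mask em0 (bedges D)) cl _ _ (mem_nth 0 hi) (mem_nth 0 hj) sT _.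
  rewrite {}hsol; last by move=> e /mem_mask/hE.
  have [-> ->] := H i j hi hj.
  (* The selection is pulled back through this very identification, so it cannot distinguish the two
     terminals, and the guard reduces to the condition of [sol_glue]. *)
  have -> : sel i == sel j.
    by rewrite !hs ?mem_iota //= /f /glue eqxx; case: ifP.
  rewrite /=; case: ifP => _; split=> [[[h1 h2] h3]|[h1 h2]] //.
- case/andP=> /andP[hi hj] hos wD s0; case: em => // b em [s1] H hs.
  set D1 := apply_op D (AddEdge i j).
  have wD1 := wfb_apply wD (o := AddEdge i j) (introT andP (conj hi hj)).
  have s01 : size (rcons em0 b) = size (bedges D1) by rewrite !size_rcons s0.
  rewrite -cat_rcons /=.
  have mL : perm_eq (mask (rcons em0 b) (bedges D1))
     (nseq b (nth 0 (bterms D) i, nth 0 (bterms D) j) ++ mask em0 (bedges D)).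
    by rewrite mask_rcons // perm_catC.
  have [sT hE] := wD.
  case: b s01 mL => s01 mL.
    have H1 : matches (bterms D1) (mask (rcons em0 true) (bedges D1)) sm (join cn i j).
      by apply: matches_join_add H => // z; rewrite (perm_mem mL).
    rewrite (IH D1 _ _ _ _ hos wD1 s01 s1 H1 hs).
    have -> : cn i j = conn (mask em0 (bedges D)) (nth 0 (bterms D) i) (nth 0 (bterms D) j).
      exact: (H i j hi hj).2.
    rewrite !hs ?mem_iota //.
    set s' := s \o _.
    have hadd := @sol_add (bverts D) (bterms D) s' (mask em0 (bedges D)) cl
      _ _ (mem_nth 0 hi) (mem_nth 0 hj) sT.
    rewrite /= in mL hadd.
    split=> [[/(sol_perm mL) /hadd [h1 h2] h3]|[h1]].
      by rewrite h2.
    case: ifP => // h2 h3; split=> //.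
    have mL' : perm_eq ((nth 0 (bterms D) i, nth 0 (bterms D) j) :: mask em0 (bedges D))
        (mask (rcons em0 true) (rcons (bedges D) (nth 0 (bterms D) i, nth 0 (bterms D) j))).
      by rewrite perm_sym.
    by apply: (sol_perm mL'); apply/hadd.
  have H1 : matches (bterms D1) (mask (rcons em0 false) (bedges D1)) sm cn.
    by move=> x y hx hy; rewrite (eq_conn (perm_mem mL)); apply: H.
  rewrite (IH D1 _ _ _ _ hos wD1 s01 s1 H1 hs).
  split=> -[h1 h2]; split=> //; first exact: sol_perm mL h1.
  by apply: sol_perm h1; rewrite perm_sym.
Qed.

Lemma cnt_ops os D s : all (op_ok (size (bterms D))) os ->
  let D' := foldl apply_op D os in
  cnt (bverts D') (bterms D') s =
  cnt (bverts D) (bterms D) (s \o ops_fun (bterms D) os).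
Proof.
elim: os D => [|[i j|i j] os IH] D //= /andP[/andP[hi hj] hos] /=; last exact: IH.
by rewrite IH /= ?size_map // cnt_glue ?mem_nth.
Qed.

(** * The automaton of a class *)

(* A tree automaton on parse trees.  A primitive graph with a vertices and b
   edges has options (q, d, vm, em): select the vertices and edges marked in vm
   and em, get state q and count d.  A rule with a new edges has transitions
   ((q1, q2), (q, d), em): from states q1, q2 of the operands and new edges em,
   get state q and add d to the counts.  A pair (q, d) in accepts adds d to the
   count at the root. *)
Record automaton := Automaton {
  nstates : nat;
  leaf_rules : seq (nat * nat * seq (nat * nat * bitseq * bitseq));
  node_rules : seq (nat * seq ((nat * nat) * (nat * nat) * bitseq));
  accepts : seq (nat * nat) }.

(** Counts are exact here; truncation by [minn k] enters only with the tables. A vertex arising by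
    identification occurs in the vertex list once for each selected leaf vertex mapped to it. *)
Inductive run (M : automaton) (n m : nat) :
    ptree n m -> nat -> nat -> seq 'I_n -> seq 'I_m -> Prop :=
  | RunLeaf i vs es a b opts q d vm em :
      onth (leaf_rules M) i = Some (a, b, opts) -> (q, d, vm, em) \in opts ->
      run M (PLeaf i vs es) q d (mask vm vs) (mask em es)
  | RunNode i es t1 t2 a trs q1 q2 q d em c1 c2 vs1 vs2 es1 es2 :
      onth (node_rules M) i = Some (a, trs) ->
      ((q1, q2), (q, d), em) \in trs ->
      run M t1 q1 c1 vs1 es1 -> run M t2 q2 c2 vs2 es2 ->
      run M (PNode i es t1 t2) q (c1 + c2 + d) (vs1 ++ vs2)
        ((es1 ++ es2) ++ mask em es).

Fixpoint fits (M : automaton) n m (t : ptree n m) : bool :=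
  match t with
  | PLeaf i vs es =>
      if onth (leaf_rules M) i is Some (a, b, _)
      then (size vs == a) && (size es == b) else false
  | PNode i es t1 t2 =>
      [&& (if onth (node_rules M) i is Some (a, _) then size es == a else false),
          fits M t1 & fits M t2]
  end.

Definition automaton_ok (M : automaton) : Prop :=
  [/\ forall i a b opts, onth (leaf_rules M) i = Some (a, b, opts) ->
        {in opts, forall o : nat * nat * bitseq * bitseq, let: (q, d, vm, em) := o in
           [&& q < nstates M, size vm == a & size em == b]},
      forall i a trs, onth (node_rules M) i = Some (a, trs) ->
        {in trs, forall o : (nat * nat) * (nat * nat) * bitseq,
           let: ((q1, q2), (q, d), em) := o in
           [&& q1 < nstates M, q2 < nstates M, q < nstates M & size em == a]}
    & {in accepts M, forall a, a.1 < nstates M}].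

(** Selected terminals, connected pairs of terminals, and the closed flag. Coincidence of terminals
    need not be recorded: between rules, terminals are pairwise distinct vertices. [enc] fills the
    indices beyond the actual terminals with false, so that equal situations give equal states. *)
Definition tstate (tau : nat) : finType :=
  ({ffun 'I_tau -> bool} * {ffun 'I_tau * 'I_tau -> bool} * bool)%type.

Definition enc tau (m : nat) (sel : pred nat) (cn : rel nat) (cl : bool) : tstate tau :=
  ([ffun i : 'I_tau => (i < m) && sel i],
   [ffun p : 'I_tau * 'I_tau => [&& p.1 < m, p.2 < m & cn p.1 p.2]], cl).

Definition dsel tau (q : tstate tau) (i : nat) : bool :=
  if insub i is Some o then q.1.1 o else false.

Definition dcn tau (q : tstate tau) (i j : nat) : bool :=
  if (insub i, insub j) is (Some o, Some p) then q.1.2 (o, p) else false.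

Lemma dsel_enc tau m sel cn cl i : m <= tau ->
  dsel (enc tau m sel cn cl) i = (i < m) && sel i.
Proof.
move=> hm; rewrite /dsel; case: insubP => [o ho <-|]; first by rewrite ffunE.
by rewrite -leqNgt => h; rewrite ltnNge (leq_trans hm h).
Qed.

Lemma dcn_enc tau m sel cn cl i j : m <= tau ->
  dcn (enc tau m sel cn cl) i j = [&& i < m, j < m & cn i j].
Proof.
move=> hm; rewrite /dcn; case: insubP => [o ho <-|]; last first.
  by rewrite -leqNgt => h; rewrite ltnNge (leq_trans hm h).
case: insubP => [p hp <-|]; first by rewrite ffunE.
by rewrite -leqNgt => h; rewrite [j < m]ltnNge (leq_trans hm h) /= andbF.
Qed.

Lemma enc_ext tau m sel sel' cn cn' cl :
  (forall i, i < m -> sel i = sel' i) ->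
  (forall i j, i < m -> j < m -> cn i j = cn' i j) ->
  enc tau m sel cn cl = enc tau m sel' cn' cl.
Proof.
move=> hs hc; rewrite /enc; congr (_, _, _); apply/ffunP => x; rewrite !ffunE.
  by case: ltnP => //= h; rewrite hs.
by case: ltnP => //= h1; case: ltnP => //= h2; rewrite hc.
Qed.

Definition state_of tau (T : seq nat) (s : nat -> bool) (L : seq (nat * nat)) cl :=
  enc tau (size T) (fun i => s (nth 0 T i))
    (fun i j => conn L (nth 0 T i) (nth 0 T j)) cl.

(** Indices of the right operand are shifted by [larity r]. The initial coincidence relation is
    equality of indices because the terminals of the operands are distinct. The number returned
    counts the distinct selected vertices that stop being terminals. *)
Definition rule_step tau (r : crule) (q1 q2 : tstate tau) (em : bitseq) :
    option (tstate tau * nat) :=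
  let m1 := larity r in let m := m1 + rarity r in
  let sel i := if i < m1 then dsel q1 i else dsel q2 (i - m1) in
  let cn i j := if i < m1 then (j < m1) && dcn q1 i j
                else (m1 <= j) && dcn q2 (i - m1) (j - m1) in
  if union_cl (has (dsel q1) (iota 0 m1)) (has (dsel q2) (iota 0 (rarity r)))
       q1.2 q2.2 is Some cl then
  if ops_step sel (ops r) em (fun i j => i == j) cn is Some (sm, cn') then
  if restrict_cl sel cn' (iota 0 m) (result r) cl is Some cl' then
    Some (enc tau (size (result r)) (fun k => sel (nth 0 (result r) k))
            (fun k l => cn' (nth 0 (result r) k) (nth 0 (result r) l)) cl',
          ndist sm [seq i <- iota 0 m | sel i && ~~ has (sm i) (result r)])
  else None else None else None.

Lemma restrict_cl_map (T I res : seq nat) sel cn (s : nat -> bool) (c : rel nat) cl :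
  {in I, forall i, sel i = s (nth 0 T i)} ->
  {in I &, forall i j, cn i j = c (nth 0 T i) (nth 0 T j)} ->
  {subset res <= I} ->
  restrict_cl sel cn I res cl =
  restrict_cl s c (map (nth 0 T) I) (map (nth 0 T) res) cl.
Proof.
move=> hs hc sr; rewrite /restrict_cl !all_map; case: cl => //.
have -> : all (fun i => sel i ==> has (cn i) res) I =
    all (preim (nth 0 T) (fun i => s i ==> has (c i) (map (nth 0 T) res))) I.
  apply: eq_in_all => i iI /=; rewrite hs // has_map; congr (_ ==> _).
  by apply: eq_in_has => j /sr jI /=; rewrite hc.
have -> : all (fun k => ~~ sel k) res = all (preim (nth 0 T) (fun k => ~~ s k)) res.
  by apply: eq_in_all => k /sr kI /=; rewrite hs.
have -> // : all (fun i => all (fun j => sel i && sel j ==> cn i j) I) I =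
    all (preim (nth 0 T) (fun i =>
      all (fun j => s i && s j ==> c i j) (map (nth 0 T) I))) I.
apply: eq_in_all => i iI /=; rewrite all_map; apply: eq_in_all => j jI /=.
by rewrite !hs // hc.
Qed.

Lemma map_nth_size (T : seq nat) : map (nth 0 T) (iota 0 (size T)) = T.
Proof. by rewrite -[RHS](mkseq_nth 0). Qed.

Lemma sol_cl_uniq V T s L cl cl' : {subset T <= V} ->
  sol V T s L cl -> sol V T s L cl' -> cl = cl'.
Proof.
wlog: cl cl' / cl' => [hw sT S S'|].
  case: cl' S' => S'; first exact: hw S S'.
  by case: cl S => // S; apply/esym; exact: hw S' S.
case: cl' => // _ sT; case: cl => // S [_ _ [nT [x xV sx] _]].
have [_ _ h] := S; have /hasP[t tT /(sol_conn S)] := h x xV sx.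
by rewrite sx => /esym st; have := nT t tT; rewrite st.
Qed.

(** The bound on names makes the shift in [disj_union] produce disjoint names; uniqueness of
    terminals justifies starting [ops_step] with equality of indices. *)
Definition wfn (A : built) : Prop :=
  [/\ wfb A, {in bverts A, forall x, x < size (bverts A)} & uniq (bterms A)].

Lemma matches_union N (T1 T2 V1 V2 : seq nat) L1 L2 cn :
  {in V1, forall x, x < N} -> {subset T1 <= V1} ->
  {in L1, forall e, (e.1 \in V1) && (e.2 \in V1)} ->
  {in L2, forall e, (e.1 \in V2) && (e.2 \in V2)} ->
  uniq T1 -> uniq T2 ->
  (forall i j, i < size T1 + size T2 -> j < size T1 + size T2 -> cn i j =
    if i < size T1 then (j < size T1) && conn L1 (nth 0 T1 i) (nth 0 T1 j)
    else (size T1 <= j) &&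
         conn L2 (nth 0 T2 (i - size T1)) (nth 0 T2 (j - size T1))) ->
  matches (T1 ++ map (addn N) T2) (L1 ++ map (map_pair (addn N)) L2)
    (fun i j => i == j) cn.
Proof.
move=> V1N sT1 LV1 LV2 u1 u2 hcn i j; rewrite size_cat size_map => hi hj.
split.
  rewrite nth_uniq ?size_cat ?size_map // cat_uniq u1 map_inj_uniq ?u2 ?andbT /=;
    last exact: addnI.
  apply/hasPn => z /mapP[y yT ->]; apply/negP => /sT1/V1N.
  by rewrite ltnNge leq_addr.
rewrite hcn // (conn_union _ _ V1N LV1 LV2).
have nN k : k < size T1 + size T2 -> nth 0 (T1 ++ map (addn N) T2) k =
    if k < size T1 then nth 0 T1 k else N + nth 0 T2 (k - size T1).
  move=> hk; rewrite nth_cat; case: ltnP => // hk'; rewrite (nth_map 0) //.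
  by rewrite -(ltn_add2l (size T1)) subnKC.
have lN k : k < size T1 -> nth 0 T1 k < N by move=> hk; rewrite V1N ?sT1 ?mem_nth.
rewrite !nN //; case: (ltnP i) => hi'; case: (ltnP j) => hj'; rewrite ?lN //=.
- by rewrite [_ < N]ltnNge leq_addr.
- by rewrite ltnNge leq_addr /= leqNgt lN.
- by rewrite ltnNge !leq_addr /= !addKn.
Qed.

Lemma wfb_union A B : {in bverts A, forall x, x < size (bverts A)} ->
  wfb A -> wfb B -> wfb (disj_union A B).
Proof.
move=> hA [sA eA] [sB eB]; split=> /=.
  move=> x; rewrite !mem_cat => /orP[/sA->//|/mapP[y /sB yV ->]].
  by rewrite (map_f (addn _) yV) orbT.
move=> e; rewrite mem_cat => /orP[/eA/andP[h1 h2]|/mapP[e' /eB/andP[h1 h2] ->]].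
  by rewrite !mem_cat h1 h2.
by rewrite /= !mem_cat !(map_f (addn _)) ?orbT.
Qed.

Lemma uniq_map_pattern (f g : nat -> nat) (I : seq nat) :
  {in I &, forall i j, (f i == f j) = (g i == g j)} ->
  uniq (map f I) = uniq (map g I).
Proof.
elim: I => //= i I IH H; rewrite IH; last first.
  by move=> j k hj hk; apply: H; rewrite inE ?hj ?hk orbT.
congr (~~ _ && _); apply/mapP/mapP => -[j jI /eqP e]; exists j => //; apply/eqP.
  by rewrite -H ?mem_head // inE jI orbT.
by rewrite H ?mem_head // inE jI orbT.
Qed.

Lemma uniq_union_terms A B : {in bverts A, forall x, x < size (bverts A)} ->
  {subset bterms A <= bverts A} -> uniq (bterms A) -> uniq (bterms B) ->
  uniq (bterms (disj_union A B)).
Proof.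
move=> hA sA uA uB; rewrite cat_uniq uA map_inj_uniq ?uB ?andbT /=; last exact: addnI.
apply/hasPn => z /mapP[y yT ->]; apply/negP => /sA/hA.
by rewrite ltnNge leq_addr.
Qed.

Lemma wfn_discrete m : wfn (discrete m).
Proof.
split; [split=> //| |exact: iota_uniq].
by move=> x /=; rewrite mem_iota size_iota.
Qed.

Lemma compose_parts r A B : let U := disj_union A B in
  let F := ops_fun (bterms U) (ops r) in
  [/\ bverts (compose r A B) = map F (bverts U),
      bterms (foldl apply_op U (ops r)) = map F (bterms U)
    & bterms (compose r A B) =
      map (nth 0 (bterms (foldl apply_op U (ops r)))) (result r)].
Proof. by move=> U F; have [] := foldl_ops U (ops r). Qed.

Lemma wfn_compose tau r A B : rule_ok tau r -> wfn A -> wfn B ->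
  size (bterms A) = larity r -> size (bterms B) = rarity r ->
  wfn (compose r A B).
Proof.
case/and4P=> hops hres _ ur [wA nA uA] [wB nB uB] sA sB.
set U := disj_union A B.
have wU : wfb U by apply: wfb_union.
have sTU : size (bterms U) = larity r + rarity r.
  by rewrite /= size_cat size_map sA sB.
have uU : uniq (bterms U) by apply: uniq_union_terms => //; case: wA.
have [eV eT eTC] := compose_parts r A B.
have hopsU : all (op_ok (size (bterms U))) (ops r) by rewrite sTU.
have wD := wfb_foldl wU hopsU.
have FV := ops_fun_mem wU.1 hopsU.
have nU : {in bverts U, forall x, x < size (bverts U)}.
  move=> x; rewrite /= size_cat size_map mem_cat => /orP[/nA h|/mapP[y /nB h ->]].
    exact: leq_trans h (leq_addr _ _).
  by rewrite ltn_add2l.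
split.
- split=> [x|]; last exact: wD.2.
  rewrite eTC => /mapP[i ires ->]; apply: wD.1; apply: mem_nth.
  by rewrite eT size_map sTU; move/allP: hres; apply.
- by rewrite eV => x' /mapP[x xV ->]; rewrite size_map nU // FV.
set U0 := disj_union (discrete (larity r)) (discrete (rarity r)) in ur.
have [_ eT0 eTC0] := compose_parts r (discrete (larity r)) (discrete (rarity r)).
rewrite -/U0 in eT0 eTC0.
have sTU0 : size (bterms U0) = larity r + rarity r.
  by rewrite /= size_cat size_map !size_iota.
have uU0 : uniq (bterms U0).
  have [[s0 _] n0 u0] := wfn_discrete (larity r).
  by apply: uniq_union_terms => //; case: (wfn_discrete (rarity r)).
move: ur; rewrite eTC0 eTC (@uniq_map_pattern _
  (nth 0 (bterms (foldl apply_op U (ops r))))) // => i j /(allP hres) hi /(allP hres) hj.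
rewrite eT eT0 !(nth_map 0) ?sTU ?sTU0 //.
apply: ops_fun_pattern; rewrite ?sTU ?sTU0 // => x y hx hy.
by rewrite !nth_uniq ?sTU ?sTU0.
Qed.

(** Chains [sol_union], [sol_ops] and [sol_restrict], where [mU] and [mD] say that the index
    relations of the automaton describe the real ones before and after the operations. The first
    half finds states of the operands for a given solution of the composed graph; the second
    computes state and count of the composed solution from those of the operands. *)
Lemma compose_spec tau r A B em1 em2 em s :
  rule_ok tau r -> wfn A -> wfn B ->
  size (bterms A) = larity r -> size (bterms B) = rarity r ->
  larity r <= tau -> rarity r <= tau ->
  size em1 = size (bedges A) -> size em2 = size (bedges B) ->
  size em = count is_add (ops r) ->
  let C := compose r A B in
  let F := ops_fun (bterms (disj_union A B)) (ops r) in
  let sA := s \o F in let sB := sA \o addn (size (bverts A)) in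
  let LA := mask em1 (bedges A) in let LB := mask em2 (bedges B) in
  let LC := mask ((em1 ++ em2) ++ em) (bedges C) in
  (forall cl, sol (bverts C) (bterms C) s LC cl ->
    exists cl1 cl2,
    [/\ sol (bverts A) (bterms A) sA LA cl1, sol (bverts B) (bterms B) sB LB cl2
      & isSome (rule_step r (state_of tau (bterms A) sA LA cl1)
          (state_of tau (bterms B) sB LB cl2) em)]) /\
  (forall cl1 cl2 q d,
    sol (bverts A) (bterms A) sA LA cl1 -> sol (bverts B) (bterms B) sB LB cl2 ->
    rule_step r (state_of tau (bterms A) sA LA cl1)
      (state_of tau (bterms B) sB LB cl2) em = Some (q, d) ->
    exists cl, [/\ sol (bverts C) (bterms C) s LC cl,
      q = state_of tau (bterms C) s LC cl
      & cnt (bverts C) (bterms C) s =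
        cnt (bverts A) (bterms A) sA + cnt (bverts B) (bterms B) sB + d]).
Proof.
move=> rok wnA wnB szA szB hA hB s1 s2 s3 C F sA sB LA LB LC.
have [wA nA uA] := wnA; have [wB nB uB] := wnB.
case/and4P: (rok) => hops hres _ ur.
set U := disj_union A B; set D := foldl apply_op U (ops r).
have wU : wfb U by apply: wfb_union.
have sTU : size (bterms U) = larity r + rarity r.
  by rewrite /= size_cat size_map szA szB.
have [eV eT eTC] := compose_parts r A B.
have hopsU : all (op_ok (size (bterms U))) (ops r) by rewrite sTU.
have wD := wfb_foldl wU hopsU.
have sTD : size (bterms D) = larity r + rarity r by rewrite eT size_map.
have hsub : {subset bterms C <= bterms D}.
  by rewrite eTC => x /mapP[i /(allP hres) hi ->]; rewrite mem_nth ?sTD.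
have s12 : size (em1 ++ em2) = size (bedges U).
  by rewrite /= !size_cat size_map s1 s2.
have LU : mask (em1 ++ em2) (bedges U) =
    LA ++ map (map_pair (addn (size (bverts A)))) LB.
  by rewrite /= mask_cat // -map_mask.
have hLA : {in LA, forall e, (e.1 \in bverts A) && (e.2 \in bverts A)}.
  by move=> e /mem_mask/wA.2.
have hLB : {in LB, forall e, (e.1 \in bverts B) && (e.2 \in bverts B)}.
  by move=> e /mem_mask/wB.2.
set sel := fun cl1 cl2 i => if i < larity r
  then dsel (state_of tau (bterms A) sA LA cl1) i
  else dsel (state_of tau (bterms B) sB LB cl2) (i - larity r).
set cn := fun cl1 cl2 i j => if i < larity r
  then (j < larity r) && dcn (state_of tau (bterms A) sA LA cl1) i j
  else (larity r <= j) &&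
    dcn (state_of tau (bterms B) sB LB cl2) (i - larity r) (j - larity r).
have subr i : i < larity r + rarity r -> larity r <= i -> i - larity r < rarity r by lia.
have selE cl1 cl2 : {in iota 0 (larity r + rarity r), forall i,
    sel cl1 cl2 i = sA (nth 0 (bterms U) i)}.
  move=> i; rewrite mem_iota /= add0n => hi.
  rewrite /sel /= nth_cat szA; case: ltnP => hi'; rewrite dsel_enc ?szA ?szB //.
    by rewrite hi'.
  by rewrite subr //= (nth_map 0) // szB subr.
have mU cl1 cl2 : matches (bterms U) (mask (em1 ++ em2) (bedges U))
    (fun i j => i == j) (cn cl1 cl2).
  rewrite LU; apply: matches_union hLA hLB uA uB _ => //; first by case: wA.
  rewrite szA szB => i j hi hj; rewrite /cn.
  case: ltnP => hi'; case: (ltnP j) => hj' //=; rewrite dcn_enc ?szA ?szB //.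
    by rewrite hi' hj'.
  by rewrite !subr.
have hasA cl1 : has (dsel (state_of tau (bterms A) sA LA cl1)) (iota 0 (larity r)) =
    has sA (bterms A).
  rewrite -[in RHS](map_nth_size (bterms A)) has_map szA; apply: eq_in_has => i.
  by rewrite mem_iota /= => hi; rewrite dsel_enc szA // hi.
have hasB cl2 : has (dsel (state_of tau (bterms B) sB LB cl2)) (iota 0 (rarity r)) =
    has sB (bterms B).
  rewrite -[in RHS](map_nth_size (bterms B)) has_map szB; apply: eq_in_has => i.
  by rewrite mem_iota /= => hi; rewrite dsel_enc szB // hi.
have mD cl1 cl2 sm cn' :
    ops_step (sel cl1 cl2) (ops r) em (fun i j => i == j) (cn cl1 cl2) = Some (sm, cn') ->
    matches (bterms D) LC sm cn'.
  by apply: ops_matches => //; apply: mU.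
have selD cl1 cl2 : {in iota 0 (larity r + rarity r), forall i,
    sel cl1 cl2 i = s (nth 0 (bterms D) i)}.
  move=> i hi; rewrite selE // /D eT (nth_map 0) // sTU.
  by rewrite mem_iota in hi.
have resI : {subset result r <= iota 0 (larity r + rarity r)}.
  by move=> i /(allP hres) hi; rewrite mem_iota.
have iotaD : map (nth 0 (bterms D)) (iota 0 (larity r + rarity r)) = bterms D.
  by rewrite -sTD map_nth_size.
have resE cl1 cl2 sm cn' cl0 : matches (bterms D) LC sm cn' ->
    restrict_cl (sel cl1 cl2) cn' (iota 0 (larity r + rarity r)) (result r) cl0 =
    restrict_cl s (conn LC) (bterms D) (bterms C) cl0.
  move=> hm; rewrite (@restrict_cl_map (bterms D) _ _ _ _ s (conn LC)) //.
  - by rewrite iotaD eTC.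
  - move=> i j; rewrite !mem_iota /= => hi hj; apply: (hm i j _ _).2; by rewrite sTD.
have stE cl cl1 cl2 sm cn' : matches (bterms D) LC sm cn' ->
    enc tau (size (result r)) (fun k => sel cl1 cl2 (nth 0 (result r) k))
      (fun k l => cn' (nth 0 (result r) k) (nth 0 (result r) l)) cl =
    state_of tau (bterms C) s LC cl.
  move=> hm; rewrite /state_of eTC size_map; apply: enc_ext => [k|k l] hk.
    by rewrite (nth_map 0) // selD // resI ?mem_nth.
  have hr x : x < size (result r) -> nth 0 (result r) x < size (bterms D).
    by move=> hx; rewrite sTD; move/allP: hres; apply; rewrite mem_nth.
  by move=> hl; rewrite !(nth_map 0) // (hm _ _ (hr _ hk) (hr _ hl)).2.
have cntE cl1 cl2 sm cn' : matches (bterms D) LC sm cn' ->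
    cnt (bverts C) (bterms C) s =
    cnt (bverts A) (bterms A) sA + cnt (bverts B) (bterms B) sB +
    ndist sm [seq i <- iota 0 (larity r + rarity r)
             | sel cl1 cl2 i && ~~ has (sm i) (result r)].
  move=> hm; rewrite (cnt_restrict _ hsub wD.1) cnt_ops // -/U -/F.
  rewrite cnt_union //; last by case: wA.
  congr (_ + _); rewrite -[in LHS]iotaD filter_map.
  rewrite -(@size_undup_map _ (nth 0 (bterms D))); last first.
    move=> i j; rewrite !mem_filter !mem_iota /= => /andP[_ hi] /andP[_ hj].
    by apply: (hm i j _ _).1; rewrite sTD.
  congr (size (undup (map _ _))); apply: eq_in_filter => i hi /=.
  rewrite (selD _ _ _ hi); congr (_ && ~~ _).
  rewrite mem_iota /= in hi.
  apply/mapP/hasP => -[k kr h]; exists k => //.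
    by rewrite (hm i k _ _).1 ?sTD //; [exact/eqP | move/allP: hres; apply].
  by apply/eqP; rewrite -(hm i k _ _).1 ?sTD //; move/allP: hres; apply.
have solD cl0 cl1 cl2 : sol (bverts D) (bterms D) s LC cl0 <->
    sol (bverts U) (bterms U) sA (mask (em1 ++ em2) (bedges U)) cl0 /\
    isSome (ops_step (sel cl1 cl2) (ops r) em (fun i j => i == j) (cn cl1 cl2)).
  apply: (@sol_ops _ _ _ _ _ _ _ _ _ hopsU wU s12 s3 (mU cl1 cl2)).
  by rewrite sTU => i hi; rewrite selE.
have hunion cl0 := @sol_union (size (bverts A)) (bverts A) (bterms A) LA (bverts B)
  (bterms B) LB sA cl0 nA wA.1 wB.1 hLA hLB.
split.
- move=> cl /(sol_restrict _ _ _ hsub wD.1) [cl0 [SD hr]].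
  have [SU _] := (solD cl0 true true).1 SD.
  move: (SU); rewrite LU => /hunion [cl1 [cl2 [SA SB hu]]].
  have [_] := (solD cl0 cl1 cl2).1 SD.
  case eo: (ops_step _ _ _ _ _) => [[sm cn']|] // _.
  have hm := mD _ _ _ _ eo.
  exists cl1, cl2; split=> //.
  rewrite /rule_step hasA hasB /= -/(sel cl1 cl2) -/(cn cl1 cl2) hu eo.
  by rewrite (resE _ _ _ _ _ hm) hr.
- move=> cl1 cl2 q d SA SB.
  rewrite /rule_step hasA hasB /= -/(sel cl1 cl2) -/(cn cl1 cl2).
  case eu: (union_cl _ _ _ _) => [cl0|] //.
  case eo: (ops_step _ _ _ _ _) => [[sm cn']|] //.
  have hm := mD _ _ _ _ eo; rewrite (resE _ _ _ _ _ hm).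
  case er: (restrict_cl _ _ _ _ _) => [cl'|] // [<- <-].
  exists cl'; rewrite (stE _ _ _ _ _ hm); split=> //; last exact: cntE hm.
  apply/(sol_restrict _ _ _ hsub wD.1); exists cl0; rewrite er; split=> //.
  apply/(solD cl0 cl1 cl2); rewrite eo; split=> //.
  by rewrite LU; apply/hunion; exists cl1, cl2.
Qed.

(** * Listing all options and transitions exhaustively *)

Definition solb (V T : seq nat) (s : nat -> bool) (L : seq (nat * nat)) cl : bool :=
  [&& all (fun e => [&& s e.1, s e.2, e.1 \in V & e.2 \in V]) L, forest L
    & if cl then
        [&& all (fun t => ~~ s t) T, has s V
          & all (fun x => all (fun y => s x ==> s y ==> conn L x y) V) V]
      else all (fun x => s x ==> has (conn L x) T) V].

Lemma solP V T s L cl : reflect (sol V T s L cl) (solb V T s L cl).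
Proof.
apply: (iffP and3P) => -[h1 h2 h3]; split=> //.
- exact/allP.
- case: cl h3 => [/and3P[/allP nT /hasP hx hc]|/allP ho]; last first.
    by move=> x xV sx; have := ho x xV; rewrite sx.
  split=> // x y xV yV sx sy.
  by have /allP/(_ x xV)/allP/(_ y yV) := hc; rewrite sx sy.
- exact/allP.
- case: cl h3 => [[nT hx hc]|ho]; last first.
    by apply/allP => x xV; apply/implyP; apply: ho.
  apply/and3P; split; [exact/allP | exact/hasP |].
  apply/allP => x xV; apply/allP => y yV; apply/implyP => sx; apply/implyP => sy.
  exact: hc.
Qed.

Definition bitseqs (n : nat) : seq bitseq := [seq val b | b <- enum {: n.-tuple bool}].

Lemma mem_bitseqs n b : (b \in bitseqs n) = (size b == n).
Proof.
apply/mapP/idP => [[t _ ->]|h]; first by rewrite size_tuple.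
by exists (Tuple h); rewrite ?mem_enum.
Qed.

Definition rank tau (q : tstate tau) : nat := enum_rank q.

Lemma rank_inj tau : injective (@rank tau).
Proof. by move=> q1 q2 /val_inj/enum_rank_inj. Qed.

Definition leaf_opts (tau : nat) (p : tgraph) : seq (nat * nat * bitseq * bitseq) :=
  let A := built_prim p in
  flatten [seq flatten [seq flatten [seq
    let s := nth false vm in let L := mask em (bedges A) in
    if solb (bverts A) (bterms A) s L cl
    then [:: (rank (state_of tau (bterms A) s L cl), cnt (bverts A) (bterms A) s,
              vm, em)]
    else [::]
    | cl <- [:: true; false]] | em <- bitseqs (ne p)] | vm <- bitseqs (nv p)].

Definition node_trans (tau : nat) (r : crule) :
    seq ((nat * nat) * (nat * nat) * bitseq) :=
  flatten [seq flatten [seq flatten [seq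
    if rule_step r q1 q2 em is Some (q, d)
    then [:: ((rank q1, rank q2), (rank q, d), em)] else [::]
    | q1 <- enum (tstate tau)] | q2 <- enum (tstate tau)]
    | em <- bitseqs (count is_add (ops r))].

(* A state is accepting when closing all terminals completes a tree. *)
Definition final_states (tau : nat) : seq (nat * nat) :=
  [seq (rank q, count (dsel q) (iota 0 tau))
  | q <- enum (tstate tau)
    & restrict_cl (dsel q) (dcn q) (iota 0 tau) [::] q.2 == Some true].

Definition class_automaton (tau : nat) (Gamma : gclass) : automaton :=
  Automaton #|tstate tau|
    [seq (nv p, ne p, leaf_opts tau p) | p : tgraph <- prims Gamma]
    [seq (count is_add (ops r), node_trans tau r) | r <- rules Gamma]
    (final_states tau).

Lemma rank_lt tau (q : tstate tau) : rank q < #|tstate tau|.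
Proof. exact: ltn_ord. Qed.

Lemma leaf_optsP tau p q d vm em :
  (q, d, vm, em) \in leaf_opts tau p <->
  let A := built_prim p in
  [/\ size vm = nv p, size em = ne p &
   exists cl, [/\ sol (bverts A) (bterms A) (nth false vm) (mask em (bedges A)) cl,
     q = rank (state_of tau (bterms A) (nth false vm) (mask em (bedges A)) cl)
     & d = cnt (bverts A) (bterms A) (nth false vm)]].
Proof.
split.
  case/flatten_mapP=> vm'; rewrite mem_bitseqs => /eqP hv.
  case/flatten_mapP=> em'; rewrite mem_bitseqs => /eqP he.
  case/flatten_mapP=> cl _ /=; case: solP => // S; rewrite inE.
  by case/eqP=> -> -> -> ->; split=> //; exists cl.
case=> hv he [cl [/solP S -> ->]].
apply/flatten_mapP; exists vm; first by rewrite mem_bitseqs hv.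
apply/flatten_mapP; exists em; first by rewrite mem_bitseqs he.
apply/flatten_mapP; exists cl; first by case: cl {S}.
by rewrite /= S mem_head.
Qed.

Lemma node_transP tau r a1 a2 a d em :
  ((a1, a2), (a, d), em) \in node_trans tau r <->
  size em = count is_add (ops r) /\
  exists q1 q2 q : tstate tau, [/\ a1 = rank q1, a2 = rank q2, a = rank q
    & rule_step r q1 q2 em = Some (q, d)].
Proof.
split.
  case/flatten_mapP=> em'; rewrite mem_bitseqs => /eqP he.
  case/flatten_mapP=> q2 _ /flatten_mapP[q1 _].
  case er: rule_step => [[q d']|] //; rewrite inE => /eqP[-> -> -> -> ->].
  by split=> //; exists q1, q2, q.
case=> he [q1 [q2 [q [-> -> -> er]]]].
apply/flatten_mapP; exists em; first by rewrite mem_bitseqs he.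
apply/flatten_mapP; exists q2; rewrite ?mem_enum //.
apply/flatten_mapP; exists q1; rewrite ?mem_enum //.
by rewrite er mem_head.
Qed.

Lemma class_automaton_ok tau Gamma : automaton_ok (class_automaton tau Gamma).
Proof.
split.
- move=> i a b opts; rewrite onth_map; case: onth => //= p [<- <- <-].
  move=> [[[q d] vm] em] /leaf_optsP.
  by case=> -> -> [cl [_ -> _]]; rewrite rank_lt !eqxx.
- move=> i a trs; rewrite onth_map; case: onth => //= r [<- <-].
  move=> [[[q1 q2] [q d]] em] /node_transP.
  by case=> -> [p1 [p2 [p [-> -> -> _]]]]; rewrite !rank_lt eqxx.
- by move=> a /mapP[q _ ->]; apply: rank_lt.
Qed.

Lemma size_bedges_compose r A B :
  size (bedges (compose r A B)) =
  size (bedges A) + size (bedges B) + count is_add (ops r).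
Proof. by rewrite size_foldl_ops /= size_cat size_map. Qed.

Lemma onth_map_Some (T U : Type) (f : T -> U) s i x :
  onth s i = Some x -> onth (map f s) i = Some (f x).
Proof. by rewrite onth_map => ->. Qed.

Lemma onth_mem (T : eqType) (s : seq T) i x : onth s i = Some x -> x \in s.
Proof.
elim: s i => [|y s IH] [|i] //=; first by case=> ->; rewrite mem_head.
by move/IH; rewrite inE => ->; rewrite orbT.
Qed.

Lemma onth_all (T : Type) (p : pred T) s i x : all p s -> onth s i = Some x -> p x.
Proof. by elim: s i => [|y s IH] [|i] //= /andP[py ps]; [case=> <- | apply: IH]. Qed.

Lemma wfn_prim tau p : prim_ok tau p -> wfn (built_prim p).
Proof.
case/and3P=> _ up _; split; last by rewrite /= map_inj_uniq //; exact: val_inj.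
  split=> [x /mapP[t _ ->]|e /mapP[f _ ->]] /=; rewrite !mem_iota /= !add0n ?ltn_ord //.
by move=> x; rewrite /= mem_iota size_iota.
Qed.

Lemma build_wfn tau Gamma n m (t : ptree n m) A :
  class_ok tau Gamma -> build Gamma t = Some A ->
  [/\ wfn A, size (bterms A) <= tau, size (pverts t) = size (bverts A),
      size (pedges t) = size (bedges A) & fits (class_automaton tau Gamma) t].
Proof.
case/andP=> hp hr; elim: t A => [i vs es|i es t1 IH1 t2 IH2] A /=.
  case ep: onth => [p|] //; case: ifP => // /andP[/eqP hv /eqP he] [<-].
  have pok := onth_all hp ep; rewrite (onth_map_Some _ ep) /= hv he !eqxx.
  rewrite size_iota !size_map -enumT size_enum_ord; split=> //; first exact: wfn_prim pok.
  by case/and3P: pok.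
case er: onth => [r|] //; case e1: build => [A1|] //; case e2: build => [A2|] //.
case: ifP => // /and3P[/eqP h1 /eqP h2 /eqP he] [<-].
have rok := onth_all hr er.
have [w1 s1 v1 d1 sh1] := IH1 _ e1; have [w2 s2 v2 d2 sh2] := IH2 _ e2.
have [eV eT eTC] := compose_parts r A1 A2.
split.
- exact: wfn_compose rok w1 w2 h1 h2.
- by rewrite eTC size_map; case/and4P: rok.
- by rewrite eV size_map /= !size_cat size_map v1 v2.
- by rewrite size_bedges_compose !size_cat d1 d2 he.
- by rewrite (onth_map_Some _ er) /= he eqxx sh1.
Qed.

(** * Runs of the automaton correspond to partial solutions *)

Lemma eq_cnt V T s s' : {in V, s =1 s'} -> cnt V T s = cnt V T s'.
Proof.
by move=> h; rewrite /cnt; congr (size (undup _)); apply: eq_in_filter => x /h->.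
Qed.

Lemma run_sound tau Gamma n m (t : ptree n m) A q c vs es :
  class_ok tau Gamma -> build Gamma t = Some A ->
  run (class_automaton tau Gamma) t q c vs es ->
  exists s em cl,
    [/\ size em = size (bedges A),
        sol (bverts A) (bterms A) s (mask em (bedges A)) cl,
        q = rank (state_of tau (bterms A) s (mask em (bedges A)) cl),
        c = cnt (bverts A) (bterms A) s
      & vs = mask (map s (bverts A)) (pverts t) /\ es = mask em (pedges t)].
Proof.
move=> cok hb hr; elim: hr A hb => {t q c vs es}.
  move=> i vs es a b opts q d vm em hi ho A /=.
  case ep: onth => [p|] //; case: ifP => // /andP[/eqP hv /eqP he] [<-].
  move: hi; rewrite (onth_map_Some _ ep) => -[_ _ eo].
  move: ho; rewrite -eo => /leaf_optsP[sv se [cl [S -> ->]]].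
  exists (nth false vm), em, cl; split=> //.
    by rewrite size_map -?enumT size_enum_ord se.
  by split=> //; rewrite -[in LHS](mkseq_nth false vm) sv.
move=> i es t1 t2 a trs q1 q2 q d em c1 c2 vs1 vs2 es1 es2 hi ho _ IH1 _ IH2 A /=.
case er: onth => [r|] //; case e1: build => [A1|] //; case e2: build => [A2|] //.
case: ifP => // /and3P[/eqP h1 /eqP h2 /eqP he] [<-].
move: hi; rewrite (onth_map_Some _ er) => -[_ etr].
move: ho; rewrite -etr => /node_transP[hem [p1 [p2 [p [eq1 eq2 -> hst]]]]].
have /andP[_ hrok] := cok; have rok := onth_all hrok er.
have [w1 t1' v1 d1 _] := build_wfn cok e1; have [w2 t2' v2 d2 _] := build_wfn cok e2.
have [s1 [em1 [cl1 [z1 S1 eq1' -> [-> ->]]]]] := IH1 _ e1.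
have [s2 [em2 [cl2 [z2 S2 eq2' -> [-> ->]]]]] := IH2 _ e2.
have {eq1 eq1'} ep1 : p1 = _ := rank_inj (etrans (esym eq1) eq1').
have {eq2 eq2'} ep2 : p2 = _ := rank_inj (etrans (esym eq2) eq2').
set N := size (bverts A1).
(* The two selections are pasted together on the disjoint union. By [sF] the pasted selection
   already respects the identifications made by the rule, so it is also a selection of the composed
   graph. *)
pose s x := if x < N then s1 x else s2 (x - N).
set F := ops_fun (bterms (disj_union A1 A2)) (ops r).
have [wb1 n1 u1] := w1; have [wb2 n2 u2] := w2.
have sv1 : {in bverts A1, s1 =1 s} by move=> x /n1 hx; rewrite /s hx.
have sv2 x : s2 x = s (N + x) by rewrite /s ltnNge leq_addr addKn.
have sF : s \o F =1 s.
  move: hst; rewrite /rule_step; case: union_cl => // cl.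
  case eo: ops_step => [r'|] // _.
  have rok' := rok; case/and4P: rok' => hops _ _ _.
  have szU : size (bterms (disj_union A1 A2)) = larity r + rarity r.
    by rewrite /= size_cat size_map h1 h2.
  apply: ops_invar (eo) => //.
  - by rewrite szU.
  - apply: (@matches_union _ _ _ (bverts A1) (bverts A2) (mask em1 (bedges A1))
      (mask em2 (bedges A2))) => //; first exact: wb1.1.
    + by move=> e /mem_mask/wb1.2.
    + by move=> e /mem_mask/wb2.2.
    rewrite h1 h2 => k l hk hl; rewrite ep1 ep2.
    case: (ltnP k) => hk'; case: (ltnP l) => hl' //=; rewrite dcn_enc //.
      by rewrite h1 hk' hl'.
    by rewrite h2; have -> : k - larity r < rarity r by [lia];
      have -> : l - larity r < rarity r by [lia].
  - rewrite szU => k; rewrite mem_iota /= add0n => hk.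
    rewrite /= nth_cat h1 ep1 ep2; case: ltnP => hk'; rewrite dsel_enc //.
      rewrite h1 hk' /= sv1 //; apply: wb1.1; by rewrite mem_nth ?h1.
    have hk2 : k - larity r < rarity r by lia.
    by rewrite h2 hk2 (nth_map 0) ?h2 //= sv2.
have S1' : sol (bverts A1) (bterms A1) (s \o F) (mask em1 (bedges A1)) cl1.
  by apply: sol_ext S1; [exact: wb1.1 | move=> x xV; rewrite sF sv1].
have S2' : sol (bverts A2) (bterms A2) ((s \o F) \o addn N) (mask em2 (bedges A2)) cl2.
  apply: sol_ext S2; first exact: wb2.1.
  by move=> x _; rewrite [RHS]sF sv2.
have st1 : p1 = state_of tau (bterms A1) (s \o F) (mask em1 (bedges A1)) cl1.
  rewrite ep1; apply: enc_ext => // k hk; rewrite sF sv1 //.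
  by apply: wb1.1; rewrite mem_nth.
have st2 : p2 = state_of tau (bterms A2) ((s \o F) \o addn N) (mask em2 (bedges A2)) cl2.
  by rewrite ep2; apply: enc_ext => // k hk; rewrite [RHS]sF sv2.
have [_ /(_ cl1 cl2 p d S1')] := compose_spec s rok w1 w2 h1 h2
  (leq_trans (eq_leq (esym h1)) t1') (leq_trans (eq_leq (esym h2)) t2') z1 z2 hem.
rewrite -st1 -st2 => /(_ S2' hst) [cl [S -> ec]].
exists s, ((em1 ++ em2) ++ em), cl; split=> //.
- by rewrite size_bedges_compose !size_cat z1 z2 hem.
- rewrite ec; congr (_ + _ + _).
    by apply: eq_cnt => x xV; rewrite [RHS]sF sv1.
  by apply: eq_cnt => x xV; rewrite [RHS]sF sv2.
have [-> _ _] := compose_parts r A1 A2; rewrite -map_comp.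
rewrite /= (eq_map sF) map_cat -map_comp !mask_cat ?size_map ?size_cat ?v1 ?v2 ?d1 ?d2 ?z1 ?z2 //.
split=> //; congr (_ ++ _); last by congr mask; apply: eq_map => x /=; rewrite sv2.
by congr mask; apply/eq_in_map.
Qed.

Lemma run_complete tau Gamma n m (t : ptree n m) A s em cl :
  class_ok tau Gamma -> build Gamma t = Some A ->
  size em = size (bedges A) ->
  sol (bverts A) (bterms A) s (mask em (bedges A)) cl ->
  run (class_automaton tau Gamma) t
    (rank (state_of tau (bterms A) s (mask em (bedges A)) cl))
    (cnt (bverts A) (bterms A) s)
    (mask (map s (bverts A)) (pverts t)) (mask em (pedges t)).
Proof.
move=> cok; elim: t A s em cl => [i vs es|i es t1 IH1 t2 IH2] A s em cl /=.
  case ep: onth => [p|] //; case: ifP => // /andP[/eqP hv /eqP he] [<-] sem S.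
  have szem : size em = ne p by rewrite sem size_map -?enumT size_enum_ord.
  have hi : onth (leaf_rules (class_automaton tau Gamma)) i =
    Some (nv p, ne p, leaf_opts tau p) by rewrite onth_map ep.
  apply: (RunLeaf vs es hi).
  have pok := onth_all (andP cok).1 ep; have [[sT _] _ _] := wfn_prim pok.
  have es' : {in bverts (built_prim p), s =1 nth false (map s (iota 0 (nv p)))}.
    move=> x; rewrite /= mem_iota add0n => hx.
    by rewrite (nth_map 0) ?size_iota // nth_iota.
  apply/leaf_optsP; rewrite size_map size_iota; split=> //.
  exists cl; split.
  - exact: sol_ext sT es' S.
  - congr rank; apply: enc_ext => // k hk; apply: es'; apply: sT.
    by rewrite mem_nth.
  - exact: eq_cnt.
case er: onth => [r|] //; case e1: build => [A1|] //; case e2: build => [A2|] //.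
case: ifP => // /and3P[/eqP h1 /eqP h2 /eqP he] [<-] sem S.
have rok := onth_all (andP cok).2 er.
have [w1 t1' v1 d1 _] := build_wfn cok e1; have [w2 t2' v2 d2 _] := build_wfn cok e2.
set k1 := size (bedges A1); set k2 := size (bedges A2).
have szem : size em = k1 + k2 + count is_add (ops r).
  by rewrite sem size_bedges_compose.
set em1 := take k1 em; set em2 := take k2 (drop k1 em); set em3 := drop (k1 + k2) em.
have eem : em = (em1 ++ em2) ++ em3.
  by rewrite /em1 /em2 /em3 -takeD cat_take_drop.
have z1 : size em1 = k1 by rewrite size_takel // szem -addnA leq_addr.
have z2 : size em2 = k2 by rewrite size_takel // size_drop szem -addnA addKn leq_addr.
have z3 : size em3 = count is_add (ops r) by rewrite size_drop szem addKn.
have [hback hstep] := compose_spec s rok w1 w2 h1 h2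
  (leq_trans (eq_leq (esym h1)) t1') (leq_trans (eq_leq (esym h2)) t2') z1 z2 z3.
rewrite -eem in hback hstep.
have [cl1 [cl2 [S1 S2]]] := hback _ S.
case ers: rule_step => [[q d]|] // _.
have [cl' [S' eq ec]] := hstep _ _ _ _ S1 S2 ers.
have [wC _ _ _ _] : [/\ wfn (compose r A1 A2), true, true, true & true].
  by split=> //; apply: wfn_compose rok w1 w2 h1 h2.
(* An open solution reaches a terminal from each selected vertex, while a closed one selects a
   vertex but no terminal; hence the flag is determined. *)
have ecl : cl' = cl by apply: sol_cl_uniq S' S; case: wC => -[].
have -> : rank (state_of tau (bterms (compose r A1 A2)) s
    (mask em (bedges (compose r A1 A2))) cl) = rank q by rewrite eq ecl.
rewrite ec; have [-> _ _] := compose_parts r A1 A2; rewrite -map_comp /=.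
rewrite map_cat -map_comp mask_cat ?size_map ?v1 //.
rewrite {1}eem mask_cat ?size_cat ?z1 ?z2 ?d1 ?d2 // mask_cat ?z1 ?d1 //.
have hi : onth (node_rules (class_automaton tau Gamma)) i =
  Some (count is_add (ops r), node_trans tau r) by rewrite onth_map er.
apply: (RunNode es hi).
- by apply/node_transP; split=> //; do 3!eexists; split; [| | |exact: ers].
- exact: IH1 e1 z1 S1.
- exact: IH2 e2 z2 S2.
Qed.

(** * Runs and trees *)

Section Trees.
Variable G : graph.
Implicit Types (F : {set 'I_(ne G)}) (x y : 'I_(nv G)).

Lemma joinsE (T : eqType) (e : T * T) (x y : T) :
  joins e x y -> e = (x, y) \/ e = (y, x).
Proof. by case/orP=> /eqP; [left | right]. Qed.

Lemma walk_cat F x p q :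
  walk F x (p ++ q) = walk F x p && walk F (walk_end x p) q.
Proof.
rewrite /walk_end; elim: p x => [|[e y] p IH] x //=.
by rewrite IH -!andbA.
Qed.

Lemma walk_end_cat x (p q : seq ('I_(ne G) * 'I_(nv G))) :
  walk_end x (p ++ q) = walk_end (walk_end x p) q.
Proof. by rewrite /walk_end map_cat last_cat. Qed.

Lemma walk_conn F es x p : walk F x p -> {subset map fst p <= es} ->
  conn (map (@ends G) es) x (walk_end x p).
Proof.
elim: p x => [|[e y] p IH] x /=; first by rewrite conn_refl.
case/and3P=> _ hj hw hs.
have ee : e \in es by apply: hs; rewrite mem_head.
have hp : {subset map fst p <= es} by move=> z hz; apply: hs; rewrite inE hz orbT.
apply: conn_trans (IH y hw hp).
have := conn_edge (map_f (@ends G) ee).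
by case: (joinsE hj) => -> //=; rewrite conn_sym.
Qed.

Lemma conn_walk F es x y : {subset es <= F} -> conn (map (@ends G) es) x y ->
  exists p, walk F x p /\ walk_end x p = y.
Proof.
elim: es x y => [|e es IH] x y hs /=; first by move/eqP<-; exists [::].
have eF : e \in F by apply: hs; rewrite mem_head.
have {}IH a b := IH a b (fun z hz => hs z (mem_behead (s := e :: es) hz)).
have step a b : joins (ends e) a b -> conn (map (@ends G) es) x a ->
    conn (map (@ends G) es) b y -> exists p, walk F x p /\ walk_end x p = y.
  move=> hj /IH[p [hp ep]] /IH[q [hq eq]].
  exists (p ++ (e, b) :: q).
  by rewrite walk_cat hp walk_end_cat /= ep eF hj hq.
case/or3P=> [/IH//|/andP[]|/andP[]]; apply: step; rewrite /joins.
  by rewrite -surjective_pairing eqxx.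
by rewrite -surjective_pairing eqxx orbT.
Qed.

(** The first edge of a cycle does not recur, so the rest of the cycle connects its ends within
    [rem e es]. Moving that edge to the front of the list contradicts [forest]. *)
Lemma forest_acyclic F es : F =i es -> forest (map (@ends G) es) ->
  forall x p, ~ is_cycle F x p.
Proof.
move=> eF hf x [|[e y] p] [] //= _ /and3P[eF' hj hw] he /andP[ne' _] _.
have ees : e \in es by rewrite -eF.
have hp : {subset map fst p <= rem e es}.
  move=> z hz; have zF : z \in F.
    elim: p y hw hz {hj he ne'} => //= -[e' y'] p IH y /and3P[h _ hw].
    by rewrite inE => /orP[/eqP->//|]; apply: IH hw.
  have ze : z != e by apply: contraNneq ne' => <-.
  rewrite eF in zF; move: zF; rewrite (perm_mem (perm_to_rem ees)) inE.
  by rewrite (negPf ze).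
have := walk_conn hw hp; rewrite /walk_end.
have -> : last y (map snd p) = x by [].
move: hf; rewrite (perm_forest (perm_map (@ends G) (perm_to_rem ees))) /=.
by case: (joinsE hj) => -> /= /andP[/negPf h _]; rewrite ?h // conn_sym h.
Qed.
End Trees.

(** A parse tree matches the edges of the graph with the built ones only up to orientation. *)
Definition same_ends (T : eqType) (e f : T * T) : bool := joins e f.1 f.2.

Lemma eq_conn_ends (T : eqType) (L L' : seq (T * T)) :
  all2 (@same_ends T) L L' -> conn L =2 conn L'.
Proof.
elim: L L' => [|e L IH] [|f L'] //= /andP[h /IH {}IH] x y.
rewrite !IH; case: (joinsE h) => ->; first by [].
by rewrite /= [X in _ || X]orbC.
Qed.

Lemma forest_ends (T : eqType) (L L' : seq (T * T)) :
  all2 (@same_ends T) L L' -> forest L = forest L'.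
Proof.
elim: L L' => [|e L IH] [|f L'] //= /andP[h hL]; rewrite (IH _ hL).
rewrite (eq_conn_ends hL); case: (joinsE h) => -> //=.
by rewrite conn_sym.
Qed.

Lemma all2_mask (T U : Type) (r : T -> U -> bool) m s s' :
  all2 r s s' -> all2 r (mask m s) (mask m s').
Proof.
elim: m s s' => [|b m IH] [|x s] [|y s'] //= /andP[h1 h2].
by case: b => /=; rewrite ?h1 IH.
Qed.

Lemma all2_mapP (T U V W : Type) (r : V -> W -> bool) (f : T -> V) (g : U -> W) s s' :
  all2 (fun x y => r (f x) (g y)) s s' = all2 r (map f s) (map g s').
Proof. by elim: s s' => [|x s IH] [|y s'] //=; rewrite IH. Qed.

Lemma all2_mem (T U : eqType) (r : T -> U -> bool) s s' y :
  all2 r s s' -> y \in s' -> exists2 x, x \in s & r x y.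
Proof.
elim: s s' => [|x s IH] [|z s'] //= /andP[h1 h2].
rewrite inE => /orP[/eqP->|/(IH _ h2)[w ws hw]]; first by exists x; rewrite ?mem_head.
by exists w; rewrite // inE ws orbT.
Qed.

Lemma all2_meml (T U : eqType) (r : T -> U -> bool) s s' x :
  all2 r s s' -> x \in s -> exists2 y, y \in s' & r x y.
Proof.
elim: s s' => [|z s IH] [|y s'] //= /andP[h1 h2].
rewrite inE => /orP[/eqP->|/(IH _ h2)[w ws hw]]; first by exists y; rewrite ?mem_head.
by exists w; rewrite // inE ws orbT.
Qed.

Lemma size_undup_map_in (T U : eqType) (f : T -> U) (s : seq T) :
  {in s &, injective f} -> size (undup (map f s)) = size (undup s).
Proof.
move=> fi; rewrite -(size_map f (undup s)); apply/perm_size/uniq_perm.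
- exact: undup_uniq.
- rewrite map_inj_in_uniq ?undup_uniq // => x y; rewrite !mem_undup; exact: fi.
- move=> z; rewrite mem_undup; apply/mapP/mapP => -[x xs ->]; exists x => //;
    by rewrite mem_undup in xs *.
Qed.

(** The accepting test runs over all [tau] indices without knowing how many terminals there are. The
    indices beyond [size T] are unselected padding, neutral for the test and for the count. *)
Lemma final_stateP tau V T s L cl :
  {subset T <= V} -> uniq T -> size T <= tau ->
  let q := state_of tau T s L cl in
  restrict_cl (dsel q) (dcn q) (iota 0 tau) [::] cl =
    restrict_cl s (conn L) T [::] cl /\
  cnt V [::] s = cnt V T s + count (dsel q) (iota 0 tau).
Proof.
move=> sTV uT hT q.
have eI : iota 0 tau = iota 0 (size T) ++ iota (size T) (tau - size T).
  by rewrite -iotaD subnKC.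
have hi i : i < size T -> dsel q i = s (nth 0 T i).
  by move=> h; rewrite dsel_enc // h.
have ho i : i \in iota (size T) (tau - size T) -> dsel q i = false.
  by rewrite mem_iota => /andP[h _]; rewrite dsel_enc // ltnNge h.
split.
  rewrite -[in RHS](map_nth_size T) -[in RHS]/(map (nth 0 T) [::]).
  rewrite -(@restrict_cl_map T (iota 0 (size T)) [::] (dsel q) (dcn q)) //; first last.
  - move=> i j; rewrite !mem_iota /= => h1 h2.
    by rewrite /q dcn_enc // h1 h2.
  - by move=> i; rewrite mem_iota /= => /hi.
  move: hi ho; rewrite {}/q; move: (dsel _) (dcn _) => se cn hi ho.
  rewrite /restrict_cl; case: cl => //=.
  rewrite eI !all_cat /=.
  have -> : all (fun i => se i ==> false) (iota (size T) (tau - size T)).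
    by apply/allP => i /ho ->.
  rewrite andbT; case: ifP => // _.
  have h1 : all (fun i => all (fun j => se i && se j ==> cn i j)
      (iota 0 (size T) ++ iota (size T) (tau - size T))) (iota (size T) (tau - size T)).
    by apply/allP => i /ho ->; apply/allP.
  rewrite h1 andbT; congr (if _ then _ else _); apply: eq_all => i.
  rewrite all_cat [X in _ && X](_ : _ = true) ?andbT //.
  by apply/allP => j /ho ->; rewrite andbF.
rewrite (@cnt_restrict V T [::]) //; congr (_ + _).
rewrite eI count_cat [X in _ + X](_ : _ = 0) ?addn0; last first.
  by apply/eqP; rewrite -leqn0 leqNgt -has_count; apply/hasPn => i /ho ->.
rewrite undup_id ?filter_uniq // size_filter -[in LHS](map_nth_size T) count_map.
by apply: eq_in_count => i; rewrite mem_iota /= => h; rewrite hi ?andbT.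
Qed.

Lemma set_seq_card (T : finType) (s : seq T) : #|[set x in s]| = size (undup s).
Proof.
rewrite cardsE -(card_uniqP (undup_uniq s)); apply: eq_card => x.
by rewrite mem_undup.
Qed.

(** Acceptance means that dropping all terminals leaves a closed solution, that is, one nonempty
    acyclic component, which [phi] carries over to the graph. The selected terminals of the root are
    counted only at this point, by the summand [d]. *)
Lemma run_tree tau Gamma (G : graph) (t : ptree (nv G) (ne G)) q c vs es d :
  class_ok tau Gamma -> parses Gamma t ->
  run (class_automaton tau Gamma) t q c vs es ->
  (q, d) \in accepts (class_automaton tau Gamma) ->
  [/\ @is_tree G [set x in vs] [set e in es], #|[set x in vs]| = c + d & uniq es].
Proof.
move=> cok [A [phi [hb phi_inj [hv hall] hE hj]]] hr.
have [[[sT wE] nA uT] hT szv sze _] := build_wfn cok hb.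
have [s [em [cl [zem S -> -> [-> ->]]]]] := run_sound cok hb hr.
set L := mask em (bedges A) in S *; set es' := mask em (pedges t).
case/mapP=> q'; rewrite mem_filter => /andP[/eqP hres _] [/rank_inj eq ->].
have [hr' hcnt] := final_stateP s L cl sT uT hT.
have {}S : sol (bverts A) [::] s L true.
  by apply/(sol_restrict _ _ _ _ sT) => //; exists cl; rewrite -hr'; move: hres; rewrite -eq.
have [He fL [_ [x0 x0V sx0] hc]] := S.
have hvs : mask (map s (bverts A)) (pverts t) = map phi [seq x <- bverts A | s x].
  by rewrite hv -map_mask -filter_mask.
have hends : all2 (@same_ends _) (map (@ends G) es') (map (map_pair phi) L).
  by rewrite -all2_mapP; apply: all2_mask.
have LV : {in L, forall e, (e.1 \in bverts A) && (e.2 \in bverts A)}.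
  by move=> e /He /and4P[_ _ -> ->].
have uE : uniq es' by rewrite mask_uniq // (perm_uniq hE) enum_uniq.
have memS x : (x \in [set y in mask (map s (bverts A)) (pverts t)]) =
    (x \in map phi [seq x <- bverts A | s x]) by rewrite inE hvs.
split=> //.
- split.
  + apply/set0Pn; exists (phi x0); rewrite memS map_f // mem_filter sx0; exact: x0V.
  + move=> e; rewrite inE => /(map_f (@ends G)) /(all2_meml hends) [f /mapP[e' eL ->]].
    have /and4P[s1 s2 v1 v2] := He _ eL; rewrite !memS.
    by case/joinsE=> -> /=; rewrite !map_f // mem_filter ?s1 ?s2.
  + move=> x y; rewrite !memS => /mapP[a + ->] /mapP[b + ->].
    rewrite !mem_filter => /andP[sa aV] /andP[sb bV].
    apply: (@conn_walk _ _ es'); first by move=> z; rewrite inE.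
    rewrite (eq_conn_ends hends) (@conn_map _ _ _ (mem (bverts A))) //.
    exact: hc.
  + apply: (@forest_acyclic _ _ es'); first by move=> z; rewrite inE.
    by rewrite (forest_ends hends) (@forest_map _ _ _ (mem (bverts A))).
- rewrite set_seq_card hvs size_undup_map_in; last first.
    by move=> x y; rewrite !mem_filter => /andP[_ h1] /andP[_ h2]; apply: phi_inj.
  rewrite -eq -hcnt /cnt; congr (size (undup _)); apply: eq_filter => x.
  by rewrite andbT.
Qed.

(** The edges handed to the automaton form the greedy spanning forest of the edges in [F]: acyclic
    by construction, with the same connectivity. The result is the inclusion [{subset es <= F}],
    which nonnegative weights later turn into a comparison of weights. *)
Lemma tree_run tau Gamma (G : graph) (t : ptree (nv G) (ne G)) S F :
  class_ok tau Gamma -> parses Gamma t -> @is_tree G S F ->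
  exists q c vs es d,
  [/\ run (class_automaton tau Gamma) t q c vs es,
      (q, d) \in accepts (class_automaton tau Gamma), #|S| = c + d,
      uniq es & {subset es <= F}].
Proof.
move=> cok [A [phi [hb phi_inj [hv hall] hE hj]]] [S0 hsub hcon _].
have [[[sT wE] nA uT] hT szv sze _] := build_wfn cok hb.
pose s a := phi a \in S; pose em0 := map (mem F) (pedges t).
have zem0 : size em0 = size (bedges A) by rewrite size_map.
set L0 := mask em0 (bedges A); pose em := span_mask em0 (bedges A).
set L := mask em (bedges A).
have eF : mask em0 (pedges t) = [seq e <- pedges t | e \in F].
  by rewrite -filter_mask.
have hL0 : all2 (@same_ends _) (map (@ends G) (mask em0 (pedges t)))
    (map (map_pair phi) L0).
  by rewrite -all2_mapP; apply: all2_mask.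
have L0V : {in L0, forall e, (e.1 \in bverts A) && (e.2 \in bverts A)}.
  by move=> e /mem_mask/wE.
have LL0 : {subset L <= L0} by apply: mask_span_sub.
have hsol : sol (bverts A) [::] s L true.
  split; last split=> //.
  - move=> e /LL0 eL; have /andP[-> ->] := L0V _ eL.
    have [f] := all2_mem hL0 (map_f (map_pair phi) eL).
    case/mapP=> f'; rewrite eF mem_filter => /andP[/hsub /andP[h1 h2] _] ->.
    by rewrite /s; case/joinsE => /= ef; rewrite ef /= in h1 h2; rewrite h1 h2.
  - exact: forest_span.
  - case/set0Pn: S0 => x xS; have := hall x; rewrite hv => /mapP[a aV ex].
    by exists a => //; rewrite /s -ex.
  - move=> a b aV bV sa sb; rewrite conn_span.
    have [p [hw hp]] := hcon _ _ sa sb.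
    have hpF : {subset map fst p <= mask em0 (pedges t)}.
      move=> e he; rewrite eF mem_filter (perm_mem hE) mem_enum andbT.
      elim: p (phi a) hw he {hp} => //= -[e' y'] p IH x /and3P[h _ hw].
      by rewrite inE => /orP[/eqP->//|]; apply: IH hw.
    have := walk_conn hw hpF; rewrite hp (eq_conn_ends hL0).
    by rewrite (@conn_map _ _ _ (mem (bverts A))).
have T0 : {subset [::] <= bterms A} by [].
have [cl [S1 hres]] := (sol_restrict s L true T0 sT).1 hsol.
have zem : size em = size (bedges A) by apply: size_span_mask.
have hrun := run_complete cok hb zem S1.
have [hr' hcnt] := final_stateP s L cl sT uT hT.
exists (rank (state_of tau (bterms A) s L cl)), (cnt (bverts A) (bterms A) s).
do 2!eexists; exists (count (dsel (state_of tau (bterms A) s L cl)) (iota 0 tau)).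
split; first exact: hrun.
- apply/mapP; exists (state_of tau (bterms A) s L cl) => //.
  by rewrite mem_filter mem_enum hr' hres eqxx.
- rewrite -hcnt /cnt (eq_filter (a2 := s)); last by move=> x; rewrite andbT.
  rewrite -(@size_undup_map_in _ _ phi); last first.
    by move=> x y; rewrite !mem_filter => /andP[_ h1] /andP[_ h2]; apply: phi_inj.
  rewrite -set_seq_card; apply: eq_card => x; rewrite inE.
  have := hall x; rewrite hv => /mapP[a aV ->].
  apply/idP/mapP => [h|[b + ->]]; last by rewrite mem_filter => /andP[].
  by exists a; rewrite // mem_filter aV andbT.
- by rewrite mask_uniq // (perm_uniq hE) enum_uniq.
- by move=> e /mask_span_sub; rewrite eF mem_filter => /andP[].
Qed.

(** * Programs *)

Definition wp (R : realDomainType) (c : com) (T : nat) (s : state R)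
    (Q : state R -> Prop) : Prop :=
  exists T' s', [/\ exec c s T' s', T' <= T & Q s'].

Lemma wp_weaken (R : realDomainType) c T T' (s : state R) (Q Q' : state R -> Prop) :
  wp c T s Q -> T <= T' -> (forall s', Q s' -> Q' s') -> wp c T' s Q'.
Proof.
case=> T0 [s0 [h1 h2 h3]] hT hQ; exists T0, s0; split=> //; last exact: hQ.
exact: leq_trans hT.
Qed.

Lemma wp_seq (R : realDomainType) c1 c2 T1 T2 (s : state R) Q :
  wp c1 T1 s (fun s1 => wp c2 T2 s1 Q) -> wp (Seq c1 c2) (T1 + T2) s Q.
Proof.
case=> T1' [s1 [h1 hT1 [T2' [s2 [h2 hT2 hQ]]]]].
exists (T1' + T2'), s2; split=> //; [exact: ESeq h1 h2 | exact: leq_add].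
Qed.

Lemma wp_if_true (R : realDomainType) b c1 c2 T (s : state R) Q :
  beval s b -> wp c1 T s Q -> wp (If b c1 c2) (bcost b + T).+1 s Q.
Proof.
move=> hb [T' [s' [he hT hQ]]]; exists (bcost b + T').+1, s'.
by split=> //; [exact: EIfTrue | rewrite ltnS leq_add2l].
Qed.

Lemma wp_if_false (R : realDomainType) b c1 c2 T (s : state R) Q :
  ~~ beval s b -> wp c2 T s Q -> wp (If b c1 c2) (bcost b + T).+1 s Q.
Proof.
move=> hb [T' [s' [he hT hQ]]]; exists (bcost b + T').+1, s'.
by split=> //; [exact: EIfFalse | rewrite ltnS leq_add2l].
Qed.

Lemma wp_while_true (R : realDomainType) b c T1 T2 (s : state R) Q :
  beval s b -> wp c T1 s (fun s1 => wp (While b c) T2 s1 Q) ->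
  wp (While b c) (bcost b + T1 + T2).+1 s Q.
Proof.
move=> hb [T1' [s1 [h1 hT1 [T2' [s2 [h2 hT2 hQ]]]]]].
exists (bcost b + T1' + T2').+1, s2; split=> //; first exact: EWhileTrue h1 h2.
by rewrite ltnS !leq_add.
Qed.

Lemma wp_while_false (R : realDomainType) b c (s : state R) (Q : state R -> Prop) :
  ~~ beval s b -> Q s -> wp (While b c) (bcost b).+1 s Q.
Proof. by move=> hb hQ; exists (bcost b).+1, s; split=> //; apply: EWhileFalse. Qed.

(** * Loop-free fragments and loops unrolled into program text *)

Fixpoint loopfree (c : com) : bool :=
  match c with
  | Seq c1 c2 | If _ c1 c2 => loopfree c1 && loopfree c2
  | While _ _ => false
  | _ => true
  end.

Fixpoint sem (R : realDomainType) (c : com) (s : state R) : state R :=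
  match c with
  | Skip | While _ _ => s
  | NSet a i e => State (upd (nmem s) a (neval s i) (neval s e)) (wmem s)
  | WSet a i e => State (nmem s) (upd (wmem s) a (neval s i) (weval s e))
  | Seq c1 c2 => sem c2 (sem c1 s)
  | If b c1 c2 => if beval s b then sem c1 s else sem c2 s
  end.

(** Both branches of a conditional are charged, which makes the bound independent of the state. *)
Fixpoint ccost (c : com) : nat :=
  match c with
  | Skip | While _ _ => 1
  | NSet _ i e => (ncost i + ncost e).+1
  | WSet _ i e => (ncost i + wcost e).+1
  | Seq c1 c2 => ccost c1 + ccost c2
  | If b c1 c2 => (bcost b + (ccost c1 + ccost c2)).+1
  end.

Lemma wp_sem (R : realDomainType) c (s : state R) (Q : state R -> Prop) :
  loopfree c -> Q (sem c s) -> wp c (ccost c) s Q.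
Proof.
elim: c s Q => //= [|a i e|a i e|c1 IH1 c2 IH2|b c1 IH1 c2 IH2] s Q.
- by exists 1, s; split=> //; apply: ESkip.
- by move=> _ hQ; do 2!eexists; split; [exact: ENSet | |].
- by move=> _ hQ; do 2!eexists; split; [exact: EWSet | |].
- by case/andP=> l1 l2 hQ; apply/wp_seq/IH1 => //; apply: IH2.
- case/andP=> l1 l2; case: ifP => hb hQ.
    apply: wp_weaken (wp_if_true _ hb (IH1 _ _ l1 hQ)) _ _ => //.
    by rewrite ltnS leq_add2l leq_addr.
  apply: wp_weaken (wp_if_false _ (negbT hb) (IH2 _ _ l2 hQ)) _ _ => //.
  by rewrite ltnS leq_add2l leq_addl.
Qed.

Lemma wp_sem_seq (R : realDomainType) c1 c2 T (s : state R) Q :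
  loopfree c1 -> wp c2 T (sem c1 s) Q -> wp (Seq c1 c2) (ccost c1 + T) s Q.
Proof. by move=> l1 h; apply/wp_seq/wp_sem. Qed.

(** A loop over a list belonging to the automaton, not to the input; it is unrolled when the program
    is written, and [ch] is the position in the list. *)
Fixpoint seqi (A : Type) (f : nat -> A -> com) (l : seq A) (ch : nat) : com :=
  if l is o :: l' then Seq (f ch o) (seqi f l' ch.+1) else Skip.

Fixpoint sum_cost (A : Type) (T : nat -> A -> nat) (l : seq A) (ch : nat) : nat :=
  if l is o :: l' then T ch o + sum_cost T l' ch.+1 else 1.

Lemma wp_seqi (R : realDomainType) (A : Type) (f : nat -> A -> com) T l
    (I : nat -> state R -> Prop) (s : state R) :
  (forall ch o s, onth l ch = Some o -> I ch s -> wp (f ch o) (T ch o) s (I ch.+1)) ->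
  I 0 s -> wp (seqi f l 0) (sum_cost T l 0) s (I (size l)).
Proof.
move=> H; have: forall l1 l2, l = l1 ++ l2 -> I (size l1) s ->
    wp (seqi f l2 (size l1)) (sum_cost T l2 (size l1)) s (I (size l)); last first.
  by move=> H' hI; apply: (H' [::] l).
move=> l1 l2; elim: l2 l1 s => [|o l2 IH] l1 s e hI /=.
  by exists 1, s; split=> //; [exact: ESkip | rewrite e cats0].
have ho : onth l (size l1) = Some o.
  by rewrite e; elim: (l1) => //= _ ? ->.
apply/wp_seq; apply: wp_weaken (H _ _ _ ho hI) _ _ => // s' hI'.
have /(_ s') := IH (rcons l1 o); rewrite size_rcons; apply=> //.
by rewrite cat_rcons.
Qed.

Lemma sum_cost_bound (A : Type) (T : nat -> nat -> A -> nat) (f : nat -> nat) l ch :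
  (forall x, 0 < f x) ->
  (forall ch o, exists C, forall x, T x ch o <= C * f x) ->
  exists C, forall x, sum_cost (T x) l ch <= C * f x.
Proof.
move=> f0 H; elim: l ch => [|o l IH] ch /=; first by exists 1 => x; rewrite mul1n.
have [C1 h1] := H ch o; have [C2 h2] := IH ch.+1.
by exists (C1 + C2) => x; rewrite mulnDl leq_add ?h1 ?h2.
Qed.

(** Selects a case by the value of [e]. The test by [<=] suffices because the smaller values were
    excluded by the preceding tests. *)
Fixpoint dispatch (A : Type) (e : nexp) (f : nat -> A -> com) (l : seq A)
    (ch : nat) : com :=
  if l is o :: l' then If (BLe e (NConst ch)) (f ch o) (dispatch e f l' ch.+1)
  else Skip.

(** All cases are charged, whichever one is taken; [ncost e + 3] is the cost of one test. *)
Lemma wp_dispatch (R : realDomainType) (A : Type) e (f : nat -> A -> com) T l j o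
    (s : state R) Q :
  onth l j = Some o -> neval s e = j -> wp (f j o) (T j o) s Q ->
  wp (dispatch e f l 0) (sum_cost (fun ch o => (ncost e + 3) + T ch o) l 0) s Q.
Proof.
move=> ho he hw.
suff H i l' j' : onth l' j' = Some o -> j = i + j' ->
   wp (dispatch e f l' i) (sum_cost (fun ch o => (ncost e + 3) + T ch o) l' i) s Q.
  exact: H ho _.
elim: l' i j' => [|o' l' IH] i [|j'] //=.
  move=> [->]; rewrite addn0 => ej; rewrite -ej.
  have hb : beval s (BLe e (NConst j)) by rewrite /= he.
  apply: wp_weaken (wp_if_true _ hb hw) _ _ => //.
  by rewrite /=; lia.
move=> ho' ej.
have hb : ~~ beval s (BLe e (NConst i)) by rewrite /= he ej; lia.
have h := IH i.+1 j' ho'; rewrite addSnnS in h.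
apply: wp_weaken (wp_if_false _ hb (h ej)) _ _ => //.
by rewrite /=; lia.
Qed.

Lemma sem_dispatch (R : realDomainType) (A : Type) e (f : nat -> A -> com) l j o
    (s : state R) :
  onth l j = Some o -> neval s e = j -> sem (dispatch e f l 0) s = sem (f j o) s.
Proof.
move=> ho he.
suff H i l' j' : onth l' j' = Some o -> j = i + j' ->
    sem (dispatch e f l' i) s = sem (f j o) s by apply: H ho _.
elim: l' i j' => [|o' l' IH] i [|j'] //=.
  by move=> [->]; rewrite addn0 => ej; rewrite he ej leqnn.
move=> ho' ej; rewrite he ifF; first by apply: IH ho' _; rewrite ej addnS.
by apply/negP; lia.
Qed.

Lemma loopfree_dispatch (A : Type) e (f : nat -> A -> com) l i :
  (forall ch o, loopfree (f ch o)) -> loopfree (dispatch e f l i).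
Proof. by move=> h; elim: l i => //= o l IH i; rewrite h IH. Qed.

Definition vr (v : nat) : nexp := NGet 7 (NConst v).
Definition setv (v : nat) (e : nexp) : com := NSet 7 (NConst v) e.
Definition kx : nexp := NGet 0 (NConst 0).
(** The minimum with k, expressed by truncated subtraction: e - (e - k). *)
Definition mink (e : nexp) : nexp := NSub e (NSub e kx).

Lemma neval_mink (R : realDomainType) (s : state R) e :
  neval s (mink e) = minn (nmem s 0 0) (neval s e).
Proof. by rewrite /=; lia. Qed.

(** The counter runs from 0 to [k] inclusive. Each of the [k.+1] iterations pays 6 for its test, and
    so does the final failing test. *)
Lemma wp_upto (R : realDomainType) v k body Tb (I : nat -> state R -> Prop) (s : state R) :
  (forall j s, I j s -> nmem s 7 v = j /\ nmem s 0 0 = k) ->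
  (forall j s, j <= k -> I j s -> wp body Tb s (I j.+1)) ->
  I 0 s ->
  wp (While (BLe (vr v) kx) body) (k.+1 * (Tb + 6) + 6) s (I k.+1).
Proof.
move=> hv hb.
suff H n j s' : n + j = k.+1 -> I j s' ->
    wp (While (BLe (vr v) kx) body) (n * (Tb + 6) + 6) s' (I k.+1).
  by apply: H; rewrite addn0.
elim: n j s' => [|n IH] j s' e hI; have [h1 h2] := hv _ _ hI.
  rewrite add0n in e; apply: wp_while_false; last by rewrite -e.
  by rewrite /= h1 h2 e -ltnNge.
apply: wp_weaken (wp_while_true (T1 := Tb) (T2 := n * (Tb + 6) + 6) _ _) _ _.
- by rewrite /= h1 h2; lia.
- apply: wp_weaken (hb _ _ _ hI) (leqnn _) _; first by lia.
  by move=> s1; apply: IH; lia.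
- by rewrite /=; lia.
- by [].
Qed.

(* Arrays number 13 and above hold the tables. *)
Definition aD (q : nat) : nat := (3 * q).+4.+4.+4.+1.
Definition aL (q : nat) : nat := (3 * q).+4.+4.+4.+2.
Definition aR (q : nat) : nat := (3 * q).+4.+4.+4.+3.

(** Choice, counts of the two operands, and weight of the best run found. The field [en_ch] is one
    more than the number of the chosen option or transition, so that 0, the content of fresh memory,
    marks an absent entry. *)
Record entry (R : Type) := Entry { en_ch : nat; en_l : nat; en_r : nat; en_w : R }.

Definition tab (R : Type) (s : state R) (q x : nat) : entry R :=
  Entry (nmem s (aD q) x) (nmem s (aL q) x) (nmem s (aR q) x) (wmem s q.+2 x).

(** Such expressions read no table, so their values survive the writes of [relax], which go to
    number arrays from 13 on. *)
Fixpoint nlow (e : nexp) : bool :=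
  match e with
  | NConst _ => true
  | NGet a i => (a < 13) && nlow i
  | NAdd e1 e2 | NSub e1 e2 => nlow e1 && nlow e2
  end.

Lemma neval_low (R : realDomainType) (s s' : state R) e : nlow e ->
  (forall a i, a < 13 -> nmem s' a i = nmem s a i) -> neval s' e = neval s e.
Proof.
move=> he h; elim: e he => //= [a i IH /andP[ha hi]|e1 IH1 e2 IH2|e1 IH1 e2 IH2].
- by rewrite h // IH.
- by case/andP=> h1 h2; rewrite IH1 // IH2.
- by case/andP=> h1 h2; rewrite IH1 // IH2.
Qed.

Definition relax (q : nat) (a : nexp) (ch : nat) (e1 e2 : nexp) (we : wexp) : com :=
  let store := Seq (NSet (aL q) a e1) (Seq (NSet (aR q) a e2)
    (Seq (WSet q.+2 a we) (NSet (aD q) a (NConst ch.+1)))) in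
  If (BLe (NGet (aD q) a) (NConst 0)) store
     (If (BWLe (WGet q.+2 a) we) Skip store).

Fixpoint wlow (e : wexp) : bool :=
  match e with
  | WZero => true
  | WGet _ i => nlow i
  | WAdd e1 e2 | WSub e1 e2 => wlow e1 && wlow e2
  end.

Lemma weval_low (R : realDomainType) (s s' : state R) e : wlow e ->
  (forall a i, a < 13 -> nmem s' a i = nmem s a i) -> wmem s' = wmem s ->
  weval s' e = weval s e.
Proof.
move=> he h hw; elim: e he => //= [a i hi|e1 IH1 e2 IH2 /andP[h1 h2]|e1 IH1 e2 IH2 /andP[h1 h2]].
- by rewrite hw (neval_low hi h).
- by rewrite IH1 // IH2.
- by rewrite IH1 // IH2.
Qed.

(** * Tables *)

Lemma sem_relax (R : realDomainType) (s : state R) q a ch e1 e2 we :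
  nlow a -> nlow e1 -> nlow e2 -> wlow we ->
  let s' := sem (relax q a ch e1 e2 we) s in
  let x := neval s a in let v := weval s we in
  [/\ forall a i, a < 13 -> nmem s' a i = nmem s a i,
      forall a i, a < 2 -> wmem s' a i = wmem s a i
    & forall q' y, tab s' q' y =
        if [&& q' == q, y == x
             & (en_ch (tab s q x) == 0) || (v < en_w (tab s q x))%R]
        then Entry ch.+1 (neval s e1) (neval s e2) v else tab s q' y].
Proof.
move=> la l1 l2 lw s' x v.
set u := (_ == 0) || _.
set store := Seq (NSet (aL q) a e1) (Seq (NSet (aR q) a e2)
    (Seq (WSet q.+2 a we) (NSet (aD q) a (NConst ch.+1)))).
have es' : s' = if u then sem store s else s.
  rewrite /s' /= /u /= -leqn0 -/x -/v; case: (_ <= 0) => //=.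
  by rewrite real_leNgt ?num_real //; case: (_ < _)%R.
have est : sem store s = State
    (upd (upd (upd (nmem s) (aL q) x (neval s e1)) (aR q) x (neval s e2)) (aD q) x ch.+1)
    (upd (wmem s) q.+2 x v).
  have h2 : forall a i, a < 13 ->
      upd (upd (nmem s) (aL q) x (neval s e1)) (aR q) x (neval s e2) a i = nmem s a i.
    move=> a' i' ha'; rewrite /upd !ifF //; apply/negP => /andP[/eqP];
      rewrite /aL /aR; lia.
  have h1 : forall a i, a < 13 ->
      upd (nmem s) (aL q) x (neval s e1) a i = nmem s a i.
    by move=> a' i' ha'; rewrite /upd !ifF //; apply/negP => /andP[/eqP]; rewrite /aL; lia.
  rewrite /=; set s1 := State (upd (nmem s) _ _ _) _.
  have -> : neval s1 e2 = neval s e2 := @neval_low R s s1 e2 l2 h1.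
  have -> : neval s1 a = x := @neval_low R s s1 a la h1.
  set s2 := State _ (wmem s).
  have -> : neval s2 a = x := @neval_low R s s2 a la h2.
  have -> : weval s2 we = v := @weval_low R s s2 we lw h2 erefl.
  pose s3 := State (nmem s2) (upd (wmem s) q.+2 x v).
  have e3 : neval s3 a = x := @neval_low R s s3 a la h2.
  by rewrite /s3 /s2 /= in e3; rewrite e3.
rewrite {}es'; case: u; last first.
  by split=> // q' y; rewrite !andbF.
rewrite est; split=> [a' i ha'|a' i ha'|q' y].
- by rewrite /= /upd !ifF //; apply/negP => /andP[/eqP]; rewrite /aL /aR /aD; lia.
- by rewrite /= /upd ifF //; apply/negP => /andP[/eqP]; lia.
rewrite andbT /tab /= /upd.
have e0 : (aD q' == aD q) = (q' == q) by rewrite /aD; lia.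
have e3 : (aL q' == aL q) = (q' == q) by rewrite /aL; lia.
have e4 : (aR q' == aR q) = (q' == q) by rewrite /aR; lia.
have e5 : (q'.+2 == q.+2) = (q' == q) by lia.
have n1 : (aD q' == aL q) = false by rewrite /aD /aL; lia.
have n2 : (aD q' == aR q) = false by rewrite /aD /aR; lia.
have n3 : (aL q' == aD q) = false by rewrite /aD /aL; lia.
have n4 : (aL q' == aR q) = false by rewrite /aR /aL; lia.
have n5 : (aR q' == aD q) = false by rewrite /aD /aR; lia.
have n6 : (aR q' == aL q) = false by rewrite /aR /aL; lia.
by rewrite e0 e3 e4 e5 n1 n2 n3 n4 n5 n6 /=; case: (q' == q); case: (y == x).
Qed.

(** Correctness of a table has two halves. [sound] says that every entry present is justified by its
    recorded choice; [covers] says that a given weight is matched or beaten, a property that further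
    relaxation preserves. *)
Definition sound (R : Type) (s : state R) (r k : nat)
    (J : nat -> nat -> entry R -> Prop) : Prop :=
  forall q c, c <= k -> en_ch (tab s q (r + c)) != 0 -> J q c (tab s q (r + c)).

Definition covers (R : realDomainType) (s : state R) (q x : nat) (v : R) : Prop :=
  en_ch (tab s q x) != 0 /\ (en_w (tab s q x) <= v)%R.

Definition only_table (R : Type) (vs : seq nat) (r k : nat) (s s' : state R) : Prop :=
  [/\ forall a i, a < 13 -> ~~ ((a == 7) && (i \in vs)) -> nmem s' a i = nmem s a i,
      forall a i, a < 2 -> wmem s' a i = wmem s a i
    & forall q x, ~~ (r <= x <= r + k) -> tab s' q x = tab s q x].

Lemma only_table_trans (R : Type) vs r k (s1 s2 s3 : state R) :
  only_table vs r k s1 s2 -> only_table vs r k s2 s3 -> only_table vs r k s1 s3.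
Proof.
move=> [a1 b1 c1] [a2 b2 c2]; split.
- by move=> a i h1 h2; rewrite a2 // a1.
- by move=> a i h1; rewrite b2 // b1.
- by move=> q x h; rewrite c2 // c1.
Qed.

Lemma relax_inv (R : realDomainType) (s : state R) q a ch e1 e2 we r k c J :
  nlow a -> nlow e1 -> nlow e2 -> wlow we ->
  neval s a = r + c -> c <= k ->
  J q c (Entry ch.+1 (neval s e1) (neval s e2) (weval s we)) ->
  sound s r k J ->
  let s' := sem (relax q a ch e1 e2 we) s in
  [/\ only_table [::] r k s s', sound s' r k J, covers s' q (r + c) (weval s we)
    & forall q' x v, covers s q' x v -> covers s' q' x v].
Proof.
move=> la l1 l2 lw ea hc hJ hS s'.
have [h1 h2 h3] := sem_relax s q ch la l1 l2 lw; rewrite -/s' ea in h1 h2 h3.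
split.
- split=> //; first by move=> a' i ha' _; apply: h1.
  move=> q' x hx; rewrite h3 ifF //; apply/negP => /and3P[_ /eqP ex _].
  by move: hx; rewrite ex; lia.
- move=> q' c' hc'; rewrite h3; case: ifP => [/and3P[/eqP-> /eqP ec _]|_]; last exact: hS.
  by rewrite (addnI ec).
- rewrite /covers h3 !eqxx /=; case: ifP => //= /negbT.
  by rewrite negb_or -leNgt => /andP[].
- move=> q' x v [v1 v2]; rewrite /covers h3; case: ifP => //=.
  case/and3P=> /eqP eq /eqP ex; rewrite -eq -ex (negPf v1) /= => hlt.
  by split=> //; apply: le_trans v2; apply: ltW.
Qed.

(** The mask is known when the program is written, so the sum is a fixed expression. Only the names
    of the edges are read at run time, from the code at distance [off] from the position in variable
    0. *)
Fixpoint wsumx (off : nat) (em : bitseq) : wexp :=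
  if em is b :: em' then
    if b then WAdd (WGet 0 (NGet 3 (NAdd (vr 0) (NConst off)))) (wsumx off.+1 em')
    else wsumx off.+1 em'
  else WZero.

Lemma wlow_wsumx off em : wlow (wsumx off em).
Proof. by elim: em off => //= -[] em IH off //=. Qed.

Lemma weval_wsumx (R : realDomainType) (s : state R) m (w : 'I_m -> R) off em es :
  (forall e, wmem s 0 (val e) = w e) -> size em = size es ->
  (forall j, j < size es ->
     nmem s 3 (nmem s 7 0 + (off + j)) = nth 0 (map val es) j) ->
  weval s (wsumx off em) = (\sum_(e <- mask em es) w e)%R.
Proof.
move=> hw; elim: em es off => [|b em IH] [|e es] off //=; first by rewrite big_nil.
move=> [hs] hc; have {}IH := IH es off.+1 hs.
have hIH : weval s (wsumx off.+1 em) = (\sum_(e <- mask em es) w e)%R.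
  by apply: IH => j hj; rewrite addSnnS hc.
case: b => //=; rewrite big_cons hIH; congr (_ + _)%R.
by rewrite -hw; congr wmem; have := hc 0 isT; rewrite addn0.
Qed.

Definition codeat (R : Type) (s : state R) (p : nat) (l : seq nat) : Prop :=
  forall j, j < size l -> nmem s 3 (p + j) = nth 0 l j.

Lemma codeat_cat (R : Type) (s : state R) p l1 l2 :
  codeat s p (l1 ++ l2) <-> codeat s p l1 /\ codeat s (p + size l1) l2.
Proof.
split=> [H|[H1 H2] j].
  split=> j hj.
    by rewrite H ?size_cat ?nth_cat ?hj // (leq_trans hj) ?leq_addr.
  by rewrite -addnA H ?size_cat ?ltn_add2l // nth_cat ltnNge leq_addr addKn.
rewrite size_cat nth_cat => hj; case: ltnP => hj'; first exact: H1.
by have -> : p + j = p + size l1 + (j - size l1) by [lia]; rewrite H2 //; lia.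
Qed.

Lemma codeat_low (R : Type) (s s' : state R) p l :
  (forall i, nmem s' 3 i = nmem s 3 i) -> codeat s p l -> codeat s' p l.
Proof. by move=> h H j hj; rewrite h H. Qed.

Fixpoint marks (arr off : nat) (vm : bitseq) : com :=
  if vm is b :: vm' then
    if b then Seq (NSet arr (NGet 3 (NAdd (vr 0) (NConst off))) (NConst 1))
                  (marks arr off.+1 vm')
    else marks arr off.+1 vm'
  else Skip.

Lemma loopfree_marks arr off vm : loopfree (marks arr off vm).
Proof. by elim: vm off => //= -[] vm IH off //=. Qed.

Lemma sem_marks (R : realDomainType) (s : state R) arr off vm (vs : seq nat) :
  arr != 3 -> arr != 7 -> size vm = size vs ->
  (forall j, j < size vs -> nmem s 3 (nmem s 7 0 + (off + j)) = nth 0 vs j) ->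
  let s' := sem (marks arr off vm) s in
  [/\ wmem s' = wmem s, forall a i, a != arr -> nmem s' a i = nmem s a i
    & forall i, nmem s' arr i = if i \in mask vm vs then 1 else nmem s arr i].
Proof.
move=> n3 n7; elim: vm vs off s => [|b vm IH] [|v vs] off s //= [hs] hc.
case: b => /=; last first.
  by apply: IH => // j hj; rewrite addSnnS hc.
set s1 := State _ _.
have e1 a i : a != arr -> nmem s1 a i = nmem s a i.
  by move=> /negPf h; rewrite /= /upd h.
have [h1 h2 h3] := IH vs off.+1 s1 hs (ltac:(
  move=> j hj; rewrite !e1 1?eq_sym // addSnnS; exact: hc)).
split=> // [a i ha|i]; first by rewrite h2 // e1.
rewrite h3 /= /upd eqxx inE /=; have := hc 0 isT; rewrite addn0 /= => ->.
by case: (i == v); case: (i \in _).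
Qed.

(** * Tabulation in postorder *)

(* Variables: 0 position in the code, 1 address of the table under
   construction, 2 size k + 1 of a table, 3 and 4 counts of the operands,
   5 and 6 addresses of the tables of the operands.  Arrays 9 and 10 map the
   address of the table of a parse tree to the position of its root in the code
   and to the address of its first table. *)
Definition leaf_opt (a ch : nat) (o : nat * nat * bitseq * bitseq) : com :=
  let: (q, d, _, em) := o in
  relax q (NAdd (vr 1) (mink (NConst d))) ch (NConst 0) (NConst 0) (wsumx (2 + a) em).

Definition pair_step (ch : nat) (o : (nat * nat) * (nat * nat) * bitseq) : com :=
  let: ((q1, q2), (q, d), em) := o in
  let x1 := NAdd (vr 5) (vr 3) in let x2 := NAdd (vr 6) (vr 4) in
  Seq (If (BLe (NConst 1) (NGet (aD q1) x1))
        (If (BLe (NConst 1) (NGet (aD q2) x2))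
          (relax q (NAdd (vr 1) (mink (NAdd (NAdd (vr 3) (vr 4)) (NConst d)))) ch
            (vr 3) (vr 4) (WAdd (WAdd (WGet q1.+2 x1) (WGet q2.+2 x2)) (wsumx 2 em)))
          Skip) Skip)
      (setv 4 (NAdd (vr 4) (NConst 1))).

Definition node_tr (ch : nat) (o : (nat * nat) * (nat * nat) * bitseq) : com :=
  Seq (setv 3 (NConst 0)) (While (BLe (vr 3) kx)
    (Seq (setv 4 (NConst 0)) (Seq (While (BLe (vr 4) kx) (pair_step ch o))
      (setv 3 (NAdd (vr 3) (NConst 1)))))).

(** Each 3 initialises a counter; each 6 is a loop test or the increment of the outer counter. The
    increment of the inner counter is part of [pair_step]. *)
Definition node_tr_cost (k ch : nat) (o : (nat * nat) * (nat * nat) * bitseq) : nat :=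
  3 + (k.+1 * (3 + ((k.+1 * (ccost (pair_step ch o) + 6) + 6) + 6) + 6) + 6).

Lemma loopfree_pair_step ch o : loopfree (pair_step ch o).
Proof. by case: o => [[[q1 q2] [q d]] em]. Qed.

Lemma weval_wsumx_eq (R : realDomainType) (s s' : state R) off em :
  (forall i, nmem s' 3 i = nmem s 3 i) -> nmem s' 7 0 = nmem s 7 0 ->
  (forall i, wmem s' 0 i = wmem s 0 i) ->
  weval s' (wsumx off em) = weval s (wsumx off em).
Proof.
move=> h3 h7 hw; elim: em off => //= b em IH off.
by case: b => //=; rewrite IH h3 h7 hw.
Qed.

Definition mono (R : realDomainType) (s s' : state R) : Prop :=
  forall q x (v : R), covers s q x v -> covers s' q x v.

Lemma mono_trans (R : realDomainType) (s1 s2 s3 : state R) :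
  mono s1 s2 -> mono s2 s3 -> mono s1 s3.
Proof. by move=> h1 h2 q x v h; apply: h2; apply: h1. Qed.

Definition node_entry (R : realDomainType) (s : state R) (k lf rt : nat)
    (trs : seq ((nat * nat) * (nat * nat) * bitseq)) (q c : nat) (e : entry R) : Prop :=
  exists q1 q2 d em,
    let e1 := tab s q1 (lf + en_l e) in let e2 := tab s q2 (rt + en_r e) in
    [/\ onth trs (en_ch e).-1 = Some ((q1, q2), (q, d), em),
        en_l e <= k /\ en_r e <= k,
        c = minn k (en_l e + en_r e + d), en_ch e1 != 0 /\ en_ch e2 != 0
      & en_w e = (en_w e1 + en_w e2 + weval s (wsumx 2 em))%R].

Definition node_cover (R : realDomainType) (s0 s : state R) (k r lf rt : nat)
    (o : (nat * nat) * (nat * nat) * bitseq) (i j : nat) : Prop :=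
  let: ((q1, q2), (q, d), em) := o in
  let e1 := tab s0 q1 (lf + i) in let e2 := tab s0 q2 (rt + j) in
  en_ch e1 != 0 -> en_ch e2 != 0 ->
  covers s q (r + minn k (i + j + d)) (en_w e1 + en_w e2 + weval s0 (wsumx 2 em))%R.

Lemma node_cover_mono (R : realDomainType) (s0 s s' : state R) k r lf rt o i j :
  mono s s' -> node_cover s0 s k r lf rt o i j -> node_cover s0 s' k r lf rt o i j.
Proof. by case: o => [[[q1 q2] [q d]] em] h H e1 e2 h1 h2; apply: h; apply: H. Qed.

Lemma only_table_setv (R : realDomainType) vs r k (s : state R) v e :
  v \in vs -> only_table vs r k s (sem (setv v e) s).
Proof.
move=> hv; split=> //= a i ha; rewrite /upd.
by case: eqP => //= ->; case: eqP => // ->; rewrite hv.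
Qed.

Lemma only_table_sub (R : realDomainType) vs vs' r k (s s' : state R) :
  {subset vs <= vs'} -> only_table vs r k s s' -> only_table vs' r k s s'.
Proof.
move=> h [h1 h2 h3]; split=> // a i ha hn; apply: h1 => //.
by apply: contra hn => /andP[-> /h].
Qed.

Lemma mono_setv (R : realDomainType) (s : state R) v e : mono s (sem (setv v e) s).
Proof. by []. Qed.

Lemma sem_if_pos2 (R : realDomainType) (s : state R) e1 e2 c :
  sem (If (BLe (NConst 1) e1) (If (BLe (NConst 1) e2) c Skip) Skip) s =
  if (neval s e1 != 0) && (neval s e2 != 0) then sem c s else s.
Proof. by rewrite /= !lt0n; case: (_ != 0); case: (_ != 0). Qed.

(** Both operand tables end below [r], so the loops read them as they were in [s0] although the
    table at [r] is being filled. [Outer] and [Inner] record which pairs of counts have already been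
    covered. *)
Lemma wp_node_tr (R : realDomainType) (s0 s : state R) k r lf rt trs ch o :
  nmem s0 0 0 = k -> nmem s0 7 1 = r -> nmem s0 7 5 = lf -> nmem s0 7 6 = rt ->
  lf + k < r -> rt + k < r -> onth trs ch = Some o ->
  only_table [:: 3; 4] r k s0 s -> sound s r k (node_entry s0 k lf rt trs) ->
  wp (node_tr ch o) (node_tr_cost k ch o) s (fun s' =>
    [/\ only_table [:: 3; 4] r k s0 s', sound s' r k (node_entry s0 k lf rt trs),
        mono s s'
      & forall i j, i <= k -> j <= k -> node_cover s0 s' k r lf rt o i j]).
Proof.
move=> hk hr hlf hrt ltl ltr ho ot hS.
pose Outer i (s' : state R) := [/\ only_table [:: 3; 4] r k s0 s',
  sound s' r k (node_entry s0 k lf rt trs), mono s s', nmem s' 7 3 = i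
  & forall i' j, i' < i -> j <= k -> node_cover s0 s' k r lf rt o i' j].
have kE s' : only_table [:: 3; 4] r k s0 s' -> nmem s' 0 0 = k.
  by case=> h _ _; rewrite h.
apply: wp_sem_seq => //.
apply: wp_weaken (wp_upto (I := Outer) _ _ _) (leqnn _) _.
- by move=> i s' [h1 _ _ h2 _]; rewrite kE.
- move=> i s1 hi [o1 S1 m1 v1 c1].
  apply: wp_sem_seq => //; apply: wp_seq.
  set s2 := sem _ s1.
  pose Inner j (s' : state R) := [/\ only_table [:: 3; 4] r k s0 s',
    sound s' r k (node_entry s0 k lf rt trs), mono s1 s',
    nmem s' 7 3 = i /\ nmem s' 7 4 = j
    & forall j', j' < j -> node_cover s0 s' k r lf rt o i j'].
  apply: wp_weaken (wp_upto (I := Inner) _ _ _) (leqnn _) _.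
  + by move=> j s' [h1 _ _ [_ h2] _]; rewrite kE.
  + move=> j s3 hj [o3 S3 m3 [v3 v4] c3].
    apply: wp_sem; first exact: loopfree_pair_step.
    set inner : com := match o with (q1, q2, (q, d), em) =>
      If (BLe (NConst 1) (NGet (aD q1) (NAdd (vr 5) (vr 3))))
        (If (BLe (NConst 1) (NGet (aD q2) (NAdd (vr 6) (vr 4))))
          (relax q (NAdd (vr 1) (mink (NAdd (NAdd (vr 3) (vr 4)) (NConst d)))) ch
            (vr 3) (vr 4) (WAdd (WAdd (WGet q1.+2 (NAdd (vr 5) (vr 3)))
              (WGet q2.+2 (NAdd (vr 6) (vr 4)))) (wsumx 2 em)))
          Skip) Skip end.
    have -> : pair_step ch o = Seq inner (setv 4 (NAdd (vr 4) (NConst 1))).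
      by rewrite /inner; case: (o) => [[[? ?] [? ?]] ?].
    suff [o4 S4 m4 c4] : let s4 := sem inner s3 in
      [/\ only_table [::] r k s3 s4, sound s4 r k (node_entry s0 k lf rt trs),
        mono s3 s4 & node_cover s0 s4 k r lf rt o i j].
      have [w3 w4] : nmem (sem inner s3) 7 3 = i /\ nmem (sem inner s3) 7 4 = j.
        by case: o4 => h _ _; rewrite !h.
      split=> //.
      * apply: only_table_trans o3 _.
        apply: only_table_trans (only_table_setv _ _ _ _ _) => //.
        exact: only_table_sub o4.
      * exact: mono_trans m4.
      * by rewrite /= /upd /= w3 w4 addn1.
      * move=> j' hj'; case: (ltngtP j' j) => hjj; last by rewrite hjj.
          by apply: node_cover_mono (c3 _ hjj).
        by exfalso; lia.
    have [n3 w3 t3] := o3.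
    have t1 q : tab s3 q (lf + i) = tab s0 q (lf + i).
      by apply: t3; apply/negP => /andP[]; lia.
    have t2 q : tab s3 q (rt + j) = tab s0 q (rt + j).
      by apply: t3; apply/negP => /andP[]; lia.
    have e1 : neval s3 (NAdd (vr 5) (vr 3)) = lf + i by rewrite /= n3 // hlf v3.
    have e2 : neval s3 (NAdd (vr 6) (vr 4)) = rt + j by rewrite /= n3 // hrt v4.
    move: c3 ho; rewrite {}/inner /node_cover.
    case: o {Inner Outer c1} => [[[q1 q2] [q d]] em] c3 ho.
    set rl := relax _ _ _ _ _ _.
    rewrite sem_if_pos2.
    have -> : neval s3 (NGet (aD q1) (NAdd (vr 5) (vr 3))) =
        en_ch (tab s0 q1 (lf + i)) by rewrite -t1 -e1.
    have -> : neval s3 (NGet (aD q2) (NAdd (vr 6) (vr 4))) =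
        en_ch (tab s0 q2 (rt + j)) by rewrite -t2 -e2.
    case: ifP => [/andP[d1 d2]|nd]; last first.
      by split=> // d1 d2; rewrite d1 d2 in nd.
    have ew : weval s3 (WAdd (WAdd (WGet q1.+2 (NAdd (vr 5) (vr 3)))
              (WGet q2.+2 (NAdd (vr 6) (vr 4)))) (wsumx 2 em)) =
       (en_w (tab s0 q1 (lf + i)) + en_w (tab s0 q2 (rt + j)) + weval s0 (wsumx 2 em))%R.
      rewrite -t1 -t2 -e1 -e2; congr (_ + _ + _)%R.
      by apply: weval_wsumx_eq => [x||x]; rewrite ?n3 ?w3.
    have ea : neval s3 (NAdd (vr 1) (mink (NAdd (NAdd (vr 3) (vr 4)) (NConst d)))) =
        r + minn k (i + j + d).
      transitivity (nmem s3 7 1 +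
        neval s3 (mink (NAdd (NAdd (vr 3) (vr 4)) (NConst d)))) => //.
      rewrite neval_mink n3 // hr.
      by rewrite n3 // hk /= v3 v4.
    set we := WAdd (WAdd (WGet q1.+2 _) _) _ in rl ew *.
    have lw : wlow we by rewrite /= wlow_wsumx.
    have hJ : node_entry s0 k lf rt trs q (minn k (i + j + d))
        (Entry ch.+1 (neval s3 (vr 3)) (neval s3 (vr 4)) (weval s3 we)).
      by exists q1, q2, d, em; rewrite ew /= v3 v4.
    have [||| h1 h2 h3 h4] // := relax_inv _ _ _ lw ea (geq_minl _ _) hJ S3.
    by split=> // _ _; rewrite -ew.
  + split; [|exact: S1|exact: mono_setv|by rewrite /= /upd /=|by []].
    by apply: only_table_trans o1 _; apply: only_table_setv.
  + move=> s3 [o3 S3 m3 [v3 _] c3]; apply: wp_sem => //; split.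
    * by apply: only_table_trans o3 _; apply: only_table_setv.
    * exact: S3.
    * exact: (mono_trans m1 (mono_trans m3 (@mono_setv _ _ _ _))).
    * by rewrite /= /upd /= v3 addn1.
    * move=> i' j hi' hj; case: (ltngtP i' i) => hii.
      - by apply: node_cover_mono (c1 _ _ hii hj).
      - by exfalso; lia.
      - by rewrite hii; apply: c3.
- split; [|exact: hS|exact: mono_setv|by []|by []].
  by apply: only_table_trans ot _; apply: only_table_setv.
- by move=> s' [h1 h2 h3 _ h4]; split=> // i j hi hj; apply: h4.
Qed.

Lemma run_leafP M n m i vs es q c vs' es' :
  run M (@PLeaf n m i vs es) q c vs' es' ->
  exists a b opts vm em, [/\ onth (leaf_rules M) i = Some (a, b, opts),
    (q, c, vm, em) \in opts, vs' = mask vm vs & es' = mask em es].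
Proof. by move=> H; inversion H; subst; do 5!eexists; split; eauto. Qed.

Lemma run_nodeP M n m i es t1 t2 q c vs' es' :
  run M (@PNode n m i es t1 t2) q c vs' es' ->
  exists a trs q1 q2 d em c1 c2 vs1 vs2 es1 es2,
    [/\ onth (node_rules M) i = Some (a, trs), ((q1, q2), (q, d), em) \in trs,
     run M t1 q1 c1 vs1 es1, run M t2 q2 c2 vs2 es2
     & [/\ c = c1 + c2 + d, vs' = vs1 ++ vs2 & es' = (es1 ++ es2) ++ mask em es]].
Proof. by move=> H; inversion H; subst; do 12!eexists; split; eauto. Qed.

Lemma mem_onth (T : eqType) (s : seq T) x : x \in s -> exists i, onth s i = Some x.
Proof.
elim: s => //= y s IH; rewrite inE => /orP[/eqP->|/IH[i hi]]; first by exists 0.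
by exists i.+1.
Qed.

Section Program.
Variable M : automaton.

Definition bump (d : nat) : com :=
  Seq (setv 1 (NAdd (vr 1) (vr 2))) (setv 0 (NAdd (vr 0) (NConst d))).

Definition leaf_prog (_ : nat) (l : nat * nat * seq (nat * nat * bitseq * bitseq)) : com :=
  let: (a, b, opts) := l in
  Seq (NSet 10 (vr 1) (vr 1)) (Seq (seqi (leaf_opt a) opts 0) (bump (2 + a + b))).

Definition leaf_cost (_ : nat) (l : nat * nat * seq (nat * nat * bitseq * bitseq)) : nat :=
  let: (a, b, opts) := l in
  5 + (sum_cost (fun ch o => ccost (leaf_opt a ch o)) opts 0 + ccost (bump (2 + a + b))).

(* In postorder the right operand has just been finished; array 10 then leads to
   the left one. *)
Definition node_pre : com :=
  Seq (setv 6 (NSub (vr 1) (vr 2)))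
    (Seq (setv 5 (NSub (NGet 10 (vr 6)) (vr 2))) (NSet 10 (vr 1) (NGet 10 (vr 5)))).

Definition node_prog (_ : nat) (l : nat * seq ((nat * nat) * (nat * nat) * bitseq)) : com :=
  let: (a, trs) := l in
  Seq node_pre (Seq (seqi node_tr trs 0) (bump (2 + a))).

Definition node_cost (k _ : nat) (l : nat * seq ((nat * nat) * (nat * nat) * bitseq)) : nat :=
  let: (a, trs) := l in
  ccost node_pre + (sum_cost (node_tr_cost k) trs 0 + ccost (bump (2 + a))).

Definition tag_code : nexp := NGet 3 (vr 0).
Definition index_code : nexp := NGet 3 (NAdd (vr 0) (NConst 1)).

Definition fwd_body : com :=
  Seq (NSet 9 (vr 1) (vr 0))
    (If (BLe tag_code (NConst 0))
      (dispatch index_code leaf_prog (leaf_rules M) 0)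
      (dispatch index_code node_prog (node_rules M) 0)).

Definition fwd_guard : bexp := BNot (BLe (NGet 0 (NConst 3)) (vr 0)).
Definition fwd : com := While fwd_guard fwd_body.

(** One 5 pays for recording the position, the other for evaluating the test of the tag; the
    dispatches for leaves and for inner nodes are both charged. *)
Definition fwd_body_cost (k : nat) : nat :=
  5 + (5 +
    (sum_cost (fun ch o => (ncost index_code + 3) + leaf_cost ch o) (leaf_rules M) 0 +
     sum_cost (fun ch o => (ncost index_code + 3) + node_cost k ch o)
       (node_rules M) 0)).+1.

Definition fwd_cost (k : nat) : nat := (6 + fwd_body_cost k).+1.

Definition leaf_entry (R : realDomainType) m (w : 'I_m -> R) (k : nat)
    (opts : seq (nat * nat * bitseq * bitseq)) (es : seq 'I_m)
    (q c : nat) (e : entry R) : Prop :=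
  exists d vm em, [/\ onth opts (en_ch e).-1 = Some (q, d, vm, em),
    c = minn k d & en_w e = (\sum_(x <- mask em es) w x)%R].

(** Like [node_entry], with the machine expression for the new edges replaced by their actual
    weight. This form no longer mentions the position in the code, which moves on. *)
Definition inner_entry (R : realDomainType) m (w : 'I_m -> R) (s : state R)
    (k lf rt : nat) (trs : seq ((nat * nat) * (nat * nat) * bitseq)) (es : seq 'I_m)
    (q c : nat) (e : entry R) : Prop :=
  exists q1 q2 d em,
    let e1 := tab s q1 (lf + en_l e) in let e2 := tab s q2 (rt + en_r e) in
    [/\ onth trs (en_ch e).-1 = Some ((q1, q2), (q, d), em),
        en_l e <= k /\ en_r e <= k,
        c = minn k (en_l e + en_r e + d), en_ch e1 != 0 /\ en_ch e2 != 0
      & en_w e = (en_w e1 + en_w e2 + \sum_(x <- mask em es) w x)%R].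

(** A tree occupies [psize t] consecutive tables of [k.+1] entries in postorder; that of its root is
    the last. *)
Definition troot n m (k a : nat) (t : ptree n m) : nat := a + (psize t).-1 * k.+1.

(* The tables of t start at address a, its code starts at position p, and the
   table of each subtree is correct. *)
Fixpoint good (R : realDomainType) n m (w : 'I_m -> R) (k : nat) (s : state R)
    (t : ptree n m) (a p : nat) : Prop :=
  let r := troot k a t in
  [/\ nmem s 10 r = a,
      forall q c vs es, run M t q c vs es ->
        covers s q (r + minn k c) (\sum_(e <- es) w e)%R
    & match t with
      | PLeaf i vs es => nmem s 9 r = p /\
          exists a b opts, onth (leaf_rules M) i = Some (a, b, opts) /\
            sound s r k (leaf_entry w k opts es)
      | PNode i es t1 t2 =>
          [/\ nmem s 9 r = p + size (code t1) + size (code t2),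
              good w k s t1 a p,
              good w k s t2 (a + psize t1 * k.+1) (p + size (code t1))
            & exists b trs, onth (node_rules M) i = Some (b, trs) /\
              sound s r k (inner_entry w s k (troot k a t1)
                (troot k (a + psize t1 * k.+1) t2) trs es)]
      end].

Lemma psize_gt0 n m (t : ptree n m) : 0 < psize t.
Proof. by case: t. Qed.

Lemma troot_lt n m k a (t : ptree n m) : troot k a t + k < a + psize t * k.+1.
Proof.
have := psize_gt0 t; rewrite /troot; case: (psize t) => // x _.
by rewrite mulSn /=; lia.
Qed.

Lemma troot_next n m k a (t : ptree n m) : troot k a t + k.+1 = a + psize t * k.+1.
Proof.
have := psize_gt0 t; rewrite /troot; case: (psize t) => // x _.
by rewrite mulSn /=; lia.
Qed.

Lemma troot_ge n m k a (t : ptree n m) : a <= troot k a t.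
Proof. exact: leq_addr. Qed.

Lemma troot_node n m k a i es (t1 t2 : ptree n m) :
  troot k a (PNode i es t1 t2) = a + psize t1 * k.+1 + psize t2 * k.+1.
Proof. by rewrite /troot /= mulnDl addnA. Qed.

(** The forward pass writes tables only from the first free address on, and the output pass writes
    none, so finished tables remain correct. *)
Lemma good_frame (R : realDomainType) n m (w : 'I_m -> R) k (s s' : state R)
    (t : ptree n m) a p :
  (forall x, a <= x < a + psize t * k.+1 ->
    [/\ nmem s' 9 x = nmem s 9 x, nmem s' 10 x = nmem s 10 x
      & forall q, tab s' q x = tab s q x]) ->
  good w k s t a p -> good w k s' t a p.
Proof.
elim: t a p => [i vs es|i es t1 IH1 t2 IH2] a p H.
  have tr c : c <= k -> forall q, tab s' q (troot k a (PLeaf i vs es) + c) =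
      tab s q (troot k a (PLeaf i vs es) + c).
    by move=> hc; case: (H (troot k a (PLeaf i vs es) + c)) => //; rewrite /troot /=; lia.
  case=> g1 g2 [g3 [b [b' [opts [ho hs]]]]].
  have [|h9 h10 _] := H (troot k a (PLeaf i vs es)); first by rewrite /troot /=; lia.
  split; first by rewrite h10.
    by move=> q c vs' es' /g2; rewrite /covers tr ?geq_minl.
  split; first by rewrite h9.
  by exists b, b', opts; split=> // q c hc; rewrite tr //; apply: hs.
set r := troot k a (PNode i es t1 t2).
have er : r = a + psize t1 * k.+1 + psize t2 * k.+1 := troot_node _ _ _ _ _ _.
have l1 := troot_lt k a t1; have l2 := troot_lt k (a + psize t1 * k.+1) t2.
have g1 := troot_ge k a t1; have g2 := troot_ge k (a + psize t1 * k.+1) t2.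
have es' : a + psize (PNode i es t1 t2) * k.+1 = r + k.+1.
  by rewrite er /= mulSn mulnDl; lia.
rewrite es' in H.
have tr x : a <= x <= r + k -> forall q, tab s' q x = tab s q x.
  by move=> hx; case: (H x) => //; lia.
case=> c1 c2 [c3 c4 c5 [b [trs [c6 c7]]]].
have [|h9 h10 _] := H r; first by rewrite er; lia.
split; first by rewrite -/r h10.
  move=> q c vs' es'' /c2; rewrite /covers tr //.
  by have := geq_minl k c; rewrite -/r er; lia.
split; first by rewrite -/r h9.
- by apply: IH1 c4 => x hx; apply: H; lia.
- by apply: IH2 c5 => x hx; apply: H; lia.
- exists b, trs; split=> // q c hc; rewrite tr; last by rewrite -/r er; lia.
  move/(c7 q c hc); case=> q1 [q2 [d [em [z1 [z2 z2'] z3 z4 z5]]]].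
  by exists q1, q2, d, em; rewrite !tr //; lia.
Qed.
End Program.

(** Besides the input and everything below the first free address, the output arrays 4, 5 and 6 are
    preserved: they must still be zero when the output is written. *)
Definition fwd_frame (R : Type) (a : nat) (s s' : state R) : Prop :=
  [/\ forall b i, b \in [:: 0; 3; 4; 5; 6; 11; 12] -> nmem s' b i = nmem s b i,
      forall i, wmem s' 0 i = wmem s 0 i, nmem s' 7 2 = nmem s 7 2
    & forall x, x < a -> [/\ nmem s' 9 x = nmem s 9 x, nmem s' 10 x = nmem s 10 x
        & forall q, tab s' q x = tab s q x]].

Lemma fwd_frame_trans (R : Type) a a' (s1 s2 s3 : state R) : a <= a' ->
  fwd_frame a s1 s2 -> fwd_frame a' s2 s3 -> fwd_frame a s1 s3.
Proof.
move=> ha [h1 h2 h3 h4] [g1 g2 g3 g4]; split.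
- by move=> b i hb; rewrite g1 // h1.
- by move=> i; rewrite g2.
- by rewrite g3.
- move=> x hx; have [k1 k2 k3] := h4 x hx; have [l1 l2 l3] := g4 x (leq_trans hx ha).
  by split=> [||q]; rewrite ?l1 ?l2 ?l3.
Qed.

Lemma only_table_fwd (R : Type) vs r k (s s' : state R) : 2 \notin vs ->
  only_table vs r k s s' -> fwd_frame r s s'.
Proof.
move=> hv [h1 h2 h3]; split.
- move=> b i hb; apply: h1; first by move: hb; rewrite !inE; lia.
  by apply/negP => /andP[/eqP e _]; rewrite e in hb.
- by move=> i; apply: h2.
- by rewrite h1 //= (negPf hv).
- move=> x hx; split=> [||q]; rewrite ?h1 // h3 //.
  by apply/negP => /andP[]; lia.
Qed.

Definition fresh (R : Type) (s : state R) (a : nat) : Prop :=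
  forall q x, a <= x -> en_ch (tab s q x) = 0.

Lemma fresh_only_table (R : Type) vs r k (s s' : state R) :
  only_table vs r k s s' -> fresh s r -> fresh s' (r + k.+1).
Proof.
move=> [_ _ h] hf q x hx; rewrite h; first by apply: hf; lia.
by apply/negP => /andP[]; lia.
Qed.

Lemma fresh_sound (R : Type) (s : state R) r k J : fresh s r -> sound s r k J.
Proof. by move=> hf q c _; rewrite hf ?leq_addr. Qed.

Lemma onth_lt (T : Type) (s : seq T) i x : onth s i = Some x -> i < size s.
Proof. by elim: s i => [|y s IH] [|i] //=; apply: IH. Qed.

(** * Processing one leaf or one inner node *)

Section Forward.
Variables (R : realDomainType) (M : automaton) (n m : nat) (w : 'I_m -> R) (k : nat).
Hypothesis Mok : automaton_ok M.

Definition weighted (s : state R) : Prop := forall e : 'I_m, wmem s 0 (val e) = w e.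

Lemma code_leaf_edges (s : state R) p (i : nat) (vs : seq 'I_n) (es : seq 'I_m) j :
  codeat s p (code (PLeaf i vs es)) -> j < size es ->
  nmem s 3 (p + (2 + size vs + j)) = nth 0 (map val es) j.
Proof.
move=> H hj; have -> : 2 + size vs + j = (size vs + j).+2 by lia.
rewrite H /=; last by rewrite size_cat !size_map; lia.
by rewrite nth_cat size_map ltnNge leq_addr /= addKn.
Qed.

Lemma wp_leaf_prog ch na nb opts i (vs : seq 'I_n) (es : seq 'I_m) (s : state R) a p :
  (forall q d vm em, (q, d, vm, em) \in opts -> size em = nb) ->
  size vs = na -> size es = nb ->
  codeat s p (code (PLeaf i vs es)) -> weighted s -> fresh s a ->
  nmem s 7 0 = p -> nmem s 7 1 = a -> nmem s 7 2 = k.+1 -> nmem s 0 0 = k ->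
  wp (leaf_prog ch (na, nb, opts)) (leaf_cost ch (na, nb, opts)) s (fun s' =>
    [/\ fwd_frame a s s', nmem s' 9 a = nmem s 9 a /\ nmem s' 10 a = a,
        nmem s' 7 0 = p + (2 + na + nb) /\ nmem s' 7 1 = a + k.+1,
        fresh s' (a + k.+1)
      & sound s' a k (leaf_entry w k opts es) /\
        forall q d vm em, (q, d, vm, em) \in opts ->
          covers s' q (a + minn k d) (\sum_(e <- mask em es) w e)%R]).
Proof.
move=> hem hvs hes hcode hw hf hp ha h2 hk.
apply: (wp_sem_seq (c1 := NSet 10 (vr 1) (vr 1))) => //; set s1 := sem _ s.
apply: wp_seq.
pose I ch (s' : state R) := [/\ only_table [::] a k s1 s',
  sound s' a k (leaf_entry w k opts es)
  & forall ch' q d vm em, ch' < ch -> onth opts ch' = Some (q, d, vm, em) ->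
      covers s' q (a + minn k d) (\sum_(e <- mask em es) w e)%R].
have s1E b x : b != 10 -> nmem s1 b x = nmem s b x.
  by move=> /negPf hb; rewrite /= /upd hb.
apply: wp_weaken (wp_seqi (I := I) _ _) (leqnn _) _.
- move=> c [[[q d] vm] em] s' ho [o1 S1 C1]; apply: wp_sem => //.
  have [n3 w3 _] := o1.
  have ea : neval s' (NAdd (vr 1) (mink (NConst d))) = a + minn k d.
    transitivity (nmem s' 7 1 + neval s' (mink (NConst d))) => //.
    by rewrite neval_mink !n3 // !s1E // ha hk.
  have ew : weval s' (wsumx (2 + na) em) = (\sum_(e <- mask em es) w e)%R.
    apply: weval_wsumx.
    - by move=> e; rewrite w3 // -hw.
    - by rewrite hes; apply: hem (onth_mem ho).
    - move=> j hj; rewrite !n3 // !s1E // hp -hvs.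
      exact: code_leaf_edges hcode hj.
  have hJ : leaf_entry w k opts es q (minn k d)
      (Entry c.+1 (neval s' (NConst 0)) (neval s' (NConst 0))
        (weval s' (wsumx (2 + na) em))).
    by exists d, vm, em; rewrite ew.
  have [|||| o2 S2 c2 m2] // := relax_inv _ _ _ _ ea (geq_minl _ _) hJ S1.
    exact: wlow_wsumx.
  split=> //; first exact: only_table_trans o1 o2.
  move=> ch' q' d' vm' em'; rewrite ltnS leq_eqVlt => /orP[/eqP->|hlt].
    by rewrite ho => -[<- <- _ <-]; rewrite -ew.
  by move=> ho'; apply/m2/(C1 _ _ _ _ _ hlt ho').
- split=> //; apply: fresh_sound => q x hx.
  exact: hf.
- move=> s2 [o2 S2 C2]; apply: wp_sem => //.
  have [n3 w3 t3] := o2.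
  have f1 : fwd_frame a s s1.
    split=> // [b j hb|x hx]; first by rewrite s1E //; apply: contraTneq hb => ->.
    split=> //; first by rewrite /= /upd /= ha [x == a](ltn_eqF hx).
  have f2 : fwd_frame a s1 s2 by apply: only_table_fwd o2.
  have fr : fwd_frame a s s2 := fwd_frame_trans (leqnn a) f1 f2.
  have [q1 q2 q3 q4] := fr.
  split.
  + split=> //= b j hb.
    by rewrite /upd; rewrite !ifF ?q1 //; apply: contraTF hb => /andP[/eqP-> _].
  + have h9 : nmem s2 9 a = nmem s 9 a by rewrite n3.
    have h10 : nmem s2 10 a = a by rewrite n3 //= /upd /= ha eqxx.
    exact: conj h9 h10.
  + have h70 : nmem s2 7 0 = p by rewrite n3.
    have h71 : nmem s2 7 1 = a by rewrite n3.
    by rewrite /= /upd /= h70 h71 q3 h2.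
  + have hf1 : fresh s1 a by move=> q x hx; exact: hf.
    by move=> q x hx; exact: (fresh_only_table o2 hf1 q hx).
  + split=> // q d vm em /mem_onth[c hc].
    exact: C2 (onth_lt hc) hc.
Qed.

Lemma wp_node_prog ch na trs i (es : seq 'I_m) (s : state R) a r lf rt p :
  (forall o em, (o, em) \in trs -> size em = na) -> size es = na ->
  codeat s p (1 :: i :: map val es) -> weighted s -> fresh s r ->
  nmem s 7 0 = p -> nmem s 7 1 = r -> nmem s 7 2 = k.+1 -> nmem s 0 0 = k ->
  rt + k.+1 = r -> lf + k < rt -> nmem s 10 rt = lf + k.+1 -> nmem s 10 lf = a ->
  wp (node_prog ch (na, trs)) (node_cost k ch (na, trs)) s (fun s' =>
    [/\ fwd_frame r s s', nmem s' 9 r = nmem s 9 r /\ nmem s' 10 r = a,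
        nmem s' 7 0 = p + (2 + na) /\ nmem s' 7 1 = r + k.+1,
        fresh s' (r + k.+1)
      & sound s' r k (inner_entry w s' k lf rt trs es) /\
        forall q1 q2 q d em i j, ((q1, q2), (q, d), em) \in trs -> i <= k -> j <= k ->
          let e1 := tab s q1 (lf + i) in let e2 := tab s q2 (rt + j) in
          en_ch e1 != 0 -> en_ch e2 != 0 ->
          covers s' q (r + minn k (i + j + d))
            (en_w e1 + en_w e2 + \sum_(e <- mask em es) w e)%R]).
Proof.
move=> hem hes hcode hw hf hp hr h2 hk ert hlf srt slf.
apply: wp_sem_seq => //; set s1 := sem node_pre s.
apply: wp_seq.
have e6 : nmem s1 7 6 = rt by rewrite /= /upd /= hr h2; lia.
(* The first table of the right operand directly follows the root table of the left one, so stepping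
   back by [k.+1] from it finds [lf] without knowing the size of either operand. *)
have e5 : nmem s1 7 5 = lf.
  by rewrite /= /upd /= hr h2 (_ : r - k.+1 = rt) ?srt; lia.
have e10 : nmem s1 10 r = a.
  rewrite /= /upd /= hr h2 eqxx (_ : r - k.+1 = rt) ?srt; last by lia.
  by rewrite (_ : lf + k.+1 - k.+1 = lf) ?slf //; lia.
have s1E b x : b \notin [:: 7; 10] -> nmem s1 b x = nmem s b x.
  by rewrite !inE negb_or => /andP[/negPf h7 /negPf h10]; rewrite /= /upd h7 h10.
have s17 x : x < 5 -> nmem s1 7 x = nmem s 7 x.
  by move=> hx; rewrite /= /upd /= !ifF //; lia.
have w1 : weighted s1 by [].
have c1 : codeat s1 p (1 :: i :: map val es) by apply: codeat_low hcode => x; rewrite s1E.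
pose I ch (s' : state R) := [/\ only_table [:: 3; 4] r k s1 s',
  sound s' r k (node_entry s1 k lf rt trs)
  & forall ch' o i j, ch' < ch -> onth trs ch' = Some o -> i <= k -> j <= k ->
      node_cover s1 s' k r lf rt o i j].
have hwe em : size em = na -> weval s1 (wsumx 2 em) = (\sum_(e <- mask em es) w e)%R.
  move=> hsz; apply: weval_wsumx => //; first by rewrite hsz.
  by move=> j hj; rewrite s17 // hp c1 /= ?size_map.
apply: wp_weaken (wp_seqi (I := I) _ _) (leqnn _) _.
- move=> c o s' ho [o1 S1 C1].
  have h00 : nmem s1 0 0 = k by rewrite s1E.
  have h71 : nmem s1 7 1 = r by rewrite s17.
  have llt : lf + k < r by lia.
  have rlt : rt + k < r by lia.
  apply: wp_weaken (wp_node_tr h00 h71 e5 e6 llt rlt ho o1 S1) (leqnn _) _.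
  move=> s2 [o2 S2 m2 C2]; split=> // ch' o' i' j hc ho' hi hj.
  move: hc; rewrite ltnS leq_eqVlt => /orP[/eqP ec|hlt].
    by move: ho'; rewrite ec ho => -[<-]; apply: C2.
  by apply: node_cover_mono m2 _; apply: C1 hlt ho' hi hj.
- split=> //; apply: fresh_sound => q x hx; exact: hf.
- move=> s2 [o2 S2 C2]; apply: wp_sem => //.
  have [n3 w3 t3] := o2.
  have f1 : fwd_frame r s s1.
    split=> // [b j hb|x hx].
    + by rewrite s1E //; move: hb; rewrite !inE; lia.
    + split=> //.
      by rewrite /= /upd /= hr [x == r](ltn_eqF hx).
  have f2 : fwd_frame r s1 s2 by apply: only_table_fwd o2.
  have fr : fwd_frame r s s2 := fwd_frame_trans (leqnn r) f1 f2.
  have [q1 q2 q3 q4] := fr.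
  split.
  + split=> //= b j hb.
    by rewrite /upd; rewrite !ifF ?q1 //; apply: contraTF hb => /andP[/eqP-> _].
  + have h9 : nmem s2 9 r = nmem s 9 r by rewrite n3 // s1E.
    have h10 : nmem s2 10 r = a by rewrite n3.
    exact: conj h9 h10.
  + have h70 : nmem s2 7 0 = p by rewrite n3 // s17.
    have h71 : nmem s2 7 1 = r by rewrite n3 // s17.
    by rewrite /= /upd /= h70 h71 q3 h2.
  + have hf1 : fresh s1 r by move=> q x hx; exact: hf.
    by move=> q x hx; exact: (fresh_only_table o2 hf1 q hx).
  + have tl q' x : x <= k -> tab s2 q' (lf + x) = tab s1 q' (lf + x).
      by move=> hx; apply: t3; apply/negP => /andP[]; lia.
    have tr q' x : x <= k -> tab s2 q' (rt + x) = tab s1 q' (rt + x).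
      by move=> hx; apply: t3; apply/negP => /andP[]; lia.
    split.
      move=> q c hc /(S2 q c hc) [p1 [p2 [d [em [z1 [z2 z2'] z3 z4 z5]]]]].
      exists p1, p2, d, em; split=> //.
        by rewrite -tl // -tr // in z4.
      rewrite [LHS]z5 hwe; last by apply: hem (onth_mem z1).
      by rewrite -tl // -tr.
    move=> p1 p2 q d em i' j hin hi hj /= d1 d2.
    have [c hc] := mem_onth hin.
    rewrite -hwe; last exact: hem hin.
    exact: (C2 c _ _ _ (onth_lt hc) hc hi hj d1 d2).
Qed.
End Forward.

(** * The tabulation of a whole tree *)

Section ForwardTree.
Variables (R : realDomainType) (M : automaton) (n m : nat) (w : 'I_m -> R) (k : nat).
Hypothesis Mok : automaton_ok M.

Lemma weighted_frame a (s s' : state R) : fwd_frame a s s' -> weighted w s -> weighted w s'.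
Proof. by move=> [_ h _ _] hw e; rewrite h. Qed.

Lemma codeat_frame a (s s' : state R) p l :
  fwd_frame a s s' -> codeat s p l -> codeat s' p l.
Proof. by move=> [h _ _ _]; apply: codeat_low => i; rewrite h. Qed.

Lemma fwd_frame_mark (s : state R) r :
  nmem s 7 1 = r -> fwd_frame r s (sem (NSet 9 (vr 1) (vr 0)) s).
Proof.
move=> hr; split=> // [b i hb|x hx].
  by rewrite /= /upd ifF //; apply: contraTF hb => /andP[/eqP-> _].
by split=> //; rewrite /= /upd /= hr [x == r](ltn_eqF hx).
Qed.

(** A single loop scans the code, so no program fragment corresponds to a subtree. The statement
    therefore carries a continuation [T], [Q]: the induction hypothesis for [t1] is used with the
    scan of [t2] and the iteration for the root as continuation. *)
Lemma fwd_tree (t : ptree n m) (s : state R) a p T Q :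
  fits M t -> weighted w s -> fresh s a ->
  nmem s 0 0 = k -> nmem s 7 2 = k.+1 -> nmem s 7 0 = p -> nmem s 7 1 = a ->
  p + size (code t) <= nmem s 0 3 -> codeat s p (code t) ->
  (forall s', fwd_frame a s s' -> nmem s' 7 0 = p + size (code t) ->
     nmem s' 7 1 = a + psize t * k.+1 -> fresh s' (a + psize t * k.+1) ->
     good M w k s' t a p -> wp (fwd M) T s' Q) ->
  wp (fwd M) (psize t * fwd_cost M k + T) s Q.
Proof.
have [hleaf hnode _] := Mok.
have guard (s' : state R) x : nmem s' 7 0 = x -> x < nmem s' 0 3 -> beval s' fwd_guard.
  by move=> h1 h2; rewrite /= h1 -ltnNge.
elim: t s a p T Q => [i vs es|i es t1 IH1 t2 IH2] s a p T Q.
  move=> hfit hw hf hk h2 hp ha hlen hcode hQ.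
  have hg : beval s fwd_guard.
    by apply: guard hp _; apply: leq_trans hlen; rewrite /= -addSnnS leq_addr.
  have hp0 : 0 < p + size (code (PLeaf i vs es)) by rewrite /=; lia.
  move: hfit; rewrite /=; case ho: onth => [[[na nb] opts]|] // /andP[/eqP hvs /eqP hes].
  rewrite mul1n; set T1 := fwd_body_cost M k.
  apply: wp_weaken (wp_while_true (T1 := T1) (T2 := T) hg _) _ (fun _ h => h); last first.
    by rewrite /fwd_cost -/T1 /=; lia.
  apply: wp_sem_seq => //; set s1 := sem _ s.
  have f1 : fwd_frame a s s1 by apply: fwd_frame_mark.
  have hcode1 := codeat_frame f1 hcode.
  have ht : beval s1 (BLe tag_code (NConst 0)).
    rewrite [beval _ _]/(nmem s1 3 (nmem s1 7 0) <= 0) [nmem s1 7 0]hp.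
    by have := hcode1 0 isT; rewrite addn0 => ->.
  have hi : neval s1 index_code = i.
    have v10 : nmem s1 7 0 = p by exact: hp.
    transitivity (nmem s1 3 (nmem s1 7 0 + 1)) => //.
    by rewrite v10; apply: (hcode1 1).
  have hwt : weighted w s1 := weighted_frame f1 hw.
  have hf1 : fresh s1 a by move=> q x hx; exact: hf.
  have hem : forall q d vm em, (q, d, vm, em) \in opts -> size em = nb.
    by move=> q d vm em h; have /and3P[_ _ /eqP] := hleaf _ _ _ _ ho _ h.
  have hwp := wp_leaf_prog i hem hvs hes hcode1 hwt hf1 hp ha h2 hk.
  apply: wp_weaken (wp_if_true _ ht (wp_dispatch ho hi hwp)) _ _.
    by rewrite ltnS leq_add2l leq_addr.
  move=> s2 [f2 [h9 h10] [g0 g1] hf2 [S2 C2]].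
  have er : troot k a (PLeaf i vs es) = a by rewrite /troot /= mul0n addn0.
  apply: hQ.
  - exact: fwd_frame_trans f1 f2.
  - by rewrite g0 /= size_cat !size_map hvs hes.
  - by rewrite g1 mul1n.
  - by rewrite mul1n.
  - rewrite /good er; split=> //.
      move=> q c vs' es' /run_leafP [b1 [b2 [opts' [vm [em [ho' hin _ ->]]]]]].
      by move: ho'; rewrite ho => -[_ _ eo]; rewrite -eo in hin; apply: C2 hin.
    split; first by rewrite h9 /= /upd /= ha eqxx hp.
    by exists na, nb, opts.
move=> hfit hw hf hk h2 hp ha hlen hcode hQ.
move: hfit; rewrite /=; case ho: onth => [[na trs]|] // /and3P[/eqP hes fit1 fit2].
move: hcode hlen; rewrite [code _]/= => /codeat_cat [hc1 /codeat_cat [hc2 hc3]].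
rewrite !size_cat => hlen.
set FC := fwd_cost M k.
have -> : (psize t1 + psize t2).+1 * FC + T =
    psize t1 * FC + (psize t2 * FC + (FC + T)) by rewrite mulSn mulnDl; lia.
set a2 := a + psize t1 * k.+1; set r := a2 + psize t2 * k.+1.
set p2 := p + size (code t1); set p3 := p2 + size (code t2).
have a2r : a2 <= r := leq_addr _ _.
have aa2 : a <= a2 := leq_addr _ _.
apply: (IH1 s a p _ _ fit1 hw hf hk h2 hp ha _ hc1); first by lia.
move=> s1 f1 v10 v11 hf1 gd1; have [n1 w1 k1 t1f] := f1.
apply: (IH2 s1 a2 p2 _ _ fit2 (weighted_frame f1 hw) hf1 _ _ v10 v11).
- by rewrite n1.
- by rewrite k1.
- by rewrite n1 // /p2; lia.
- exact: codeat_frame f1 hc2.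
move=> s2 f2 v20 v21 hf2 gd2.
have f12 : fwd_frame a s s2 := fwd_frame_trans aa2 f1 f2.
have [n2 w2 k2 t2f] := f12; have [m2 _ _ u2] := f2.
have gd1' : good M w k s2 t1 a p.
  by apply: good_frame gd1 => x /andP[_ hx]; apply: u2.
have hg : beval s2 fwd_guard.
  by apply: guard v20 _; rewrite n2 //= /p2; move: hlen => /=; lia.
set T1 := fwd_body_cost M k.
apply: wp_weaken (wp_while_true (T1 := T1) (T2 := T) hg _) _ (fun _ h => h); last first.
  by rewrite /FC /fwd_cost -/T1 /=; lia.
apply: wp_sem_seq => //; set s3 := sem _ s2.
have f3 : fwd_frame r s2 s3 by apply: fwd_frame_mark.
have f13 : fwd_frame a s s3 := fwd_frame_trans (leq_trans aa2 a2r) f12 f3.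
have [n3 w3 k3 t3f] := f13; have [_ _ _ u3] := f3.
have hcode3 := codeat_frame f13 hc3.
have v30 : nmem s3 7 0 = p3 by exact: v20.
have v31 : nmem s3 7 1 = r by exact: v21.
have ht : ~~ beval s3 (BLe tag_code (NConst 0)).
  rewrite [beval _ _]/(nmem s3 3 (nmem s3 7 0) <= 0) v30.
  by have := hcode3 0 isT; rewrite addn0 => ->.
have hi : neval s3 index_code = i.
  transitivity (nmem s3 3 (nmem s3 7 0 + 1)) => //.
  by rewrite v30; apply: (hcode3 1).
have gd1'' : good M w k s3 t1 a p.
  by apply: good_frame gd1' => x /andP[_ hx]; apply: u3; apply: leq_trans a2r.
have gd2'' : good M w k s3 t2 a2 p2.
  by apply: good_frame gd2 => x /andP[_ hx]; apply: u3.
have hwt : weighted w s3 := weighted_frame f13 hw.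
have hf3 : fresh s3 r by move=> q x hx; exact: hf2.
have hem : forall o em, (o, em) \in trs -> size em = na.
  by move=> [[q1 q2] [q d]] em h; have /and4P[_ _ _ /eqP] := hnode _ _ _ ho _ h.
set lf := troot k a t1; set rt := troot k a2 t2.
have ert : rt + k.+1 = r by apply: troot_next.
have elf : lf + k.+1 = a2 by apply: troot_next.
have hlf : lf + k < rt by apply: leq_trans (troot_ge k a2 t2); rewrite -elf addnS.
(* [good] unfolds only on a constructor, which is the sole purpose of this case distinction and of
   the following ones. *)
have slf : nmem s3 10 lf = a by case: (t1) gd1'' @lf elf hlf => [? ? ?|? ? ? ?] [].
have srt : nmem s3 10 rt = lf + k.+1.
  by rewrite elf; case: (t2) gd2'' @rt ert hlf => [? ? ?|? ? ? ?] [].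
have C1 q c vs es1 : run M t1 q c vs es1 -> covers s3 q (lf + minn k c) (\sum_(e <- es1) w e)%R.
  by case: (t1) gd1'' @lf {elf hlf slf srt} => [? ? ?|? ? ? ?] [_ h _] *; apply: h; eauto.
have C2 q c vs es2 : run M t2 q c vs es2 -> covers s3 q (rt + minn k c) (\sum_(e <- es2) w e)%R.
  by case: (t2) gd2'' @rt {ert hlf srt} => [? ? ?|? ? ? ?] [_ h _] *; apply: h; eauto.
have h32 : nmem s3 7 2 = k.+1 by rewrite k3.
have h30 : nmem s3 0 0 = k by rewrite n3.
have hwp := wp_node_prog i hem hes hcode3 hwt hf3 v30 v31 h32 h30 ert hlf srt slf.
apply: wp_weaken (wp_if_false _ ht (wp_dispatch ho hi hwp)) _ _.
  by rewrite ltnS leq_add2l leq_addl.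
move=> s4 [f4 [h9 h10] [g0 g1] hf4 [S4 C4]].
have [_ _ _ u4] := f4.
have er : troot k a (PNode i es t1 t2) = r by rewrite troot_node.
have ep : a + (psize t1 + psize t2).+1 * k.+1 = r + k.+1.
  by rewrite /r /a2 mulSn mulnDl; lia.
apply: hQ.
- exact: fwd_frame_trans (leq_trans aa2 a2r) f13 f4.
- by rewrite g0 /p3 /p2 /= !size_cat /= size_map hes; lia.
- by rewrite g1 /= ep.
- by rewrite /= ep.
- rewrite /good -/good er; split=> //.
    move=> q c vs' es' /run_nodeP [b [trs' [q1 [q2 [d [em [c1 [c2 [vs1 [vs2 [es1 [es2]]]]]]]]]]]].
    case=> ho' hin r1 r2 [-> _ ->]; move: ho'; rewrite ho => -[_ et]; rewrite -et in hin.
    have [d1 l1] := C1 _ _ _ _ r1; have [d2 l2] := C2 _ _ _ _ r2.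
    have [d4 l4] := C4 _ _ _ _ _ _ _ hin (geq_minl k c1) (geq_minl k c2) d1 d2.
    (* Truncating the counts of the operands does not change the truncated sum, so the entries at
       truncated counts cover the run. *)
    have emin : minn k (minn k c1 + minn k c2 + d) = minn k (c1 + c2 + d) by lia.
    rewrite emin in d4 l4; split=> //; apply: le_trans l4 _.
    by rewrite !big_cat /=; apply: lerD => //; apply: lerD.
  split.
  + by rewrite h9 /= /upd /= v21 v20 eqxx.
  + by apply: good_frame gd1'' => x /andP[_ hx]; apply: u4; apply: leq_trans a2r.
  + by apply: good_frame gd2'' => x /andP[_ hx]; apply: u4.
  + by exists na, trs.
Qed.
End ForwardTree.

(** * Reading off an optimal run *)

Lemma onth_iota0 n i : i < n -> onth (iota 0 n) i = Some i.
Proof.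
rewrite -[in Some i](add0n i); elim: n 0 i => //= n IH j [|i] /=; first by rewrite addn0.
by rewrite ltnS => /(IH j.+1); rewrite addSnnS.
Qed.

(* Arrays 11 and 12 hold the state and the count requested from the table at a
   given address.  Variables 8 to 11: address and contents of the requested
   entry. *)
Definition load_entry (q _ : nat) : com :=
  Seq (setv 9 (NSub (NGet (aD q) (vr 8)) (NConst 1)))
    (Seq (setv 10 (NGet (aL q) (vr 8))) (setv 11 (NGet (aR q) (vr 8)))).

Definition out_opt (a _ : nat) (o : nat * nat * bitseq * bitseq) : com :=
  let: (_, _, vm, em) := o in Seq (marks 5 2 vm) (marks 6 (2 + a) em).

Definition out_leaf (_ : nat) (l : nat * nat * seq (nat * nat * bitseq * bitseq)) : com :=
  let: (a, _, opts) := l in dispatch (vr 9) (out_opt a) opts 0.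

Definition request (q1 q2 : nat) : com :=
  Seq (NSet 11 (vr 5) (NConst q1)) (Seq (NSet 12 (vr 5) (vr 10))
    (Seq (NSet 11 (vr 6) (NConst q2)) (NSet 12 (vr 6) (vr 11)))).

Definition out_tr (_ : nat) (o : (nat * nat) * (nat * nat) * bitseq) : com :=
  let: ((q1, q2), _, em) := o in Seq (request q1 q2) (marks 6 2 em).

Definition operands : com :=
  Seq (setv 6 (NSub (vr 1) (vr 2))) (setv 5 (NSub (NGet 10 (vr 6)) (vr 2))).

Definition out_node (_ : nat) (l : nat * seq ((nat * nat) * (nat * nat) * bitseq)) : com :=
  Seq operands (dispatch (vr 9) out_tr l.2 0).

(** Array names are constants of the language, so reading the table of the requested state takes a
    dispatch over all states, which copies the entry into variables. *)
Definition bwd_pre (M : automaton) : com :=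
  Seq (Seq (setv 1 (NSub (vr 1) (vr 2)))
    (Seq (setv 0 (NGet 9 (vr 1))) (setv 8 (NAdd (vr 1) (NGet 12 (vr 1))))))
  (dispatch (NGet 11 (vr 1)) load_entry (iota 0 (nstates M)) 0).

Definition bwd_body (M : automaton) : com :=
  Seq (bwd_pre M)
    (If (BLe tag_code (NConst 0))
      (dispatch index_code out_leaf (leaf_rules M) 0)
      (dispatch index_code out_node (node_rules M) 0)).

(** The table addresses are visited downwards, in reverse postorder. Parents precede their operands,
    so every request is written before it is read. *)
Definition bwd (M : automaton) : com := While (BLe (NConst 1) (vr 1)) (bwd_body M).

Definition bwd_cost (M : automaton) : nat := (4 + ccost (bwd_body M)).+1.

Lemma loopfree_out_leaf ch l : loopfree (out_leaf ch l).
Proof.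
case: l => [[a b] opts]; apply: loopfree_dispatch => c [[[q d] vm] em] /=.
by rewrite !loopfree_marks.
Qed.

Lemma loopfree_out_node ch l : loopfree (out_node ch l).
Proof.
case: l => [a trs] /=; apply: loopfree_dispatch => c [[[q1 q2] x] em] /=.
exact: loopfree_marks.
Qed.

Lemma loopfree_bwd_body M : loopfree (bwd_body M).
Proof.
have h1 := loopfree_dispatch index_code (leaf_rules M) 0 loopfree_out_leaf.
have h2 := loopfree_dispatch index_code (node_rules M) 0 loopfree_out_node.
have h3 : loopfree (dispatch (NGet 11 (vr 1)) load_entry (iota 0 (nstates M)) 0).
  exact: loopfree_dispatch.
by rewrite /bwd_body /bwd_pre /= h1 h2 h3.
Qed.

Lemma sem_bwd_body (R : realDomainType) M (s : state R) :
  sem (bwd_body M) s =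
  if beval (sem (bwd_pre M) s) (BLe tag_code (NConst 0))
  then sem (dispatch index_code out_leaf (leaf_rules M) 0) (sem (bwd_pre M) s)
  else sem (dispatch index_code out_node (node_rules M) 0) (sem (bwd_pre M) s).
Proof. by []. Qed.

Lemma sem_request (R : realDomainType) (s : state R) q1 q2 lf rt :
  nmem s 7 5 = lf -> nmem s 7 6 = rt -> lf != rt ->
  let s' := sem (request q1 q2) s in
  [/\ wmem s' = wmem s, forall b x, b \notin [:: 11; 12] -> nmem s' b x = nmem s b x,
      forall b x, x != lf -> x != rt -> nmem s' b x = nmem s b x,
      nmem s' 11 lf = q1 /\ nmem s' 12 lf = nmem s 7 10
    & nmem s' 11 rt = q2 /\ nmem s' 12 rt = nmem s 7 11].
Proof.
move=> h5 h6 hn; rewrite /= /upd /= h5 h6 !eqxx /= (negPf hn).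
split=> // b x.
  by rewrite !inE negb_or => /andP[/negPf-> /negPf->].
by move=> /negPf-> /negPf->; rewrite !andbF.
Qed.

Section Backward.
Variables (R : realDomainType) (M : automaton) (n m : nat) (w : 'I_m -> R) (k : nat).
Hypothesis Mok : automaton_ok M.

Lemma sem_bwd_pre (s : state R) r q c :
  nmem s 7 1 = r + k.+1 -> nmem s 7 2 = k.+1 -> nmem s 11 r = q -> nmem s 12 r = c ->
  q < nstates M ->
  let s1 := sem (bwd_pre M) s in let e := tab s q (r + c) in
  [/\ forall b x, b != 7 -> nmem s1 b x = nmem s b x, wmem s1 = wmem s,
      [/\ nmem s1 7 0 = nmem s 9 r, nmem s1 7 1 = r & nmem s1 7 2 = k.+1]
    & [/\ nmem s1 7 9 = (en_ch e).-1, nmem s1 7 10 = en_l e & nmem s1 7 11 = en_r e]].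
Proof.
move=> h1 h2 hq hc hlt s1 e.
set s0 := sem (Seq (setv 1 (NSub (vr 1) (vr 2)))
    (Seq (setv 0 (NGet 9 (vr 1))) (setv 8 (NAdd (vr 1) (NGet 12 (vr 1)))))) s.
have er : nmem s 7 1 - nmem s 7 2 = r by rewrite h1 h2 addnK.
have v1 : nmem s0 7 1 = r by rewrite /= /upd /= er.
have v0 : nmem s0 7 0 = nmem s 9 r by rewrite /= /upd /= er.
have v8 : nmem s0 7 8 = r + c by rewrite /= /upd /= er hc.
have v2 : nmem s0 7 2 = k.+1 by [].
have sE b x : b != 7 -> nmem s0 b x = nmem s b x.
  by move=> /negPf hb; rewrite /= /upd !hb.
have es1 : s1 = sem (load_entry q q) s0.
  apply: (sem_dispatch load_entry (onth_iota0 hlt)).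
  by transitivity (nmem s0 11 (nmem s0 7 1)) => //; rewrite v1 sE.
have n1 : aD q != 7 by []. have n2 : aL q != 7 by []. have n3 : aR q != 7 by [].
have sE1 b x : b != 7 -> nmem s1 b x = nmem s0 b x.
  by move=> /negPf hb; rewrite es1 /= /upd !hb.
have sV x : x < 9 -> nmem s1 7 x = nmem s0 7 x.
  move=> hx; rewrite es1 /= /upd /=.
  have -> : (x == 11) = false by lia.
  have -> : (x == 10) = false by lia.
  by have -> : (x == 9) = false by lia.
split.
- by move=> b x hb; rewrite sE1 // sE.
- by rewrite es1.
- by rewrite !sV.
- have a9 : nmem s1 7 9 = nmem s0 (aD q) (nmem s0 7 8) - 1 by rewrite es1.
  have a10 : nmem s1 7 10 = nmem s0 (aL q) (nmem s0 7 8) by rewrite es1.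
  have a11 : nmem s1 7 11 = nmem s0 (aR q) (nmem s0 7 8) by rewrite es1.
  by rewrite a9 a10 a11 v8 !sE // subn1.
Qed.

Lemma code_leaf_verts (s : state R) p i (vs : seq 'I_n) (es : seq 'I_m) j :
  codeat s p (code (PLeaf i vs es)) -> j < size vs ->
  nmem s 3 (p + (2 + j)) = nth 0 (map val vs) j.
Proof.
move=> H hj; rewrite add2n H /=; last by rewrite size_cat !size_map; lia.
by rewrite nth_cat size_map hj.
Qed.

(** Requests stored below [a] are those for subtrees not yet visited and must survive. The output
    sets only grow, by [vs] and [es]. *)
Definition bwd_frame (a : nat) (s s' : state R) (vs : seq 'I_n) (es : seq 'I_m) : Prop :=
  [/\ forall b x, b \notin [:: 5; 6; 7; 11; 12] -> nmem s' b x = nmem s b x,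
      wmem s' = wmem s, nmem s' 7 2 = nmem s 7 2,
      forall x, x < a -> nmem s' 11 x = nmem s 11 x /\ nmem s' 12 x = nmem s 12 x
    & forall x, (nmem s' 5 x != 0) = (nmem s 5 x != 0) || (x \in map val vs) /\
                (nmem s' 6 x != 0) = (nmem s 6 x != 0) || (x \in map val es)].

Lemma bwd_frame_tab a s s' vs es : bwd_frame a s s' vs es ->
  forall q x, tab s' q x = tab s q x.
Proof. by move=> [h1 h2 _ _ _] q x; rewrite /tab h2 !h1. Qed.

Lemma bwd_frame_good a s s' vs es (t : ptree n m) a' p :
  bwd_frame a s s' vs es -> good M w k s t a' p -> good M w k s' t a' p.
Proof.
move=> hf; have htab := bwd_frame_tab hf; case: hf => h1 _ _ _ _.
by apply: good_frame => x _; rewrite !h1.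
Qed.

Lemma bwd_frame_trans a a' s1 s2 s3 vs1 es1 vs2 es2 vs es : a <= a' ->
  bwd_frame a s1 s2 vs1 es1 -> bwd_frame a' s2 s3 vs2 es2 ->
  vs =i vs1 ++ vs2 -> es =i es1 ++ es2 -> bwd_frame a s1 s3 vs es.
Proof.
move=> ha [h1 h2 h3 h4 h5] [g1 g2 g3 g4 g5] ev ee; split.
- by move=> b x hb; rewrite g1 // h1.
- by rewrite g2.
- by rewrite g3.
- by move=> x hx; have [-> ->] := g4 x (leq_trans hx ha); apply: h4.
- move=> x; have [-> ->] := g5 x; have [-> ->] := h5 x.
  rewrite -!orbA -!mem_cat -!map_cat.
  by split; congr (_ || _); apply: (eq_mem_map val); move=> z; rewrite ?ev ?ee.
Qed.

(** The run is rebuilt from the recorded choices. Its weight is exactly that of the entry, while its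
    count [c'] is known only to truncate to the requested [c]. A continuation is carried as in
    [fwd_tree], here with the right operand visited before the left one. *)
Lemma bwd_tree (t : ptree n m) (s : state R) a p q c T Q :
  fits M t -> good M w k s t a p -> codeat s p (code t) ->
  nmem s 7 2 = k.+1 -> nmem s 7 1 = a + psize t * k.+1 ->
  nmem s 11 (troot k a t) = q -> nmem s 12 (troot k a t) = c ->
  c <= k -> q < nstates M -> en_ch (tab s q (troot k a t + c)) != 0 ->
  (forall s' c' vs es, run M t q c' vs es -> minn k c' = c ->
     en_w (tab s q (troot k a t + c)) = (\sum_(e <- es) w e)%R ->
     bwd_frame a s s' vs es -> nmem s' 7 1 = a -> wp (bwd M) T s' Q) ->
  wp (bwd M) (psize t * bwd_cost M + T) s Q.
Proof.
have [hleaf hnode _] := Mok.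
elim: t s a p q c T Q => [i vs es|i es t1 IH1 t2 IH2] s a p q c T Q.
  move=> hfit hgood hcode h2 h1 hq hc hck hqn hd hQ.
  have er : troot k a (PLeaf i vs es) = a by rewrite /troot /= mul0n addn0.
  rewrite er in hq hc hd hQ; rewrite /= mul1n in h1.
  have hg : beval s (BLe (NConst 1) (vr 1)) by rewrite /= h1 addnS.
  rewrite /= mul1n.
  apply: wp_weaken (wp_while_true (T2 := T) hg
    (wp_sem (Q := fun s' => wp (bwd M) T s' Q) (loopfree_bwd_body M) _)) (leqnn _) (fun _ h => h).
  change (wp (bwd M) T (sem (bwd_body M) s) Q).
  have [pE pW [p0 p1 p2] [p9 _ _]] := sem_bwd_pre h1 h2 hq hc hqn.
  set s1 := sem (bwd_pre M) s in pE pW p0 p1 p2 p9.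
  case: hgood; rewrite er => g1 _ [g3 [na [nb [opts [ho hs]]]]].
  have [d [vm [em [e1 e2 e3]]]] := hs q c hck hd.
  move: hfit; rewrite [fits _ _]/= ho => /andP[/eqP hvs /eqP hes].
  have /and3P[_ /eqP hvm /eqP hem] := hleaf _ _ _ _ ho _ (onth_mem e1).
  have p0' : nmem s1 7 0 = p by rewrite p0 g3.
  have hcode1 : codeat s1 p (code (PLeaf i vs es)).
    by apply: codeat_low hcode => x; rewrite pE.
  have ht : beval s1 (BLe tag_code (NConst 0)).
    rewrite [beval _ _]/(nmem s1 3 (nmem s1 7 0) <= 0) p0'.
    by have := hcode1 0 isT; rewrite addn0 => ->.
  have hi : neval s1 index_code = i.
    transitivity (nmem s1 3 (nmem s1 7 0 + 1)) => //.
    by rewrite p0'; apply: (hcode1 1).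
  have -> : sem (bwd_body M) s = sem (out_opt na (en_ch (tab s q (a + c))).-1 (q, d, vm, em)) s1.
    transitivity (sem (dispatch index_code out_leaf (leaf_rules M) 0) s1).
      by rewrite sem_bwd_body -/s1 ht.
    rewrite (sem_dispatch _ ho hi).
    exact: (sem_dispatch _ e1).
  have [m1 m2 m3] := @sem_marks R s1 5 2 vm (map val vs) isT isT
    (etrans hvm (esym (etrans (size_map _ _) hvs))) (ltac:(
      rewrite size_map => j hj; rewrite p0'; exact: code_leaf_verts hcode1 hj)).
  set s2 := sem (marks 5 2 vm) s1 in m1 m2 m3.
  have [k1 k2 k3] := @sem_marks R s2 6 (2 + na) em (map val es) isT isT
    (etrans hem (esym (etrans (size_map _ _) hes))) (ltac:(
      rewrite size_map => j hj; rewrite !m2 // p0' -hvs;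
      exact: code_leaf_edges hcode1 hj)).
  apply: (hQ _ d (mask vm vs) (mask em es)).
  - exact: RunLeaf ho (onth_mem e1).
  - by rewrite -e2.
  - by rewrite e3.
  - split.
    + move=> b x; rewrite !inE !negb_or => /and5P[b5 b6 b7 _ _].
      by rewrite k2 // m2 // pE.
    + by rewrite k1 m1 pW.
    + by rewrite k2 // m2 // p2 h2.
    + by move=> x _; rewrite !k2 // !m2 // !pE.
    + move=> x; rewrite k2 // m3 k3 m2 // !pE // !map_mask.
      by split; case: ifP; rewrite ?orbT ?orbF.
  - by rewrite k2 // m2.
move=> hfit hgood hcode h2 h1 hq hc hck hqn hd hQ.
set r := troot k a (PNode i es t1 t2) in hq hc hd hQ.
have h1' : nmem s 7 1 = r + k.+1 by rewrite h1 troot_next.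
have hg : beval s (BLe (NConst 1) (vr 1)) by rewrite /= h1' addnS.
set BC := bwd_cost M.
have -> : psize (PNode i es t1 t2) * BC + T =
    (4 + ccost (bwd_body M) + (psize t2 * BC + (psize t1 * BC + T))).+1.
  have eBC : BC = (4 + ccost (bwd_body M)).+1 by [].
  rewrite [psize _]/= mulSn mulnDl {1}eBC; move: (ccost _) => x; lia.
apply: wp_weaken (wp_while_true hg
  (wp_sem (Q := fun s' => wp (bwd M) _ s' Q) (loopfree_bwd_body M) _)) (leqnn _) (fun _ h => h).
change (wp (bwd M) (psize t2 * BC + (psize t1 * BC + T)) (sem (bwd_body M) s) Q).
have [pE pW [p0 p1 p2] [p9 p10 p11]] := sem_bwd_pre h1' h2 hq hc hqn.
set s1 := sem (bwd_pre M) s in pE pW p0 p1 p2 p9 p10 p11.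
case: hgood; rewrite -/r -/(good M w k s) => g1 _ [g3 gd1 gd2 [na [trs [ho hs]]]].
have [q1 [q2 [d [em [e1 [e2 e2'] e3 [e4 e4'] e5]]]]] := hs q c hck hd.
move: hfit; rewrite [fits _ _]/= ho => /and3P[/eqP hes fit1 fit2].
have /and4P[q1n q2n _ /eqP hem] := hnode _ _ _ ho _ (onth_mem e1).
move: hcode; rewrite [code _]/= => /codeat_cat [hc1 /codeat_cat [hc2 hc3]].
set a2 := a + psize t1 * k.+1 in gd2 hs e4' e5 *.
set p2' := p + size (code t1) in hc2 hc3 gd2; set p3 := p2' + size (code t2) in hc3.
set lf := troot k a t1 in hs e4 e5; set rt := troot k a2 t2 in hs e4' e5.
have ert : rt + k.+1 = r by rewrite /r troot_node; apply: troot_next.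
have elf : lf + k.+1 = a2 by apply: troot_next.
have hlf : lf < a2 by lia.
have hrt : a2 <= rt := troot_ge k a2 t2.
have aa2 : a <= a2 := leq_addr _ _.
have alf : a <= lf := troot_ge k a t1.
have p0' : nmem s1 7 0 = p3 by rewrite p0 g3.
have hcode3 : codeat s1 p3 (1 :: i :: map val es).
  by apply: codeat_low hc3 => x; rewrite pE.
have ht : ~~ beval s1 (BLe tag_code (NConst 0)).
  rewrite [beval _ _]/(nmem s1 3 (nmem s1 7 0) <= 0) p0'.
  by have := hcode3 0 isT; rewrite addn0 => ->.
have hi : neval s1 index_code = i.
  transitivity (nmem s1 3 (nmem s1 7 0 + 1)) => //.
  by rewrite p0'; apply: (hcode3 1).
set s2 := sem operands s1.
have srt : nmem s 10 rt = a2 by case: (t2) gd2 @rt {hs e4' e5 ert hrt} => [? ? ?|? ? ? ?] [].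
have v6 : nmem s2 7 6 = rt by rewrite /= /upd /= p1 p2 -ert addnK.
have v5 : nmem s2 7 5 = lf.
  by rewrite /= /upd /= p1 p2 -ert addnK pE // srt -elf addnK.
have s2V x : x \notin [:: 5; 6] -> nmem s2 7 x = nmem s1 7 x.
  by rewrite !inE negb_or => /andP[/negPf x5 /negPf x6]; rewrite /= /upd /= x5 x6.
have s2E b x : b != 7 -> nmem s2 b x = nmem s1 b x.
  by move=> /negPf hb; rewrite /= /upd !hb.
have nlr : lf != rt by apply/eqP; lia.
have [y1 y2 y3 [y4 y5] [y6 y7]] := sem_request q1 q2 v5 v6 nlr.
set s3 := sem (request q1 q2) s2 in y1 y2 y3 y4 y5 y6 y7.
have v30 : nmem s3 7 0 = p3 by rewrite y2 // s2V // p0'.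
have s3c x : nmem s3 3 x = nmem s 3 x by rewrite y2 // s2E // pE.
have [k1 k2 k3] := @sem_marks R s3 6 2 em (map val es) isT isT
  (etrans hem (esym (etrans (size_map _ _) hes))) (ltac:(
    rewrite size_map => j hj; rewrite v30 add2n y2 // s2E // hcode3 /= ?size_map //)).
set s4 := sem (marks 6 2 em) s3 in k1 k2 k3.
have -> : sem (bwd_body M) s = s4.
  transitivity (sem (dispatch index_code out_node (node_rules M) 0) s1).
    by rewrite sem_bwd_body -/s1 (negPf ht).
  rewrite (sem_dispatch _ ho hi).
  transitivity (sem (dispatch (vr 9) out_tr trs 0) s2) => //.
  have v9 : neval s2 (vr 9) = (en_ch (tab s q (r + c))).-1.
    by transitivity (nmem s2 7 9) => //; rewrite s2V.
  exact: (sem_dispatch _ e1 v9).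
have s4E b x : b \notin [:: 5; 6; 7; 11; 12] -> nmem s4 b x = nmem s b x.
  rewrite !inE !negb_or => /and5P[b5 b6 b7 b11 b12].
  by rewrite k2 // y2 ?inE ?negb_or ?b11 // s2E // pE.
have w4 : wmem s4 = wmem s by rewrite k1 y1 -pW.
have t4 q' x : tab s4 q' x = tab s q' x by rewrite /tab w4 !s4E.
have v42 : nmem s4 7 2 = k.+1 by rewrite k2 // y2 // s2V.
have v41 : nmem s4 7 1 = a2 + psize t2 * k.+1.
  by rewrite k2 // y2 // s2V // p1 /r troot_node.
have gd24 : good M w k s4 t2 a2 p2'.
  by apply: good_frame gd2 => x _; rewrite !s4E //; split=> // q'; rewrite t4.
have gd14 : good M w k s4 t1 a p.
  by apply: good_frame gd1 => x _; rewrite !s4E //; split=> // q'; rewrite t4.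
have hc24 : codeat s4 p2' (code t2) by apply: codeat_low hc2 => x; rewrite s4E.
have hc14 : codeat s4 p (code t1) by apply: codeat_low hc1 => x; rewrite s4E.
have r11 : nmem s4 11 rt = q2 by rewrite k2.
have r12 : nmem s4 12 rt = en_r (tab s q (r + c)) by rewrite k2 // y7 s2V.
have l11 : nmem s4 11 lf = q1 by rewrite k2.
have l12 : nmem s4 12 lf = en_l (tab s q (r + c)) by rewrite k2 // y5 s2V.
have d24 : en_ch (tab s4 q2 (rt + en_r (tab s q (r + c)))) != 0 by rewrite t4.
apply: (IH2 s4 a2 p2' q2 _ _ _ fit2 gd24 hc24 v42 v41 r11 r12 e2' q2n d24).
move=> s5 c2 vs2 es2 run2 m2 ew2 f5 v51.
have gd15 := bwd_frame_good f5 gd14.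
have [n5 w5 v52 rq5 o5] := f5.
have hc15 : codeat s5 p (code t1) by apply: codeat_low hc14 => x; rewrite n5.
have l511 : nmem s5 11 lf = q1 by rewrite (rq5 _ hlf).1.
have l512 : nmem s5 12 lf = en_l (tab s q (r + c)) by rewrite (rq5 _ hlf).2.
have d15 : en_ch (tab s5 q1 (lf + en_l (tab s q (r + c)))) != 0.
  by rewrite (bwd_frame_tab f5) t4.
have v52' : nmem s5 7 2 = k.+1 by rewrite v52.
apply: (IH1 s5 a p q1 _ _ _ fit1 gd15 hc15 v52' v51 l511 l512 e2 q1n d15).
move=> s6 c1 vs1 es1 run1 m1 ew1 f6 v61.
apply: (hQ s6 (c1 + c2 + d) (vs1 ++ vs2) ((es1 ++ es2) ++ mask em es)) => //.
- exact: (RunNode es ho (onth_mem e1) run1 run2).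
- by rewrite e3 -m1 -m2; lia.
- rewrite e5 !big_cat /= -ew1 -ew2.
  by rewrite (bwd_frame_tab f5) !t4.
have f4 : bwd_frame a s s4 [::] (mask em es).
  split=> //.
  - by rewrite v42 h2.
  - move=> x hx; rewrite !k2 // !y3 ?s2E ?pE //; apply/eqP; lia.
  - move=> x; rewrite k2 // y2 // s2E // pE // k3 y2 // s2E // pE // map_mask.
    by split; [rewrite orbF | case: ifP; rewrite ?orbT ?orbF].
have f46 : bwd_frame a s4 s6 (vs1 ++ vs2) (es1 ++ es2).
  have f5' : bwd_frame a s4 s5 vs2 es2.
    by split=> // x hx; apply: rq5; apply: leq_trans aa2.
  by apply: bwd_frame_trans (leqnn a) f5' f6 _ _ => x; rewrite !mem_cat orbC.
apply: bwd_frame_trans (leqnn a) f4 f46 _ _ => x; first by [].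
by rewrite !mem_cat orbC.
Qed.
End Backward.

(** * The whole program *)

Section Search.
Variable M : automaton.

(* The best accepted entry of the root is collected in a table for an additional
   state, number nstates M, at the first free address. *)
Definition acc_try (ch : nat) (o : nat * nat) : com :=
  let x := NAdd (vr 6) (vr 3) in
  Seq (If (BLe (NConst 1) (NGet (aD o.1) x))
        (If (BLe kx (NAdd (vr 3) (NConst o.2)))
          (relax (nstates M) (vr 1) ch (vr 3) (NConst 0) (WGet o.1.+2 x)) Skip) Skip)
      (setv 3 (NAdd (vr 3) (NConst 1))).

Definition acc_step (ch : nat) (o : nat * nat) : com :=
  Seq (setv 3 (NConst 0)) (While (BLe (vr 3) kx) (acc_try ch o)).

Definition acc_cost (k ch : nat) (o : nat * nat) : nat :=
  3 + (k.+1 * (ccost (acc_try ch o) + 6) + 6).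

Definition acc_entry (R : realDomainType) (s : state R) (k rt : nat) (_ _ : nat)
    (e : entry R) : Prop :=
  exists q d, let e1 := tab s q (rt + en_l e) in
    [/\ onth (accepts M) (en_ch e).-1 = Some (q, d), en_l e <= k, k <= en_l e + d,
        en_ch e1 != 0 & en_w e = en_w e1].

Definition acc_cover (R : realDomainType) (s0 s : state R) (k r rt : nat)
    (o : nat * nat) (i : nat) : Prop :=
  let e := tab s0 o.1 (rt + i) in
  en_ch e != 0 -> k <= i + o.2 -> covers s (nstates M) r (en_w e).

Lemma wp_acc_step (R : realDomainType) (s0 s : state R) k r rt ch o :
  nmem s0 0 0 = k -> nmem s0 7 1 = r -> nmem s0 7 6 = rt -> rt + k < r ->
  onth (accepts M) ch = Some o ->
  only_table [:: 3] r k s0 s -> sound s r k (acc_entry s0 k rt) ->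
  wp (acc_step ch o) (acc_cost k ch o) s (fun s' =>
    [/\ only_table [:: 3] r k s0 s', sound s' r k (acc_entry s0 k rt), mono s s'
      & forall i, i <= k -> acc_cover s0 s' k r rt o i]).
Proof.
move=> hk hr hrt ltr ho ot hS.
pose I i (s' : state R) := [/\ only_table [:: 3] r k s0 s',
  sound s' r k (acc_entry s0 k rt), mono s s', nmem s' 7 3 = i
  & forall i', i' < i -> acc_cover s0 s' k r rt o i'].
apply: wp_sem_seq => //.
apply: wp_weaken (wp_upto (I := I) _ _ _) (leqnn _) _.
- by move=> i s' [[h _ _] _ _ h2 _]; rewrite h2 (h 0 0).
- move=> i s1 hi [o1 S1 m1 v1 c1]; apply: wp_sem => //.
  set inner := If (BLe (NConst 1) (NGet (aD o.1) (NAdd (vr 6) (vr 3))))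
        (If (BLe kx (NAdd (vr 3) (NConst o.2)))
          (relax (nstates M) (vr 1) ch (vr 3) (NConst 0)
             (WGet o.1.+2 (NAdd (vr 6) (vr 3)))) Skip) Skip.
  suff [o2 S2 m2 c2] : let s2 := sem inner s1 in
      [/\ only_table [::] r k s1 s2, sound s2 r k (acc_entry s0 k rt),
        mono s1 s2 & acc_cover s0 s2 k r rt o i].
    have w3 : nmem (sem inner s1) 7 3 = i by case: o2 => h _ _; rewrite h.
    split.
    + apply: only_table_trans o1 _.
      apply: only_table_trans (only_table_setv _ _ _ _ _) => //.
      exact: only_table_sub o2.
    + exact: S2.
    + exact: (mono_trans m1 (mono_trans m2 (@mono_setv _ _ _ _))).
    + by rewrite /= /upd /= -/(sem inner s1) w3 addn1.
    + move=> i'; rewrite ltnS leq_eqVlt => /orP[/eqP->|hii]; first exact: c2.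
      by move=> d1 d2; exact: (m2 _ _ _ (c1 i' hii d1 d2)).
  have [n1 w1 t1] := o1.
  have e1 : neval s1 (NAdd (vr 6) (vr 3)) = rt + i by rewrite /= n1 // hrt v1.
  have tE q : tab s1 q (rt + i) = tab s0 q (rt + i).
    by apply: t1; apply/negP => /andP[]; lia.
  have -> : sem inner s1 =
      if (en_ch (tab s0 o.1 (rt + i)) != 0) && (k <= i + o.2)
      then sem (relax (nstates M) (vr 1) ch (vr 3) (NConst 0)
             (WGet o.1.+2 (NAdd (vr 6) (vr 3)))) s1 else s1.
    have -> : (en_ch (tab s0 o.1 (rt + i)) != 0) =
        beval s1 (BLe (NConst 1) (NGet (aD o.1) (NAdd (vr 6) (vr 3)))).
      by rewrite -tE -e1 -lt0n.
    have -> : (k <= i + o.2) = beval s1 (BLe kx (NAdd (vr 3) (NConst o.2))).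
      by rewrite /= n1 // hk v1.
    transitivity (if beval s1 (BLe (NConst 1) (NGet (aD o.1) (NAdd (vr 6) (vr 3)))) then
      if beval s1 (BLe kx (NAdd (vr 3) (NConst o.2))) then
      sem (relax (nstates M) (vr 1) ch (vr 3) (NConst 0)
             (WGet o.1.+2 (NAdd (vr 6) (vr 3)))) s1 else s1 else s1) => //.
    by do 2!case: (beval _ _).
  case: ifP => [/andP[d1 d2]|nd]; last first.
    by split=> // e d1 d2; rewrite d1 d2 in nd.
  have ew : weval s1 (WGet o.1.+2 (NAdd (vr 6) (vr 3))) = en_w (tab s0 o.1 (rt + i)).
    by rewrite -tE -e1.
  have ea : neval s1 (vr 1) = r + 0 by rewrite addn0 /= n1.
  have hJ : acc_entry s0 k rt (nstates M) 0
      (Entry ch.+1 (neval s1 (vr 3)) (neval s1 (NConst 0))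
        (weval s1 (WGet o.1.+2 (NAdd (vr 6) (vr 3))))).
    by exists o.1, o.2; rewrite ew /= v1 -surjective_pairing.
  have [|||| h1 h2 h3 h4] // := relax_inv _ _ _ _ ea (leq0n k) hJ S1.
  split=> // e _ _; rewrite ew addn0 in h3; exact: h3.
- split; [|exact: hS|exact: mono_setv|by []|by []].
  by apply: only_table_trans ot _; apply: only_table_setv.
- by move=> s' [h1 h2 h3 _ h4]; split=> // i hi; apply: h4.
Qed.

Definition start_bwd : com :=
  Seq (NSet 4 (NConst 0) (NConst 1))
    (Seq (NSet 12 (vr 6) (NGet (aL (nstates M)) (vr 1)))
      (dispatch (NSub (NGet (aD (nstates M)) (vr 1)) (NConst 1))
        (fun _ o => NSet 11 (vr 6) (NConst o.1)) (accepts M) 0)).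

Definition program : com :=
  Seq (setv 2 (NAdd kx (NConst 1)))
    (Seq (fwd M)
      (Seq (setv 6 (NSub (vr 1) (vr 2)))
        (Seq (seqi acc_step (accepts M) 0)
          (If (BLe (NConst 1) (NGet (aD (nstates M)) (vr 1)))
             (Seq start_bwd (bwd M)) Skip)))).

(** [z] stands for the size of the parse tree. The 7 and the 5 added to the costs of the two passes
    pay for the failing tests that end them. *)
Definition program_cost (k z : nat) : nat :=
  6 + ((z * fwd_cost M k + 7) + (7 + (sum_cost (acc_cost k) (accepts M) 0 +
    (5 + (ccost start_bwd + (z * bwd_cost M + 5))).+1))).

Lemma leq_sq k : k.+1 <= k.+1 ^ 2.
Proof. by rewrite -{1}(expn1 k.+1) leq_pexp2l. Qed.

(** The bound uses [k.+1 ^ 2] because tables have [k.+1] entries; with [k ^ 2] it would fail at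
    [k = 0]. *)
Lemma node_tr_cost_bound ch o : exists C, forall k, node_tr_cost k ch o <= C * k.+1 ^ 2.
Proof.
exists (ccost (pair_step ch o) + 6 + 30) => k; rewrite /node_tr_cost.
set y := ccost _ + 6; have := leq_sq k; have -> : k.+1 ^ 2 = k.+1 * k.+1 by [].
have : 0 < k.+1 by []; move: (k.+1) => K K0 h.
have -> : K * (3 + (K * y + 6 + 6) + 6) = y * (K * K) + K * 21.
  by rewrite [y * _]mulnC -mulnA -mulnDr; congr (K * _); lia.
by rewrite mulnDl; move: h; move: (K * K) => v h; move: (y * v) => u; lia.
Qed.

Lemma const_bound x : exists C, forall k, x <= C * k.+1 ^ 2.
Proof. by exists x => k; rewrite leq_pmulr // expn_gt0. Qed.

Lemma add_bound (f g : nat -> nat) :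
  (exists C, forall k, f k <= C * k.+1 ^ 2) ->
  (exists C, forall k, g k <= C * k.+1 ^ 2) ->
  exists C, forall k, f k + g k <= C * k.+1 ^ 2.
Proof.
move=> [C1 h1] [C2 h2]; exists (C1 + C2) => k.
by rewrite mulnDl leq_add ?h1 ?h2.
Qed.

Lemma fwd_cost_bound : exists C, forall k, fwd_cost M k <= C * k.+1 ^ 2.
Proof.
have f0 k : 0 < k.+1 ^ 2 by rewrite expn_gt0.
have [C1 h1] : exists C, forall k,
    sum_cost (fun ch o => (ncost index_code + 3) + node_cost k ch o)
      (node_rules M) 0 <= C * k.+1 ^ 2.
  apply: (sum_cost_bound (T := fun k ch o => (ncost index_code + 3) + node_cost k ch o)) => //.
  move=> ch [a trs]; apply: add_bound; first exact: const_bound.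
  apply: add_bound; first exact: const_bound.
  apply: add_bound; last exact: const_bound.
  apply: sum_cost_bound => // c o; exact: node_tr_cost_bound.
set S1 := sum_cost (fun ch o => (ncost index_code + 3) + leaf_cost ch o) (leaf_rules M) 0.
exists (S1 + 18 + C1) => k; have := h1 k; rewrite /fwd_cost /fwd_body_cost -/S1 mulnDl.
have : S1 + 18 <= (S1 + 18) * k.+1 ^ 2 by rewrite leq_pmulr.
set u := (S1 + 18) * _; set v := C1 * _; set y := sum_cost _ _ _; lia.
Qed.

Lemma program_cost_bound : exists C, forall k z, 0 < z ->
  program_cost k z <= C * (z * k.+1 ^ 2).
Proof.
have f0 k : 0 < k.+1 ^ 2 by rewrite expn_gt0.
have [C1 h1] := fwd_cost_bound.
have [C2 h2] : exists C, forall k, sum_cost (acc_cost k) (accepts M) 0 <= C * k.+1 ^ 2.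
  apply: sum_cost_bound => // ch o; rewrite /acc_cost.
  exists (ccost (acc_try ch o) + 6 + 9) => k; have := leq_sq k; have := f0 k.
  set y := ccost _ + 6; rewrite mulnDl; move: (k.+1 ^ 2) => K K0 hK.
  have : k.+1 * y <= y * K by rewrite mulnC leq_mul2l hK orbT.
  by move: (k.+1 * y) (y * K) => u v; lia.
set D := ccost start_bwd + bwd_cost M + 40.
exists (C1 + C2 + D) => k z z0; rewrite /program_cost.
set K := k.+1 ^ 2.
have K0 : 0 < z * K by rewrite muln_gt0 z0 f0.
have e1 : z * fwd_cost M k <= C1 * (z * K).
  by rewrite mulnCA leq_mul2l h1 orbT.
have e2 : sum_cost (acc_cost k) (accepts M) 0 <= C2 * (z * K).
  by apply: leq_trans (h2 k) _; rewrite leq_mul2l leq_pmull ?orbT.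
have e3 : z * bwd_cost M <= bwd_cost M * (z * K).
  by rewrite mulnC leq_mul2l leq_pmulr ?orbT ?f0.
have e4 : ccost start_bwd <= ccost start_bwd * (z * K) by rewrite leq_pmulr.
rewrite /D; move: K0 e1 e2 e3 e4; move: (z * K) => x.
move: (fwd_cost M k) (sum_cost _ _ _) (ccost _) (bwd_cost _) => a b c d.
by rewrite !mulnDl; lia.
Qed.
End Search.

(** * Correctness of the search and of the output *)

Lemma nmem_NSet (R : realDomainType) (s : state R) a i e b x :
  nmem (sem (NSet a i e) s) b x =
  if (b == a) && (x == neval s i) then neval s e else nmem s b x.
Proof. by []. Qed.

Lemma sem_start_bwd (R : realDomainType) M (s : state R) r rt q d :
  nmem s 7 1 = r -> nmem s 7 6 = rt ->
  onth (accepts M) (en_ch (tab s (nstates M) r)).-1 = Some (q, d) ->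
  let s' := sem (start_bwd M) s in
  [/\ wmem s' = wmem s, forall b x, b \notin [:: 4; 11; 12] -> nmem s' b x = nmem s b x,
      nmem s' 4 0 = 1, nmem s' 11 rt = q
    & nmem s' 12 rt = en_l (tab s (nstates M) r)].
Proof.
move=> h1 h6 ho s'.
set s1 := sem (NSet 12 (vr 6) (NGet (aL (nstates M)) (vr 1)))
  (sem (NSet 4 (NConst 0) (NConst 1)) s).
have sE b x : b \notin [:: 4; 12] -> nmem s1 b x = nmem s b x.
  by rewrite !inE negb_or => /andP[/negPf h4 /negPf h12]; rewrite /= /upd h4 h12.
have es' : s' = sem (NSet 11 (vr 6) (NConst q)) s1.
  transitivity (sem (dispatch (NSub (NGet (aD (nstates M)) (vr 1)) (NConst 1))
        (fun _ o => NSet 11 (vr 6) (NConst o.1)) (accepts M) 0) s1) => //.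
  apply: (sem_dispatch _ ho).
  transitivity (nmem s1 (aD (nstates M)) (nmem s1 7 1) - 1) => //.
  by rewrite !sE // h1 subn1.
have v6 : nmem s1 7 6 = rt by rewrite sE.
split.
- by rewrite es'.
- move=> b x; rewrite !inE !negb_or => /and3P[h4 /negPf h11 h12].
  by rewrite es' nmem_NSet h11 sE // !inE !negb_or h4.
- by rewrite es'.
- by rewrite es' nmem_NSet [neval s1 (vr 6)]v6 !eqxx.
- rewrite es' /=; transitivity (nmem s1 12 rt) => //.
  by rewrite /= /upd /= h6 h1 eqxx.
Qed.

Section Correctness.
Variables (R : realDomainType) (M : automaton) (n m : nat) (w : 'I_m -> R) (k : nat).
Hypothesis Mok : automaton_ok M.

Definition accepted (t : ptree n m) (vs : seq 'I_n) (es : seq 'I_m) : Prop :=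
  exists q d c, [/\ (q, d) \in accepts M, run M t q c vs es & k <= c + d].

(** Phrased for runs of an arbitrary automaton; trees of the graph enter only through [run_tree] and
    [tree_run]. *)
Definition program_post (t : ptree n m) (s : state R) : Prop :=
  if nmem s 4 0 != 0 then
    exists vs es, [/\ accepted t vs es,
      forall x, (nmem s 5 x != 0) = (x \in map val vs),
      forall x, (nmem s 6 x != 0) = (x \in map val es)
      & forall vs' es', accepted t vs' es' ->
          (\sum_(e <- es) w e <= \sum_(e <- es') w e)%R]
  else forall vs es, ~ accepted t vs es.

Lemma program_correct (t : ptree n m) (s : state R) :
  fits M t -> weighted w s -> nmem s 0 0 = k -> nmem s 0 3 = size (code t) ->
  codeat s 0 (code t) -> (forall b x, 4 <= b -> nmem s b x = 0) ->
  wp (program M) (program_cost M k (psize t)) s (program_post t).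
Proof.
move=> hfit hw hk hlen hcode h0.
apply: wp_sem_seq => //; set s1 := sem _ s.
have s1E b x : b != 7 -> nmem s1 b x = nmem s b x.
  by move=> /negPf hb; rewrite /= /upd hb.
have v2 : nmem s1 7 2 = k.+1 by rewrite /= /upd /= hk addn1.
have hf1 : fresh s1 0 by move=> q x _; exact: h0.
have hcode1 : codeat s1 0 (code t) by apply: codeat_low hcode => x; rewrite s1E.
apply: wp_seq.
have hw1 : weighted w s1 by exact: hw.
have v10 : nmem s1 7 0 = 0 by exact: h0.
have v11 : nmem s1 7 1 = 0 by exact: h0.
have h10 : nmem s1 0 0 = k by exact: hk.
apply: (fwd_tree Mok hfit hw1 hf1 h10 v2 v10 v11) => //.
- by rewrite s1E // hlen.
move=> s2 f2 v20 v21 hf2 gd; have [n2 w2 v22 _] := f2.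
rewrite !add0n in v20 v21 hf2.
apply: wp_while_false.
  by rewrite /= v20 n2 // s1E // hlen leqnn.
set r := psize t * k.+1 in v21 hf2.
apply: wp_sem_seq => //; set s3 := sem _ s2.
set rt := troot k 0 t.
have ert : rt + k.+1 = r by rewrite /rt troot_next.
have v36 : nmem s3 7 6 = rt by rewrite /= /upd /= v21 v22 v2 -ert addnK.
have v31 : nmem s3 7 1 = r by [].
have v32 : nmem s3 7 2 = k.+1 by transitivity (nmem s2 7 2) => //; rewrite v22.
have s3E b x : b != 7 -> nmem s3 b x = nmem s2 b x.
  by move=> /negPf hb; rewrite /= /upd hb.
have h30 : nmem s3 0 0 = k by rewrite s3E // n2 // s1E.
have gd3 : good M w k s3 t 0 0.
  by apply: good_frame gd => x _; rewrite !s3E.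
have ltr : rt + k < r by lia.
pose I ch (s' : state R) := [/\ only_table [:: 3] r k s3 s',
  sound s' r k (acc_entry M s3 k rt)
  & forall ch' o i, ch' < ch -> onth (accepts M) ch' = Some o -> i <= k ->
      acc_cover M s3 s' k r rt o i].
apply: wp_seq; apply: wp_weaken (wp_seqi (I := I) _ _) (leqnn _) _.
- move=> c o s' ho [o1 S1 C1].
  apply: wp_weaken (wp_acc_step h30 v31 v36 ltr ho o1 S1) (leqnn _) _.
  move=> s4 [o4 S4 m4 C4]; split=> // ch' o' i hc ho' hi.
  move: hc; rewrite ltnS leq_eqVlt => /orP[/eqP ec|hlt].
    by move: ho'; rewrite ec ho => -[<-]; apply: C4.
  by move=> d1 d2; exact: (m4 _ _ _ (C1 _ _ _ hlt ho' hi d1 d2)).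
- by split=> //; apply: fresh_sound => q x hx; exact: hf2.
move=> s4 [o4 S4 C4]; have [n4 w4 t4] := o4.
have v41 : nmem s4 7 1 = r by rewrite n4.
have v46 : nmem s4 7 6 = rt by rewrite n4.
have t4rt q c : c <= k -> tab s4 q (rt + c) = tab s3 q (rt + c).
  by move=> hc; apply: t4; apply/negP => /andP[]; lia.
have complete vs es : accepted t vs es ->
    covers s4 (nstates M) r (\sum_(e <- es) w e)%R.
  move=> [q [d [c [hin hrun hkc]]]].
  have [ch hch] := mem_onth hin.
  have [d1 l1] : covers s3 q (rt + minn k c) (\sum_(e <- es) w e)%R.
    by case: (t) gd3 hrun @rt {ert v36 ltr I v46 t4rt o4 S4 C4 n4 w4 t4 v41}
      => [? ? ?|? ? ? ?] [_ h _] hrun *; apply: h hrun.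
  (* Truncation at [k] does not affect whether the total count reaches [k]. *)
  have hkc' : k <= minn k c + d by lia.
  have [d2 l2] := C4 _ _ _ (onth_lt hch) hch (geq_minl k c) d1 hkc'.
  by split=> //; apply: le_trans l1.
have out0 : nmem s4 4 0 = 0 by rewrite n4 // s3E // n2 // s1E // h0.
have eg : beval s4 (BLe (NConst 1) (NGet (aD (nstates M)) (vr 1))) =
    (en_ch (tab s4 (nstates M) r) != 0).
  transitivity (0 < nmem s4 (aD (nstates M)) (nmem s4 7 1)) => //.
  by rewrite v41 lt0n.
case: (boolP (en_ch (tab s4 (nstates M) r) != 0)) => hd; last first.
  rewrite (negPf hd) in eg.
  apply: wp_weaken (wp_if_false _ (negbT eg)
    (wp_sem (Q := program_post t) (c := Skip) isT _)) _ (fun _ h => h).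
  - rewrite /program_post /= out0 /= => vs es /complete [h _].
    by rewrite h in hd.
  - by rewrite /=; lia.
rewrite hd in eg.
apply: (wp_if_true _ eg).
apply: wp_seq; apply: wp_sem; first exact: loopfree_dispatch.
have hd0 : en_ch (tab s4 (nstates M) (r + 0)) != 0 by rewrite addn0.
have [q [d [j1 j2 j3 j4 j5]]] := S4 _ _ (leq0n k) hd0.
rewrite !addn0 in j1 j2 j3 j4 j5.
have [z1 z2 z3 z4 z5] := sem_start_bwd v41 v46 j1.
set s5 := sem (start_bwd M) s4 in z1 z2 z3 z4 z5 *.
have t5 q' c : c <= k -> tab s5 q' (rt + c) = tab s3 q' (rt + c).
  by move=> hc; rewrite -t4rt // /tab z1 !z2.
have s5E b x : b \in [:: 0; 3; 5; 6; 9; 10] -> nmem s5 b x = nmem s3 b x.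
  move=> hb; rewrite z2; last by apply: contraTN hb; rewrite !inE; lia.
  by rewrite n4 //; move: hb; rewrite !inE; lia.
have gd5 : good M w k s5 t 0 0.
  apply: good_frame gd3 => x; rewrite add0n => /andP[_ hx].
  rewrite !s5E //; split=> // q'; rewrite /tab z1 !z2 //.
  by have := t4 q' x; rewrite /tab => -> //; apply/negP => /andP[]; rewrite /r; lia.
have hcode5 : codeat s5 0 (code t).
  by apply: codeat_low hcode1 => x; rewrite s5E // s3E // n2.
have v52 : nmem s5 7 2 = k.+1 by rewrite z2 // n4.
have v51 : nmem s5 7 1 = 0 + psize t * k.+1 by rewrite z2 // v41.
have [_ _ hacc] := Mok.
have qn : q < nstates M := hacc _ (onth_mem j1).
have d5 : en_ch (tab s5 q (rt + en_l (tab s4 (nstates M) r))) != 0 by rewrite t5.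
apply: (bwd_tree Mok hfit gd5 hcode5 v52 v51 z4 z5 j2 qn d5).
move=> s6 c' vs es hrun hc hW f6 v61.
apply: wp_while_false; first by rewrite /= v61.
have [n6 _ _ _ o6] := f6.
rewrite /program_post n6 // z3 /=; exists vs, es; split.
- by exists q, d, c'; split=> //; [exact: onth_mem j1 | lia].
- by move=> x; have [-> _] := o6 x; rewrite s5E // s3E // n2 // s1E // h0.
- by move=> x; have [_ ->] := o6 x; rewrite s5E // s3E // n2 // s1E // h0.
- move=> vs' es' /complete [_]; rewrite j5 -hW.
  by rewrite -/rt t5.
Qed.
End Correctness.

Theorem theorem1p5 (tau : nat) (Gamma : gclass) (hGamma : class_ok tau Gamma) :
  exists P : com, forall c : nat, exists C : nat,
    forall (R : realDomainType) (G : graph) (w : 'I_(ne G) -> R)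
           (t : ptree (nv G) (ne G)) (k : nat),
      (forall e, (0 <= w e)%R) -> 0 < k ->
      parses Gamma t -> psize t <= c * nv G ->
      exists (T : nat) (s : state R),
        [/\ exec P (input w t k) T s,
            T <= C * (nv G * k ^ 2)
          & solves_kmst w k s].
Proof.
set M := class_automaton tau Gamma.
have Mok : automaton_ok M := class_automaton_ok tau Gamma.
exists (program M) => c; have [C0 hC] := program_cost_bound M.
(* The factor [c] comes from the size of the parse tree, and 4 from (k + 1)^2 <= 4 k^2 for positive
   k. *)
exists (C0 * (c * 4)) => R G w t k w0 k0 hp hsz.
have hfit : fits M t.
  by case: (hp) => A [phi [hb _ _ _ _]]; have [] := build_wfn hGamma hb.
have hw : weighted w (input w t k).
  move=> e; rewrite /= (nth_map e) ?size_enum_ord ?ltn_ord //.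
  by rewrite nth_ord_enum.
have [||||T [s [hexec hT hpost]]] := @program_correct R M _ _ w k Mok t (input w t k) hfit hw.
- by [].
- by [].
- by move=> j _.
- by move=> b x hb; rewrite /= [nth [::] _ b]nth_default // nth_nil.
have sum_set (es : seq 'I_(ne G)) : uniq es ->
    weight w [set e in es] = (\sum_(e <- es) w e)%R.
  by move=> ue; rewrite /weight big_uniq //; apply: eq_bigl => e; rewrite inE.
have tree_acc S F : @is_tree G S F -> k <= #|S| ->
    exists vs es, accepted M k t vs es /\ (\sum_(e <- es) w e <= weight w F)%R.
  move=> ht hS; have [q [c0 [vs [es [d [h1 h2 h3 h4 h5]]]]]] := tree_run hGamma hp ht.
  exists vs, es; split; first by exists q, d, c0; rewrite -h3.
  (* The edges of [F] that the run leaves out are split off; their total weight is nonnegative. *)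
  rewrite -sum_set // /weight [X in (_ <= X)%R](bigID (mem [set e in es])) /=.
  rewrite -[X in (X <= _)%R]addr0 lerD ?sumr_ge0 // le_eqVlt.
  apply/orP; left; apply/eqP/eq_bigl => e; rewrite inE.
  by case: (boolP (e \in es)) => [/h5->|]; rewrite ?andbF.
exists T, s; split=> //.
- apply: leq_trans hT _; apply: leq_trans (hC k _ (psize_gt0 t)) _.
  rewrite -!mulnA leq_mul2l; apply/orP; right.
  have -> : c * (4 * (nv G * k ^ 2)) = (c * nv G) * (4 * k ^ 2) by lia.
  apply: leq_mul => //.
  by rewrite -[4]/(2 ^ 2) -expnMn leq_exp2r //; lia.
- move: hpost; rewrite /program_post /solves_kmst /out_found; case: ifP => hf.
    case=> vs [es [hacc h5 h6 hopt]].
    have -> : out_nodes G s = [set x in vs].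
      by apply/setP => x; rewrite !inE h5 mem_map //; apply: val_inj.
    have -> : out_edges G s = [set e in es].
      by apply/setP => x; rewrite !inE h6 mem_map //; apply: val_inj.
    case: (hacc) => q [d [c0 [hin hrun hk]]].
    have [ht hS ue] := run_tree hGamma hp hrun hin.
    split=> //; first by rewrite hS.
    move=> S' F' ht' hS'; have [vs' [es' [hacc' hle]]] := tree_acc _ _ ht' hS'.
    by rewrite sum_set //; apply: le_trans hle; apply: hopt hacc'.
  move=> hno S F ht; rewrite ltnNge; apply/negP => hS.
  by have [vs [es [hacc _]]] := tree_acc _ _ ht hS; apply: hno hacc.
Qed.
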